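(* Let $X(\cdot)$ and $\epsilon(\cdot)$ be independent zero-mean real stationary Gaussian processes with power spectral densities $S_X$ and $S_\epsilon$ (in the setting described in the context), let $f_s>0$, and let $S=(K_H,\Lambda)$ be a bounded linear sampler whose sampling set has upper symmetric density $d^+(\Lambda)\le f_s$. Then for every bitrate $R>0$, $$D(S,R)\;\ge\;D^\star(f_s,R).$$
   Context: Signal model. $X(\cdot)=\{X(t),t\in\mathbb R\}$ is a zero-mean real Gaussian stationary process with power spectral density (PSD) $S_X\in L_1(\mathbb R)$, i.e. $\mathbb E[X(t)X(s)]=\int_{-\infty}^{\infty}S_X(f)e^{2\pi i(t-s)f}\,df$, and variance $\sigma_X^2=\int S_X(f)\,df$. The noise $\epsilon(\cdot)$ is a zero-mean real Gaussian stationary process, independent of $X(\cdot)$, with PSD $S_\epsilon\in L_1(\mathbb R)$ (the case $\epsilon\equiv 0$ is allowed). Put $X_\epsilon(\cdot)=X(\cdot)+\epsilon(\cdot)$, $S_{X_\epsilon}=S_X+S_\epsilon$, and $$S_{X|X_\epsilon}(f)=\frac{S_X^2(f)}{S_X(f)+S_\epsilon(f)}$$ (taken as $0$ where $S_X(f)=0$). $\log$ is to base 2, $x^+=\max\{x,0\}$, $\log^+x=\max\{\log x,0\}$, and $\mu$ is Lebesgue measure. Linear functionals of the process. The closed linear span of $\{X_\epsilon(t)\}$ in $L_2$ of the probability space is isometric, via $X_\epsilon(t)\mapsto e^{2\pi i f t}$, to the closed linear span of $\{e^{2\pi i f t}\}_{t\in\mathbb R}$ in $L_2(\mathbb R,S_{X_\epsilon}(f)df)$.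 For a distribution $\phi$ whose Fourier transform $\hat\phi$ satisfies $\int|\hat\phi(f)|^2S_{X_\epsilon}(f)\,df<\infty$, the random variable $\int X_\epsilon(\tau)\phi^*(\tau)\,d\tau$ is defined as the element corresponding to the function $f\mapsto(\hat\phi(f))^*$ under this isometry. Bounded linear sampler. $S=(K_H,\Lambda)$ consists of a uniformly discrete set $\Lambda\subset\mathbb R$ (there is $\delta>0$ with $|t-s|>\delta$ for all distinct $t,s\in\Lambda$) and a kernel $K_H(t,s)$ such that for each $t_n\in\Lambda$, $K_H(t_n,\cdot)$ is a distribution satisfying the finiteness condition above. The sample at $t_n\in\Lambda$ is the real random variable $Y_n=\int_{-\infty}^\infty X_\epsilon(s)K_H(t_n,s)\,ds$. For $T>0$ put $\Lambda_T=\Lambda\cap[-T/2,T/2]$, $N_T=\mathrm{card}(\Lambda_T)$, and let $Y_T\in\mathbb R^{N_T}$ be the vector of samples $Y_n$ with $t_n\in\Lambda_T$. The upper symmetric density is $d^+(\Lambda)=\limsup_{T\to\infty}\mathrm{card}(\Lambda_T)/T$. Distortion. An encoder is a map $f:\mathbb R^{N_T}\to\{1,\ldots,2^{\lfloor TR\rfloor}\}$, a decoder is a map $g:\{1,\ldots,2^{\lfloor TR\rfloor}\}\to\mathbb R^{[-T/2,T/2]}$, and $\widehat X_T(\cdot)=g(f(Y_T))$. Define $$D_T(S,R)=\inf_{f,g}\frac1T\int_{-T/2}^{T/2}\mathbb E\big(X(t)-\widehat X_T(t)\big)^2dt,\qquad D(S,R)=\liminf_{T\to\infty}D_T(S,R).$$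 The function $D^\star$. Let $F^\star_{f_s}$ be a set with $\mu(F^\star_{f_s})\le f_s$ that maximizes $\int_F S_{X|X_\epsilon}(f)\,df$ over all measurable $F\subset\mathbb R$ with $\mu(F)\le f_s$. Then $$D^\star(f_s,R)=\sigma_X^2-\int_{F^\star_{f_s}}\big[S_{X|X_\epsilon}(f)-\theta\big]^+df,$$ where $\theta>0$ is determined by $R=\frac12\int_{F^\star_{f_s}}\log^+\big[S_{X|X_\epsilon}(f)/\theta\big]df$. *)

(* Defs.v *)
From HB Require Import structures.
From mathcomp Require Export all_boot all_order all_algebra.
From mathcomp Require Export all_classical all_reals all_analysis.
From mathcomp Require Export finmap complex.
Export Order.TTheory GRing.Theory Num.Theory.
Export numFieldNormedType.Exports.

Set Implicit Arguments.
Unset Strict Implicit.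
Unset Printing Implicit Defensive.

Local Open Scope classical_set_scope.
Local Open Scope ring_scope.

Section complex_calculus.
Context {R : realType}.
Implicit Types (psi h : R -> R[i]) (u : R -> R) (z : R[i]).

Definition cis (x : R) : R[i] := (cos x +i* sin x)%C.

Definition sqmod z : R := complex.Re z ^+ 2 + complex.Im z ^+ 2.

Definition cmeasurable h : Prop :=
  measurable_fun setT (fun x => complex.Re (h x)) /\
  measurable_fun setT (fun x => complex.Im (h x)).

Definition cintegrable h : Prop :=
  (@lebesgue_measure R).-integrable setT
    (fun x => (complex.Re (h x))%:E) /\
  (@lebesgue_measure R).-integrable setT
    (fun x => (complex.Im (h x))%:E).

Definition cintegral h : R[i] :=
  ((\int[@lebesgue_measure R]_(x in setT) complex.Re (h x)) +i*
   (\int[@lebesgue_measure R]_(x in setT) complex.Im (h x)))%C.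

(* The Schwartz seminorms of order at most N are bounded by B at u. *)
Definition seminorms_le (N : nat) (B : R) u : Prop :=
  forall k n : nat, (k <= N)%N -> (n <= N)%N ->
  forall x : R, `|x ^+ k * derive1n n u x| <= B.

Definition real_schwartz u : Prop :=
  (forall (n : nat) (x : R), derivable (derive1n n u) x 1) /\
  (forall N : nat, exists B : R, seminorms_le N B u).

Definition schwartz psi : Prop :=
  real_schwartz (fun x => complex.Re (psi x)) /\
  real_schwartz (fun x => complex.Im (psi x)).

(* Only the values of phi on Schwartz functions are meaningful. *)
Definition tempered_distribution (phi : (R -> R[i]) -> R[i]) : Prop :=
  (forall (a : R[i]) (psi1 psi2 : R -> R[i]), schwartz psi1 -> schwartz psi2 ->
     phi (fun x => a * psi1 x + psi2 x) = a * phi psi1 + phi psi2) /\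
  (exists (N : nat) (C : R), forall (psi : R -> R[i]) (B : R), schwartz psi ->
     seminorms_le N B (fun x => complex.Re (psi x)) ->
     seminorms_le N B (fun x => complex.Im (psi x)) ->
     `|phi psi| <= ((C * B)%:C)%C).

Definition conj_distribution (phi : (R -> R[i]) -> R[i]) :
    (R -> R[i]) -> R[i] :=
  fun psi => conjc (phi (fun x => conjc (psi x))).

Definition fourier psi : R -> R[i] :=
  fun f => cintegral (fun x => psi x * cis (- (2 * pi * f * x))).

(* The Fourier transform of the tempered distribution phi is the (locally
   integrable) function h: <phi, fourier psi> = \int h psi. *)
Definition fourier_transform_is (phi : (R -> R[i]) -> R[i]) h : Prop :=
  cmeasurable h /\
  (forall psi : R -> R[i], schwartz psi ->
     cintegrable (fun f => h f * psi f) /\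
     phi (fourier psi) = cintegral (fun f => h f * psi f)).

Definition weighted_sqnorm (S : R -> R) h : \bar R :=
  (\int[@lebesgue_measure R]_(f in setT) (sqmod (h f) * S f)%:E)%E.

Definition finiteness_condition (S : R -> R) (phi : (R -> R[i]) -> R[i]) : Prop :=
  exists h : R -> R[i],
    fourier_transform_is phi h /\ (weighted_sqnorm S h < +oo)%E.

End complex_calculus.

Section processes.
Context {R : realType} {d : measure_display} {Omega : measurableType d}.
Variable P : probability Omega R.

(* Constants are Gaussian; normal_prob m 0 is not the Dirac mass at m. *)
Definition gaussian_rv (Z : Omega -> R) : Prop :=
  exists m s : R, 0 <= s /\
    forall A : set R, measurable A ->
      P (Z @^-1` A) = if s == 0 then \d_m A else normal_prob m s A.

Definition gaussian_process (X : R -> {RV P >-> R}) : Prop :=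
  forall (n : nat) (c t : 'I_n -> R),
    gaussian_rv (fun w => \sum_(i < n) c i * X (t i) w).

Definition zero_mean (X : R -> {RV P >-> R}) : Prop :=
  forall t : R, ('E_P[X t] = 0)%E.

Definition stationary (X : R -> {RV P >-> R}) : Prop :=
  forall (n : nat) (t : 'I_n -> R) (tau : R) (A : 'I_n -> set R),
    (forall i, measurable (A i)) ->
    P [set w | forall i, A i (X (t i + tau) w)] =
    P [set w | forall i, A i (X (t i) w)].

Definition has_psd (X : R -> {RV P >-> R}) (S : R -> R) : Prop :=
  [/\ (forall f, 0 <= S f),
      (@lebesgue_measure R).-integrable setT (fun f => (S f)%:E) &
      forall t s : R, exists2 c : R,
        ('E_P[fun w => (X t w * X s w)%R] = c%:E)%E &
        (c%:C)%C =
          cintegral (fun f => ((S f)%:C)%C * cis (2 * pi * (t - s) * f))].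

(* Product rule on the finite-dimensional cylinders, which are pi-systems
   generating the sigma-algebras of the two processes. *)
Definition independent_processes (X Z : R -> {RV P >-> R}) : Prop :=
  forall (n m : nat) (t : 'I_n -> R) (s : 'I_m -> R)
         (A : 'I_n -> set R) (B : 'I_m -> set R),
    (forall i, measurable (A i)) -> (forall j, measurable (B j)) ->
    P ([set w | forall i, A i (X (t i) w)] `&`
       [set w | forall j, B j (Z (s j) w)]) =
    (P [set w | forall i, A i (X (t i) w)] *
     P [set w | forall j, B j (Z (s j) w)])%E.

(* A finite complex combination \sum_j c_j delta_(t_j), as the list of the
   pairs (c_j, t_j), seen in L2(P) and in L2(S df). *)
Definition time_combination (Z : R -> Omega -> R) (a : seq (R[i] * R)) :
    Omega -> R[i] :=
  fun w => \sum_(p <- a) p.1 * ((Z p.2 w)%:C)%C.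

Definition freq_combination (a : seq (R[i] * R)) : R -> R[i] :=
  fun f => \sum_(p <- a) p.1 * cis (2 * pi * f * p.2).

(* V is the image of h under the isometry between closed linear spans that
   extends Z t |-> (f |-> e^(2 pi i f t)) by linearity and continuity. *)
Definition spectral_correspondence (Z : R -> Omega -> R) (S : R -> R)
    (V : Omega -> R) (h : R -> R[i]) : Prop :=
  exists a : nat -> seq (R[i] * R),
    ((fun k => weighted_sqnorm S (fun f => h f - freq_combination (a k) f))
       @ \oo --> 0%E) /\
    ((fun k => ('E_P[fun w =>
        sqmod (((V w)%:C)%C - time_combination Z (a k) w)%R])%E) @ \oo --> 0%E).

(* V = \int Z(tau) phi^*(tau) dtau *)
Definition is_linear_functional (Z : R -> Omega -> R) (S : R -> R)
    (phi : (R -> R[i]) -> R[i]) (V : Omega -> R) : Prop :=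
  exists h : R -> R[i],
    [/\ fourier_transform_is phi h,
        (weighted_sqnorm S h < +oo)%E &
        spectral_correspondence Z S V (fun f => conjc (h f))].

End processes.

Section sampling.
Context {R : realType}.

Record sampler := Sampler {
  kernel : R -> (R -> R[i]) -> R[i] ;
  sampling_set : set R }.

Definition uniformly_discrete (Lambda : set R) : Prop :=
  exists2 delta : R, 0 < delta &
    forall t s : R, Lambda t -> Lambda s -> t != s -> delta < `|t - s|.

Definition bounded_linear_sampler (S_obs : R -> R) (S : sampler) : Prop :=
  uniformly_discrete (sampling_set S) /\
  (forall t : R, sampling_set S t ->
     tempered_distribution (kernel S t) /\
     finiteness_condition S_obs (kernel S t)).

(* An enumeration of Lambda_T, which is finite for uniformly discrete Lambda. *)
Definition sampling_times (Lambda : set R) (T : R) : seq R :=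
  enum_fset (fset_set (Lambda `&` `[- (T / 2), T / 2]%classic)).

Definition nb_samples (Lambda : set R) (T : R) : nat :=
  size (sampling_times Lambda T).

Definition upper_symmetric_density (Lambda : set R) : \bar R :=
  limf_esup (fun T : R => ((nb_samples Lambda T)%:R / T)%:E) (pinfty_nbhs R).

Context {d : measure_display} {Omega : measurableType d}.
Variable P : probability Omega R.

(* The sample Y_n at t_n is Y t_n; Y is irrelevant outside the sampling set.
   \int Z(s) K_H(t, s) ds is the functional of phi with phi^* = K_H(t, .). *)
Definition samples (Z : R -> Omega -> R) (S_obs : R -> R) (S : sampler)
    (Y : R -> {RV P >-> R}) : Prop :=
  forall t : R, sampling_set S t ->
    is_linear_functional P Z S_obs (conj_distribution (kernel S t)) (Y t).

Definition sample_vector (Lambda : set R) (Y : R -> {RV P >-> R}) (T : R)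
    (w : Omega) : (nb_samples Lambda T).-tuple R :=
  [tuple Y (tnth (in_tuple (sampling_times Lambda T)) i) w
    | i < nb_samples Lambda T].

Definition codebook_size (T rate : R) : nat := 2 ^ Num.truncn (T * rate).

Definition mean_square_error (X Xhat : R -> Omega -> R) (T : R) : \bar R :=
  ((T^-1)%:E * \int[@lebesgue_measure R]_(t in `[(- (T / 2))%R, (T / 2)%R])
    'E_P[fun w => ((X t w - Xhat t w) ^+ 2)%R])%E.

(* Encoders are Borel maps, so that the error is a random variable.  Decoders
   are unrestricted; if the error is not measurable in t, the integral above
   is a lower integral, which leaves the infimum unchanged since the
   conditional means are pointwise optimal and continuous in t. *)
Definition distortion_at (X : R -> {RV P >-> R}) (Lambda : set R)
    (Y : R -> {RV P >-> R}) (rate T : R) : \bar R :=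
  ereal_inf [set e : \bar R |
    exists (enc : (nb_samples Lambda T).-tuple R -> 'I_(codebook_size T rate))
           (dec : 'I_(codebook_size T rate) -> R -> R),
      (forall m, measurable (enc @^-1` [set m])) /\
      e = mean_square_error (fun t => X t)
            (fun t w => dec (enc (sample_vector Lambda Y T w)) t) T].

Definition distortion (X : R -> {RV P >-> R}) (Lambda : set R)
    (Y : R -> {RV P >-> R}) (rate : R) : \bar R :=
  limf_einf (distortion_at X Lambda Y rate) (pinfty_nbhs R).

End sampling.

Section dstar.
Context {R : realType}.

Definition log2 (x : R) : R := ln x / ln 2.

(* ln x = 0 for x <= 0, hence logp 0 = 0. *)
Definition logp (x : R) : R := Num.max (log2 x) 0.

(* Division by 0 yields 0, hence the value is 0 where S_X vanishes. *)
Definition S_cond (S_X S_eps : R -> R) : R -> R :=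
  fun f => S_X f ^+ 2 / (S_X f + S_eps f).

Definition optimal_passband (S : R -> R) (fs : R) (F : set R) : Prop :=
  [/\ measurable F, (@lebesgue_measure R F <= fs%:E)%E &
      forall G : set R, measurable G -> (@lebesgue_measure R G <= fs%:E)%E ->
        (\int[@lebesgue_measure R]_(f in G) (S f)%:E <=
         \int[@lebesgue_measure R]_(f in F) (S f)%:E)%E].

Definition is_Dstar (S_X S_eps : R -> R) (fs rate : R) (D : \bar R) : Prop :=
  exists (F : set R) (theta : R),
    [/\ optimal_passband (S_cond S_X S_eps) fs F,
        0 < theta,
        rate%:E = ((2^-1)%:E * \int[@lebesgue_measure R]_(f in F)
                     (logp (S_cond S_X S_eps f / theta))%:E)%E &
        D = (\int[@lebesgue_measure R]_(f in setT) (S_X f)%:E -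
             \int[@lebesgue_measure R]_(f in F)
               (Num.max (S_cond S_X S_eps f - theta) 0)%:E)%E].

End dstar.

(* Main.v *)
Require Import Defs.
From mathcomp Require Import ring lra measurable_realfun spectral.

(* placeholder *)

Set Implicit Arguments.
Unset Strict Implicit.
Unset Printing Implicit Defensive.

Local Open Scope classical_set_scope.
Local Open Scope ring_scope.

(** * Real-valued integrals *)

Section real_integrable.
Context {d : measure_display} {T : measurableType d} {R : realType}.
Implicit Types (mu : {measure set T -> \bar R}) (f g h : T -> R).

Definition intg mu f : Prop := mu.-integrable setT (EFin \o f).

Lemma intg_mfun mu f : intg mu f -> measurable_fun setT f.
Proof. by move/measurable_int/measurable_EFinP. Qed.

Lemma intg_le mu f g : measurable_fun setT f -> intg mu g ->
  (forall x, `|f x| <= g x) -> intg mu f.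
Proof.
move=> mf ig fg; apply: le_integrable ig => //; first exact/measurable_EFinP.
by move=> x _; rewrite lee_fin (le_trans (fg x))// ler_norm.
Qed.

Lemma intg_eq mu f g : intg mu f -> f =1 g -> intg mu g.
Proof. by move=> + /funext <-. Qed.

Lemma intg0 mu : intg mu (fun=> 0).
Proof. exact: integrable0. Qed.

Lemma intgD mu f g : intg mu f -> intg mu g -> intg mu (fun x => f x + g x).
Proof. by move=> fi gi; have := integrableD measurableT fi gi. Qed.

Lemma intgB mu f g : intg mu f -> intg mu g -> intg mu (fun x => f x - g x).
Proof. by move=> fi gi; have := integrableB measurableT fi gi. Qed.

Lemma intgZ mu (c : R) f : intg mu f -> intg mu (fun x => c * f x).
Proof. by move=> fi; have := integrableZl measurableT c fi. Qed.

Lemma intgZr mu (c : R) f : intg mu f -> intg mu (fun x => f x * c).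
Proof. by move/(intgZ c)/intg_eq; apply=> x; rewrite mulrC. Qed.

Lemma intgN mu f : intg mu f -> intg mu (fun x => - f x).
Proof. by move/(intgZ (-1))/intg_eq; apply=> x; rewrite mulN1r. Qed.

Lemma intg_sum mu (I : Type) (s : seq I) (Q : pred I) (F : I -> T -> R) :
  (forall i, Q i -> intg mu (F i)) ->
  intg mu (fun x => \sum_(i <- s | Q i) F i x).
Proof.
move=> iF; elim: s => [|i s ih].
  by apply: (intg_eq (intg0 mu)) => x; rewrite big_nil.
case: (boolP (Q i)) => Qi.
  by apply: (intg_eq (intgD (iF _ Qi) ih)) => x; rewrite big_cons Qi.
by apply: (intg_eq ih) => x; rewrite big_cons (negbTE Qi).
Qed.

Lemma intg_norm mu f : intg mu f -> intg mu (fun x => `|f x|).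
Proof. exact: integrable_norm. Qed.

Lemma intgMb mu f h (C : R) : intg mu f -> measurable_fun setT h ->
  (forall x, `|h x| <= C) -> intg mu (fun x => f x * h x).
Proof.
move=> fi mh hC; apply: (intg_le (g := fun x => C * `|f x|)).
- by apply: measurable_funM => //; exact: intg_mfun fi.
- exact/intgZ/intg_norm.
- by move=> x; rewrite normrM mulrC ler_wpM2r.
Qed.

Lemma intg_fin_num mu f : intg mu f -> (\int[mu]_x (f x)%:E)%E \is a fin_num.
Proof. by move=> fi; apply: integrable_fin_num. Qed.

Lemma RintE mu f : intg mu f -> (\int[mu]_x (f x)%:E)%E = (\int[mu]_x f x)%:E.
Proof. by move=> fi; rewrite fineK// intg_fin_num. Qed.

Lemma Rint_eq mu f g : f =1 g -> \int[mu]_x f x = \int[mu]_x g x.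
Proof. by move/funext ->. Qed.

Lemma RintD mu f g : intg mu f -> intg mu g ->
  \int[mu]_x (f x + g x) = \int[mu]_x f x + \int[mu]_x g x.
Proof. exact: RintegralD. Qed.

Lemma RintB mu f g : intg mu f -> intg mu g ->
  \int[mu]_x (f x - g x) = \int[mu]_x f x - \int[mu]_x g x.
Proof. exact: RintegralB. Qed.

Lemma RintZ mu (c : R) f : intg mu f ->
  \int[mu]_x (c * f x) = c * \int[mu]_x f x.
Proof. exact: RintegralZl. Qed.

Lemma RintZr mu (c : R) f : intg mu f ->
  \int[mu]_x (f x * c) = (\int[mu]_x f x) * c.
Proof. exact: RintegralZr. Qed.

Lemma Rint0 mu : \int[mu]_x (0 : R) = 0.
Proof. by rewrite /Rintegral integral0. Qed.

Lemma RintN mu f : intg mu f -> \int[mu]_x (- f x) = - \int[mu]_x f x.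
Proof.
move=> fi; rewrite -mulN1r -RintZ//; apply: Rint_eq => x.
by rewrite mulN1r.
Qed.

Lemma Rint_sum mu (I : Type) (s : seq I) (Q : pred I) (F : I -> T -> R) :
  (forall i, Q i -> intg mu (F i)) ->
  \int[mu]_x (\sum_(i <- s | Q i) F i x) = \sum_(i <- s | Q i) \int[mu]_x F i x.
Proof.
move=> iF; elim: s => [|i s ih].
  rewrite big_nil -[RHS](Rint0 mu); apply: Rint_eq => x; rewrite big_nil//.
rewrite big_cons -ih; case: ifPn => Qi.
  rewrite -RintD; [|exact: iF|exact: intg_sum].
  by apply: Rint_eq => x; rewrite big_cons Qi.
by apply: Rint_eq => x; rewrite big_cons (negbTE Qi).
Qed.

Lemma Rint_le mu f g : intg mu f -> intg mu g -> (forall x, f x <= g x) ->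
  \int[mu]_x f x <= \int[mu]_x g x.
Proof. by move=> fi gi fg; apply: le_Rintegral => // x _; exact: fg. Qed.

Lemma Rint_ge0 mu f : (forall x, 0 <= f x) -> 0 <= \int[mu]_x f x.
Proof. by move=> f0; apply: Rintegral_ge0 => x _. Qed.

Lemma Rint_abs mu f : intg mu f -> `|\int[mu]_x f x| <= \int[mu]_x `|f x|.
Proof. by move=> fi; apply: le_normr_Rintegral. Qed.

Lemma Rint_dct mu (F : nat -> T -> R) f g :
  (forall n, measurable_fun setT (F n)) ->
  (forall x, (F n x @[n --> \oo] --> f x)%classic) ->
  (forall n x, `|F n x| <= g x) -> intg mu g ->
  intg mu f /\ ((\int[mu]_x F n x) @[n --> \oo] --> (\int[mu]_x f x)).
Proof.
move=> mF Ff Fg ig.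
have mf : measurable_fun setT f.
  exact: (measurable_fun_cvg mF (fun x _ => Ff x)).
have mF' n : measurable_fun setT (EFin \o F n) by apply/measurable_EFinP.
have mf' : measurable_fun setT (EFin \o f) by apply/measurable_EFinP.
have Ff' : {ae mu, forall x, setT x -> (EFin \o F n) x @[n --> \oo] --> (EFin \o f) x}.
  by apply: aeW => x _; apply: cvg_EFin; [exact: nearW|exact: Ff].
have Fg' : {ae mu, forall x n, setT x -> (`|(EFin \o F n) x| <= (EFin \o g) x)%E}.
  by apply: aeW => x n _; rewrite /= lee_fin.
have [i1 _ i3] := dominated_convergence measurableT mF' mf' Ff' ig Fg'.
split=> //; apply: fine_cvg; rewrite fineK//; exact: intg_fin_num.
Qed.

End real_integrable.

Section real_fubini.
Context {d1 d2 : measure_display} {T1 : measurableType d1}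
  {T2 : measurableType d2} {R : realType}.

Lemma Rint_fubini (m1 : {sigma_finite_measure set T1 -> \bar R})
    (m2 : {sigma_finite_measure set T2 -> \bar R}) (f : T1 -> T2 -> R)
    (g : T1 -> R) (h : T2 -> R) :
  measurable_fun setT (fun z : T1 * T2 => f z.1 z.2) ->
  intg m1 g -> intg m2 h -> (forall x, 0 <= g x) -> (forall y, 0 <= h y) ->
  (forall x y, `|f x y| <= g x * h y) ->
  [/\ intg m1 (fun x => \int[m2]_y f x y), intg m2 (fun y => \int[m1]_x f x y) &
  \int[m1]_x (\int[m2]_y f x y) = \int[m2]_y (\int[m1]_x f x y)].
Proof.
move=> mf ig ih g0 h0 fgh.
have i2 x : intg m2 (fun y => f x y).
  apply: (intg_le (g := fun y => g x * h y)) => //; last exact: intgZ.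
  exact: (measurableT_comp mf (pair1_measurable x)).
have i1 y : intg m1 (fun x => f x y).
  apply: (intg_le (g := fun x => g x * h y)) => //; last exact: intgZr.
  exact: (measurableT_comp mf (pair2_measurable y)).
pose F (z : T1 * T2) := (f z.1 z.2)%:E.
have mF : measurable_fun setT F by apply/measurable_EFinP.
have iF : (m1 \x m2)%E.-integrable setT F.
  apply/integrable12ltyP; first exact: mF.
  apply: (@le_lt_trans _ _ (\int[m1]_x ((\int[m2]_y h y) * g x)%:E)%E); last first.
    rewrite RintE ?ltry//; exact: intgZ.
  apply: ge0_le_integral => //.
  - by move=> x _; apply: integral_ge0.
  - apply: (@measurable_fun_fubini_tonelli_F _ _ _ _ _ m2 (fun z => `|F z|%E)) => //.
    exact: (measurableT_comp (@abse_measurable _ setT) mF).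
  - by apply/measurable_EFinP/measurable_funM => //; exact: intg_mfun ig.
  - move=> x _; rewrite mulrC EFinM -RintE//.
    rewrite -ge0_integralZl//.
    + apply: ge0_le_integral => //.
      * apply: measurableT_comp => //; apply/measurable_EFinP.
        exact: intg_mfun (i2 x).
      * by apply/measurable_EFinP/measurable_funM => //; exact: intg_mfun ih.
      * by move=> y _; rewrite lee_fin.
    + by apply/measurable_EFinP; exact: intg_mfun ih.
    + by move=> y _; rewrite lee_fin.
    + by rewrite lee_fin.
have e1 : (fun x => \int[m2]_y F (x, y))%E = EFin \o (fun x => \int[m2]_y f x y).
  by apply/funext => x /=; rewrite -RintE.
have e2 : (fun y => \int[m1]_x F (x, y))%E = EFin \o (fun y => \int[m1]_x f x y).
  by apply/funext => y /=; rewrite -RintE.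
split.
- by rewrite /intg -e1; exact: integrable_fubini_F.
- apply: (intg_le (g := fun y => (\int[m1]_x g x) * h y)); last 2 first.
    exact: intgZ.
    move=> y; rewrite -RintZr//; apply: le_trans (Rint_abs (i1 y)) _.
    by apply: Rint_le; [exact: intg_norm|exact: intgZr|].
  apply/measurable_EFinP.
  by have := measurable_fubini_G iF; rewrite /fubini_G e2.
- have := Fubini iF.
  have -> : (fun x => \int[m2]_y F (x, y))%E = EFin \o (fun x => \int[m2]_y f x y) by [].
  by rewrite e2 /Rintegral => ->.
Qed.

End real_fubini.

Section probability_integrals.
Context {d : measure_display} {T : measurableType d} {R : realType}.
Variable P : probability T R.
Implicit Types (f g h : T -> R).

Lemma intg_cst (c : R) : intg P (fun=> c).
Proof. exact: finite_measure_integrable_cst. Qed.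

Lemma intg_bd f (C : R) : measurable_fun setT f -> (forall x, `|f x| <= C) ->
  intg P f.
Proof. by move=> mf fC; apply: intg_le (intg_cst C) _. Qed.

Lemma Rint_cst (c : R) : \int[P]_x c = c.
Proof. by rewrite Rintegral_cst//= [X in fine X]probability_setT mulr1. Qed.

Definition L2 f : Prop := measurable_fun setT f /\ intg P (fun x => f x ^+ 2).

Lemma L2_mfun f : L2 f -> measurable_fun setT f. Proof. by case. Qed.

Lemma L2_sqr f : L2 f -> intg P (fun x => f x ^+ 2). Proof. by case. Qed.

Lemma L2M f g : L2 f -> L2 g -> intg P (fun x => f x * g x).
Proof.
move=> [mf if2] [mg ig2].
apply: (intg_le (g := fun x => f x ^+ 2 + g x ^+ 2)).
- exact: measurable_funM.
- exact: intgD.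
- by move=> x; rewrite ler_norml; apply/andP; split; nra.
Qed.

Lemma L2_cst (c : R) : L2 (fun=> c).
Proof. by split=> //; exact: intg_cst. Qed.

Lemma L2_intg f : L2 f -> intg P f.
Proof. by move/L2M/(_ (L2_cst 1))/intg_eq; apply => x; rewrite mulr1. Qed.

Lemma L2Z (c : R) f : L2 f -> L2 (fun x => c * f x).
Proof.
move=> [mf if2]; split; first exact: measurable_funM.
by apply: intg_eq (intgZ (c ^+ 2) if2) _ => x; rewrite exprMn.
Qed.

Lemma L2D f g : L2 f -> L2 g -> L2 (fun x => f x + g x).
Proof.
move=> lf lg; split; first exact: measurable_funD (L2_mfun lf) (L2_mfun lg).
apply: intg_eq (intgD (intgD (L2_sqr lf) (L2_sqr lg)) (intgZ 2 (L2M lf lg))) _.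
by move=> x; ring.
Qed.

Lemma L2_eq f g : L2 f -> f =1 g -> L2 g.
Proof. by move=> + /funext <-. Qed.

Lemma L2B f g : L2 f -> L2 g -> L2 (fun x => f x - g x).
Proof.
by move=> lf /(L2Z (-1)) lg; apply: L2_eq (L2D lf lg) _ => x; rewrite mulN1r.
Qed.

Lemma L2_sum (I : Type) (s : seq I) (Q : pred I) (F : I -> T -> R) :
  (forall i, Q i -> L2 (F i)) -> L2 (fun x => \sum_(i <- s | Q i) F i x).
Proof.
move=> iF; elim: s => [|i s ih].
  by apply: (L2_eq (L2_cst 0)) => x; rewrite big_nil.
case: (boolP (Q i)) => Qi.
  by apply: (L2_eq (L2D (iF _ Qi) ih)) => x; rewrite big_cons Qi.
by apply: (L2_eq ih) => x; rewrite big_cons (negbTE Qi).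
Qed.

Lemma L2Mb f h (C : R) : L2 f -> measurable_fun setT h ->
  (forall x, `|h x| <= C) -> L2 (fun x => f x * h x).
Proof.
move=> [mf if2] mh hC; split; first exact: measurable_funM.
apply: intg_eq (intgMb (C := C ^+ 2) if2 (measurable_funX 2 mh) _) _ => x.
  by rewrite normrX lerXn2r// ?nnegrE// (le_trans _ (hC x)).
by rewrite exprMn.
Qed.

Lemma Rint_eq0_sqr f : L2 f -> \int[P]_x (f x ^+ 2) = 0 ->
  forall g, L2 g -> \int[P]_x (f x * g x) = 0.
Proof.
move=> lf f0 g lg.
have key (t : R) : 2 * (\int[P]_x (f x * g x)) * t <= \int[P]_x (g x ^+ 2).
  rewrite -subr_ge0; have := @Rint_ge0 _ _ _ P (fun x => (g x - t * f x) ^+ 2) _.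
  move=> /(_ (fun x => sqr_ge0 _)).
  have -> : \int[P]_x ((g x - t * f x) ^+ 2) = \int[P]_x (g x ^+ 2
      - (2 * t) * (f x * g x) + t ^+ 2 * f x ^+ 2) by apply: Rint_eq => x; ring.
  rewrite RintD ?RintB ?RintZ ?f0; first by move=> h; lra.
  all: try exact: L2_sqr. all: try exact: L2M.
  - exact/intgZ/L2M.
  - exact: intgB (L2_sqr lg) (intgZ _ (L2M lf lg)).
  - exact/intgZ/L2_sqr.
set a := \int[P]_x (f x * g x) in key *; set b := \int[P]_x (g x ^+ 2) in key.
apply/eqP; apply: contraT => a0.
have := key ((b + 1) / (2 * a)).
rewrite mulrC divfK; first by move=> h; lra.
by rewrite mulf_neq0.
Qed.

End probability_integrals.

Section transfer.
Context {d1 d2 d : measure_display} {T1 : measurableType d1}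
  {T2 : measurableType d2} {T : measurableType d} {R : realType}.

Lemma Rint_transfer (m1 : {measure set T1 -> \bar R})
    (m2 : {measure set T2 -> \bar R}) (r1 : T1 -> R) (r2 : T2 -> R)
    (Y1 : T1 -> T) (Y2 : T2 -> T) (f : T -> R) (C : R) :
  intg m1 r1 -> intg m2 r2 ->
  measurable_fun setT Y1 -> measurable_fun setT Y2 ->
  (forall D, measurable D ->
     \int[m1]_x (r1 x * \1_D (Y1 x)) = \int[m2]_x (r2 x * \1_D (Y2 x))) ->
  measurable_fun setT f -> (forall y, `|f y| <= C) ->
  \int[m1]_x (r1 x * f (Y1 x)) = \int[m2]_x (r2 x * f (Y2 x)).
Proof.
move=> i1 i2 mY1 mY2 eqD mf fC.
have mh : measurable_fun setT (fun y => f y + C) by exact: measurable_funD.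
pose h y := f y + C.
have h0 y : 0 <= h y by have := fC y; rewrite ler_norml /h => /andP[]; lra.
have hC y : h y <= 2 * C by have := fC y; rewrite ler_norml /h => /andP[]; lra.
pose D (N k : nat) := h @^-1` `[k%:R / N.+1%:R, k.+1%:R / N.+1%:R[%classic.
have mD N k : measurable (D N k) by rewrite -[D _ _]setTI; exact: mh.
pose K (N : nat) := (Num.truncn (N.+1%:R * (2 * C))).+1.
pose hN (N : nat) y : R := \sum_(k < K N) (k%:R / N.+1%:R) * \1_(D N k) y.
have hNE N y : hN N y = (Num.truncn (N.+1%:R * h y))%:R / N.+1%:R.
  have N0 : 0 < N.+1%:R :> R by [].
  have p0 : 0 <= N.+1%:R * h y by rewrite mulr_ge0// ltW.
  have kK : (Num.truncn (N.+1%:R * h y) < K N)%N.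
    by rewrite ltnS; apply: le_truncn; rewrite ler_pM2l.
  rewrite /hN (bigD1 (Ordinal kK))//= big1 ?addr0; last first.
    move=> k kn; rewrite indicE memNset ?mulr0//= /D /= in_itv/=.
    rewrite ler_pdivrMr// ltr_pdivlMr// ![_ * N.+1%:R]mulrC => /truncn_def.
    by move=> e; move/eqP: kn; apply; apply/val_inj.
  rewrite indicE mem_set ?mulr1//= /D/= in_itv/=.
  rewrite ler_pdivrMr// ltr_pdivlMr// ![_ * N.+1%:R]mulrC.
  exact: truncn_itv.
have hNb N y : `|h y - hN N y| <= N.+1%:R^-1.
  have N0 : 0 < N.+1%:R :> R by [].
  have p0 : 0 <= N.+1%:R * h y by rewrite mulr_ge0// ltW.
  rewrite hNE; have /andP[a b] := truncn_itv p0.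
  rewrite ger0_norm; last by rewrite subr_ge0 ler_pdivrMr// (mulrC (h y)).
  by rewrite lerBlDr -[X in X + _]mul1r -mulrDl ler_pdivlMr// (mulrC (h y)) nat1r ltW.
have mhN N : measurable_fun setT (hN N).
  apply: measurable_sum => k; apply: measurable_funM => //; exact: measurable_indic.
have e0 N : \int[m1]_x (r1 x * hN N (Y1 x)) = \int[m2]_x (r2 x * hN N (Y2 x)).
  have key d' (T' : measurableType d') (m : {measure set T' -> \bar R}) (r : T' -> R)
      (Y : T' -> T) : intg m r -> measurable_fun setT Y ->
      \int[m]_x (r x * hN N (Y x)) =
      \sum_(k < K N) (k%:R / N.+1%:R) * \int[m]_x (r x * \1_(D N k) (Y x)).
    move=> ir mY.
    have ik k : intg m (fun x => r x * \1_(D N k) (Y x)).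
      apply: (intgMb (C := 1)) => //.
        by apply: measurableT_comp => //; exact: measurable_indic.
      by move=> x; rewrite indicE; case: (_ \in _); rewrite ?normr1 ?normr0.
    under [RHS]eq_bigr do rewrite -RintZ//.
    rewrite -Rint_sum; last by move=> k _; exact: intgZ.
    apply: Rint_eq => x; rewrite /hN mulr_sumr; apply: eq_bigr => k _.
    by rewrite mulrCA.
  by rewrite !key//; apply: eq_bigr => k _; rewrite eqD.
have key2 d' (T' : measurableType d') (m : {measure set T' -> \bar R}) (r : T' -> R)
    (Y : T' -> T) N : intg m r -> measurable_fun setT Y ->
    `|\int[m]_x (r x * f (Y x)) + C * \int[m]_x r x
      - \int[m]_x (r x * hN N (Y x))| <= N.+1%:R^-1 * \int[m]_x `|r x|.
  move=> ir mY.
  have if' : intg m (fun x => r x * f (Y x)).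
    by apply: (intgMb (C := C)) => //; exact: measurableT_comp.
  have ih : intg m (fun x => r x * hN N (Y x)).
    apply: (intgMb (C := 2 * C + N.+1%:R^-1)) => //; first exact: measurableT_comp.
    move=> x; rewrite -[hN N (Y x)](subrK (h (Y x))) addrC.
    apply: (le_trans (ler_normD _ _)); rewrite lerD//; first by rewrite ger0_norm.
    by rewrite distrC.
  rewrite -RintZ// -RintD//; last exact: intgZ.
  rewrite -RintB//; last by apply: intgD => //; exact: intgZ.
  apply: le_trans (Rint_abs _) _.
    by apply: intgB => //; apply: intgD => //; exact: intgZ.
  rewrite -RintZ; last exact: intg_norm.
  apply: Rint_le.
  - by apply/intg_norm/intgB => //; apply: intgD => //; exact: intgZ.
  - exact/intgZ/intg_norm.
  - move=> x; rewrite (_ : _ - _ = r x * (h (Y x) - hN N (Y x))); last first.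
      by rewrite /h; ring.
    by rewrite normrM mulrC ler_wpM2r.
have eT : \int[m1]_x r1 x = \int[m2]_x r2 x.
  have := eqD _ measurableT; under eq_fun do rewrite indicT mulr1.
  under [in RHS]eq_fun do rewrite indicT mulr1.
  by [].
set I1 := \int[m1]_x (r1 x * f (Y1 x)); set I2 := \int[m2]_x _.
set A1 := \int[m1]_x `|r1 x|; set A2 := \int[m2]_x `|r2 x|.
have small N : `|I1 - I2| <= N.+1%:R^-1 * (A1 + A2).
  have := key2 _ _ m1 r1 Y1 N i1 mY1; have := key2 _ _ m2 r2 Y2 N i2 mY2.
  rewrite e0 eT -/I1 -/I2 -/A1 -/A2 => a b.
  rewrite mulrDr; apply: le_trans (lerD b a).
  rewrite -[X in _ <= _ + X]normrN; apply: le_trans _ (ler_normD _ _).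
  by rewrite le_eqVlt; apply/orP; left; apply/eqP; congr `|_|; ring.
apply/eqP; rewrite -subr_eq0 -normr_eq0; apply: contraT => n0.
have n0' : 0 < `|I1 - I2| by rewrite lt_def n0 normr_ge0.
have A0 : 0 <= A1 + A2 by rewrite addr_ge0// Rint_ge0.
have := small (Num.truncn ((A1 + A2) / `|I1 - I2|)).
rewrite ler_pdivlMl// mulrC -ler_pdivlMl// mulrC => /le_lt_trans.
by move=> /(_ _ (truncnS_gt _)); rewrite ltxx.
Qed.

End transfer.

(** * Cosine transforms and Fourier uniqueness *)

Lemma is_derive_continuous {R : realType} (F F' : R -> R) :
  (forall x : R, is_derive x 1 F (F' x)) -> continuous F.
Proof.
move=> dF x; apply: (@differentiable_continuous _ R^o R^o).
by apply/derivable1_diffP; case: (dF x).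
Qed.

Lemma cos_affine_is_derive {R : realType} (a b x : R) :
  is_derive x 1 (fun x : R => cos (a + b * x)) (- (b * sin (a + b * x))).
Proof.
have -> : (fun x : R => cos (a + b * x)) = cos \o (fun x => a + b * x) by [].
have h : is_derive x 1 (fun x : R => a + b * x) b.
  by apply: trigger_derive; rewrite /GRing.scale/=; ring.
apply: is_derive_eq (is_derive1_comp (is_derive_cos _) h) _.
by rewrite /GRing.scale/=; ring.
Qed.

Lemma sin_affine_is_derive {R : realType} (a b x : R) :
  is_derive x 1 (fun x : R => sin (a + b * x)) (b * cos (a + b * x)).
Proof.
have -> : (fun x : R => sin (a + b * x)) = sin \o (fun x => a + b * x) by [].
have h : is_derive x 1 (fun x : R => a + b * x) b.
  by apply: trigger_derive; rewrite /GRing.scale/=; ring.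
apply: is_derive_eq (is_derive1_comp (is_derive_sin _) h) _.
by rewrite /GRing.scale/=; ring.
Qed.

Lemma measurable_cos {R : realType} : measurable_fun setT (@cos R).
Proof. by apply: continuous_measurable_fun; exact: continuous_cos. Qed.

Lemma measurable_sin {R : realType} : measurable_fun setT (@sin R).
Proof. by apply: continuous_measurable_fun; exact: continuous_sin. Qed.

Lemma Rint_derive0 {R : realType} (F f : R -> R) (m : R) (C : R) :
  (forall x : R, is_derive x 1 F (f x)) -> continuous f ->
  intg lebesgue_measure f ->
  (forall x, `|F x| <= C / (1 + (x - m) ^+ 2)) ->
  \int[lebesgue_measure]_x f x = 0.
Proof.
move=> dF cf fi FC.
pose I (n : nat) := `[m - n.+1%:R, m + n.+1%:R]%classic.
have : (\int[lebesgue_measure]_x (f \_ (I n)) x) @[n --> \oo]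
    --> \int[lebesgue_measure]_x f x.
  have dct := @Rint_dct _ _ R lebesgue_measure (fun n => f \_ (I n)) f (fun x => `|f x|).
  refine (proj2 (dct _ _ _ _)).
  - move=> n; apply/(measurable_restrictT f); first exact: measurable_itv.
    by apply: (measurable_funS _ _ (intg_mfun fi)).
  - move=> x; apply: cvg_near_cst.
    exists (Num.truncn `|x - m|) => // n /= xn.
    rewrite patchE mem_set// /I/= in_itv/=.
    have : `|x - m| < n.+1%:R.
      by apply: lt_le_trans (truncnS_gt _) _; rewrite ler_nat ltnS.
    by rewrite ltr_norml => /andP[]; lra.
  - move=> n x; rewrite patchE; case: ifP => // _; rewrite normr0//.
  - exact: intg_norm.
have -> : (fun n => \int[lebesgue_measure]_x (f \_ (I n)) x) =
    (fun n : nat => F (m + n.+1%:R) - F (m - n.+1%:R)).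
  apply/funext => n; rewrite -Rintegral_mkcond /Rintegral.
  rewrite (@continuous_FTC2 _ f F)//.
  - have n0 : 0 < n.+1%:R :> R by []. lra.
  - exact: continuous_subspaceT.
  - split; first by move=> x _; case: (dF x).
    + apply: cvg_at_right_filter; exact: (is_derive_continuous dF).
    + apply: cvg_at_left_filter; exact: (is_derive_continuous dF).
  - by move=> x _; rewrite derive1E; apply: derive_val.
move=> lim1; apply: (cvg_unique _ lim1) => //; apply/cvgr0Pnorm_le => e e0.
exists (Num.truncn (2 * C / e)) => // n /= nC.
have n0 : 1 <= n.+1%:R :> R by rewrite ler1n.
have C0 : 0 <= C.
  have := FC m; rewrite subrr expr0n addr0 divr1; exact: le_trans.
have b1 (t : R) : `|t - m| = n.+1%:R -> `|F t| <= C / n.+1%:R.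
  move=> tm; apply: le_trans (FC t) _; apply: ler_wpM2l => //.
  have q : n.+1%:R <= 1 + (t - m) ^+ 2.
    by rewrite -[(t - m) ^+ 2]real_normK ?num_real// tm; nra.
  by rewrite lef_pV2 ?posrE//; lra.
apply: le_trans (ler_normB _ _) _.
apply: (@le_trans _ _ (C / n.+1%:R + C / n.+1%:R)).
  apply: lerD; apply: b1.
    by rewrite addrC addKr ger0_norm.
  by rewrite addrC addKr normrN ger0_norm.
have : 2 * C / e < n.+1%:R.
  by apply: lt_le_trans (truncnS_gt _) _; rewrite ler_nat ltnS.
rewrite ltr_pdivrMr// => h2.
have n0' : 0 < n.+1%:R :> R by [].
by rewrite -mulrDl ler_pdivrMr//; lra.
Qed.

Lemma div_halves {R : realType} (x c : R) : - x / c = - x / (2 * c) - x / (2 * c).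
Proof.
by rewrite -mulNr -mulrDl -mulr2n -[_ *+ 2]mulr_natl invfM mulrACA divff ?mul1r.
Qed.

Lemma le_abs_quadratic {R : realType} (y s : R) : s != 0 ->
  `|y| <= 2 * `|s| * (1 + y ^+ 2 / (2 * (s ^+ 2 *+ 2))).
Proof.
rewrite -normr_gt0 -[y ^+ 2]real_normK ?num_real// -[s ^+ 2]real_normK ?num_real//.
move: `|y| `|s| => a b b0; rewrite -[b ^+ 2 *+ 2]mulr_natr.
rewrite -(ler_pM2r (_ : 0 < 2 * b)); last by lra.
have -> : 2 * b * (1 + a ^+ 2 / (2 * (b ^+ 2 * 2))) * (2 * b) = 4 * b ^+ 2 + a ^+ 2.
  by field; rewrite gt_eqF.
nra.
Qed.

Section gaussian_cosine.
Context {R : realType}.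
Variables (m s : R).
Hypothesis s0 : s != 0.
Local Notation leb := (@lebesgue_measure R).
Local Notation pdf := (normal_pdf m s).

Let s2 : 0 < s ^+ 2. Proof. by rewrite exprn_even_gt0. Qed.

Lemma normal_pdf_is_derive (x : R) : is_derive x 1 pdf (- ((x - m) / s ^+ 2 * pdf x)).
Proof.
rewrite normal_pdfE//.
have -> : (fun x => normal_peak s * normal_fun m s x) =
  (fun x => normal_peak s * (expR \o (fun x => - (x - m) ^+ 2 / (s ^+ 2 *+ 2))) x) by [].
have h : is_derive x 1 (fun x : R => - (x - m) ^+ 2 / (s ^+ 2 *+ 2)) (- ((x - m) / s ^+ 2)).
  apply: trigger_derive; rewrite /GRing.scale/=.
  rewrite -mulr_natr; field. exact: s0.
have h2 := is_derive1_comp (is_derive_expR _) h.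
apply: is_derive_eq (is_deriveM (is_derive_cst (normal_peak s) x 1) h2) _.
rewrite /GRing.scale/= /normal_fun; ring.
Qed.

Lemma normal_pdf_decay : exists C, forall x,
  pdf x <= C / (1 + (x - m) ^+ 2).
Proof.
exists (normal_peak s * (1 + s ^+ 2 *+ 2)) => x; rewrite normal_pdfE//.
rewrite -mulrA ler_wpM2l ?normal_peak_ge0// /normal_fun.
have x0 := sqr_ge0 (x - m).
rewrite mulNr expRN.
have t0 : 0 < 1 + (x - m) ^+ 2 by lra.
have e1 : 1 + (x - m) ^+ 2 / (s ^+ 2 *+ 2) <= expR ((x - m) ^+ 2 / (s ^+ 2 *+ 2)).
  exact: expR_ge1Dx.
have q0 : 0 < s ^+ 2 *+ 2 by rewrite pmulrn_lgt0.
rewrite ler_pdivlMr// mulrC ler_pdivrMr ?expR_gt0//.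
have c0 : 0 <= 1 + s ^+ 2 *+ 2 by lra.
apply: le_trans (ler_wpM2l c0 e1).
have -> : (1 + s ^+ 2 *+ 2) * (1 + (x - m) ^+ 2 / (s ^+ 2 *+ 2)) =
  1 + (x - m) ^+ 2 + (s ^+ 2 *+ 2 + (x - m) ^+ 2 / (s ^+ 2 *+ 2)).
  by field.
by rewrite lerDl addr_ge0 ?divr_ge0// ltW.
Qed.

Lemma intg_normal_pdfMb (h : R -> R) C : measurable_fun setT h ->
  (forall x, `|h x| <= C) -> intg leb (fun x => pdf x * h x).
Proof. by move=> mh hC; apply: intgMb => //; exact: integrable_normal_pdf. Qed.

Lemma intg_normal_mean (h : R -> R) C : measurable_fun setT h ->
  (forall x, `|h x| <= C) -> intg leb (fun x => (x - m) * pdf x * h x).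
Proof.
move=> mh hC; apply: (intgMb (C := C)) => //.
pose s' := Num.sqrt 2 * s.
have s'0 : s' != 0 by rewrite mulf_neq0// gt_eqF// sqrtr_gt0.
apply: (@intg_le _ _ _ leb _ (fun x => (2 * `|s| * normal_peak s / normal_peak s') * normal_pdf m s' x)).
- apply: measurable_funM; last exact: measurable_normal_pdf.
  exact: measurable_funB.
- exact/intgZ/integrable_normal_pdf.
- move=> x; rewrite !normal_pdfE// [leRHS]mulrA divfK; last first.
    by rewrite gt_eqF// normal_peak_gt0.
  rewrite normrM (ger0_norm (x := normal_peak s * _)); last first.
    by rewrite mulr_ge0 ?normal_peak_ge0 ?normal_fun_ge0.
  rewrite mulrCA [leRHS]mulrAC [leRHS]mulrC ler_wpM2l ?normal_peak_ge0//.
  rewrite /normal_fun /s' exprMn sqr_sqrtr//.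
  set y := x - m.
  have -> : 2 * s ^+ 2 *+ 2 = 2 * (s ^+ 2 *+ 2) by rewrite mulrnAr.
  rewrite div_halves.
  rewrite expRD [leLHS]mulrA [leLHS]mulrAC. rewrite ler_wpM2r ?expR_ge0//.
  rewrite expRN ler_pdivrMr ?expR_gt0//.
  apply: le_trans (ler_wpM2l _ (expR_ge1Dx _)); last by rewrite mulr_ge0.
  exact: le_abs_quadratic.
Qed.

Let K (v u : R) := \int[leb]_x (pdf x * cos (v + u * (x - m))).

Let affine_measurable (v u : R) : measurable_fun setT (fun x : R => v + u * (x - m)).
Proof. by apply: measurable_funD => //; apply: measurable_funM => //; exact: measurable_funB. Qed.

Let mcos v u : measurable_fun setT (fun x : R => cos (v + u * (x - m))).
Proof. exact: measurableT_comp (measurable_cos) (affine_measurable v u). Qed.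

Let msin v u : measurable_fun setT (fun x : R => sin (v + u * (x - m))).
Proof. exact: measurableT_comp (measurable_sin) (affine_measurable v u). Qed.

Let K_parts v u : \int[leb]_x ((x - m) * pdf x * sin (v + u * (x - m))) = s ^+ 2 * u * K v u.
Proof.
have [C hC] := normal_pdf_decay.
pose F (x : R) : R := pdf x * sin (v - u * m + u * x).
pose f (x : R) : R := - ((x - m) / s ^+ 2 * pdf x) * sin (v - u * m + u * x)
  + pdf x * (u * cos (v - u * m + u * x)).
have E x : v - u * m + u * x = v + u * (x - m) by ring.
have dF (x : R) : is_derive x 1 F (f x).
  apply: is_derive_eq (is_deriveM (normal_pdf_is_derive x)
    (sin_affine_is_derive (v - u * m) u x)) _.
  by rewrite /f /GRing.scale/=; ring.
have i1 : intg leb (fun x => (x - m) * pdf x * sin (v + u * (x - m))).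
  by apply: intg_normal_mean (msin v u) _ => x; exact: sin_max.
have i2 : intg leb (fun x => pdf x * cos (v + u * (x - m))).
  by apply: intg_normal_pdfMb (mcos v u) _ => x; exact: cos_max.
have fE x : f x = - (s ^+ 2)^-1 * ((x - m) * pdf x * sin (v + u * (x - m))) +
    u * (pdf x * cos (v + u * (x - m))).
  by rewrite /f E; ring.
have := @Rint_derive0 R F f m C dF.
have -> : \int[leb]_x f x = - (s ^+ 2)^-1 * \int[leb]_x ((x - m) * pdf x * sin (v + u * (x - m)))
   + u * K v u.
  rewrite -RintZ// -RintZ// -RintD; [|exact: intgZ..].
  exact: Rint_eq.
move=> h; have {}h : - (s ^+ 2)^-1 * \int[leb]_x ((x - m) * pdf x * sin (v + u * (x - m)))
   + u * K v u = 0.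
  apply: h.
  - have cpdf : continuous pdf := is_derive_continuous normal_pdf_is_derive.
    have ccos := is_derive_continuous (cos_affine_is_derive (v - u * m) u).
    have csin := is_derive_continuous (sin_affine_is_derive (v - u * m) u).
    move=> x; apply: cvgD; apply: cvgM.
    + apply: cvgN; apply: cvgM; last exact: cpdf.
      apply: cvgM; last exact: cvg_cst.
      by apply: cvgB; [exact: cvg_id|exact: cvg_cst].
    + exact: csin.
    + exact: cpdf.
    + by apply: cvgM; [exact: cvg_cst|exact: ccos].
  - apply: intg_eq (intgD (intgZ (- (s ^+ 2)^-1) i1) (intgZ u i2)) _ => x.
    by rewrite fE.
  - move=> x; rewrite /F normrM (ger0_norm (normal_pdf_ge0 _ _ _)).
    apply: le_trans (hC x); rewrite ler_piMr ?normal_pdf_ge0//.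
    exact: sin_max.
set A := \int[leb]_x _ in h *; set B := K v u in h *.
apply: (mulfI (x := (s ^+ 2)^-1)); first by rewrite invr_eq0 lt0r_neq0.
rewrite -(mulrA (s ^+ 2)) mulKf ?lt0r_neq0//; lra.
Qed.

Let K_derive (v u : R) : is_derive u 1 (K v) (- (s ^+ 2 * u * K v u)).
Proof.
pose f (u x : R) : R := pdf x * cos (v + u * (x - m)).
have df (x u' : R) : is_derive u' 1 (f^~ x) (- ((x - m) * pdf x * sin (v + u' * (x - m)))).
  have E : f^~ x = (fun u' => pdf x * cos (v + (x - m) * u')).
    by apply/funext => u2; rewrite /f mulrC (mulrC u2) mulrC.
  rewrite E; apply: is_derive_eq (is_deriveM (is_derive_cst (pdf x) u' 1)
    (cos_affine_is_derive v (x - m) u')) _.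
  by rewrite /GRing.scale/= (mulrC u'); ring.
have i0 u' : intg leb (f u').
  by apply: intg_normal_pdfMb (mcos v u') _ => x; exact: cos_max.
have i1 : intg leb (fun x => `|(x - m) * pdf x * cst 1 x|).
  apply: intg_norm; apply: (intg_normal_mean (C := 1)) => // x.
  by rewrite normr1.
have u1 : u - 1 < u < u + 1 by lra.
have dd u' x : partial1of2 f u' x = - ((x - m) * pdf x * sin (v + u' * (x - m))).
  by rewrite /partial1of2 derive1E; have := df x u'; case.
have ub u' x : `|partial1of2 f u' x| <= `|(x - m) * pdf x * cst 1 x|.
  rewrite dd normrN normrM [leRHS]normrM ler_wpM2l//= normr1.
  exact: sin_max.
have Iu : `]u - 1, u + 1[%classic u by rewrite /= in_itv.
have dv x y : `]u - 1, u + 1[%classic x -> setT y -> derivable (f^~ y) x 1.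
  by move=> _ _; case: (df y x).
have D := @derivable_under_integral R _ _ leb f setT measurableT u (u - 1) (u + 1)
   Iu (fun x _ => i0 x) dv (fun x => `|(x - m) * pdf x * cst 1 x|)
   (fun x => normr_ge0 _) i1 (fun x y _ _ => ub x y).
have DE := @differentiation_under_integral R _ _ leb f setT measurableT u (u - 1) (u + 1)
   Iu (fun x _ => i0 x) dv (fun x => `|(x - m) * pdf x * cst 1 x|)
   (fun x => normr_ge0 _) i1 (fun x y _ _ => ub x y).
apply: DeriveDef => //.
rewrite -derive1E [LHS]DE.
rewrite -K_parts -RintN; last first.
  by apply: intg_normal_mean (msin v u) _ => x; exact: sin_max.
by apply: Rint_eq => x; rewrite dd.
Qed.

Lemma Rint_normal_cos v u : \int[leb]_x (pdf x * cos (v + u * x)) =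
  expR (- (s ^+ 2 * u ^+ 2) / 2) * cos (v + u * m).
Proof.
have -> : \int[leb]_x (pdf x * cos (v + u * x)) = K (v + u * m) u.
  by apply: Rint_eq => x; congr (_ * cos _); ring.
move: (v + u * m) => {}v.
pose G (u : R) : R := expR (s ^+ 2 * u ^+ 2 / 2) * K v u.
have dG (u' : R) : is_derive u' 1 G 0.
  have h : is_derive u' 1 (fun u : R => s ^+ 2 * u ^+ 2 / 2) (s ^+ 2 * u').
    by apply: trigger_derive; rewrite /GRing.scale/=; field.
  have h2 := is_derive1_comp (is_derive_expR _) h.
  apply: is_derive_eq (is_deriveM h2 (K_derive v u')) _.
  by rewrite /GRing.scale/=; ring.
have : G u = G 0 by apply: is_derive_0_is_cst.
rewrite /G expr0n/= mulr0 mul0r expR0 mul1r => e.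
have K0 : K v 0 = cos v.
  rewrite /K; under Rint_eq do rewrite mul0r addr0.
  rewrite RintZr; last exact: integrable_normal_pdf.
  by rewrite /Rintegral integral_normal_pdf mul1r.
rewrite -K0 -e mulrA mulNr expRN mulVf ?mul1r// gt_eqF// expR_gt0//.
Qed.

End gaussian_cosine.

Section gaussian_rv_cos.
Context {R : realType} {d : measure_display} {Omega : measurableType d}.
Variable P : probability Omega R.

Lemma gaussian_rv_cos (Z : Omega -> R) : measurable_fun setT Z ->
  gaussian_rv P Z -> exists m s : R, forall v u,
    \int[P]_w cos (v + u * Z w) = expR (- (s ^+ 2 * u ^+ 2) / 2) * cos (v + u * m).
Proof.
move=> mZ [m [s [s0 hZ]]]; exists m, s => v u.
have mc : measurable_fun setT (fun x : R => cos (v + u * x)).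
  apply: measurableT_comp measurable_cos _.
  by apply: measurable_funD => //; exact: measurable_funM.
have cb x : `|cos (v + u * x)| <= 1 by exact: cos_max.
have lhs : \int[P]_w cos (v + u * Z w) = \int[P]_w (1 * cos (v + u * Z w)).
  by apply: Rint_eq => w; rewrite mul1r.
have indE D : measurable D ->
    \int[P]_w (1 * \1_D (Z w)) = fine (P (Z @^-1` D)).
  move=> mD; rewrite /Rintegral.
  have -> : (\int[P]_w (1 * \1_D (Z w))%:E = \int[P]_w (\1_(Z @^-1` D) w)%:E)%E.
    by apply: eq_integral => w _; rewrite mul1r.
  rewrite integral_indic ?setIT//.
  by rewrite -[X in measurable X]setTI; exact: mZ.
rewrite {}lhs; have [se|sn] := eqVneq s 0.
  rewrite (@Rint_transfer _ _ _ _ _ _ _ P (dirac m) (fun=> 1) (fun=> 1) Z id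
    (fun x => cos (v + u * x)) 1)//.
  - under Rint_eq do rewrite mul1r.
    rewrite /Rintegral integral_dirac//=; last exact/measurable_EFinP.
    by rewrite indicT mul1r se expr0n/= mul0r oppr0 mul0r expR0 mul1r.
  - exact: intg_cst.
  - exact: (intg_cst (dirac m)).
  - move=> D mD; rewrite indE// hZ// se eqxx.
    under [RHS]Rint_eq do rewrite mul1r.
    by rewrite /Rintegral integral_indic ?setIT.
rewrite -Rint_normal_cos//.
apply: (@Rint_transfer _ _ _ _ _ _ _ P lebesgue_measure (fun=> 1) (normal_pdf m s) Z id
    (fun x => cos (v + u * x)) 1) => //.
- exact: intg_cst.
- exact: integrable_normal_pdf.
- move=> D mD; rewrite indE// hZ// (negbTE sn) /normal_prob /Rintegral.
  congr fine; rewrite [LHS]integral_mkcond; apply: eq_integral => x _.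
  by rewrite patchE indicE /id; case: (x \in D); rewrite ?mulr1 ?mulr0.
Qed.

End gaussian_rv_cos.

Section normal_concentration.
Context {R : realType}.
Local Notation leb := (@lebesgue_measure R).

Lemma normal_peak_sqrt2 (s : R) :
  normal_peak (Num.sqrt 2 * s) = normal_peak s / Num.sqrt 2.
Proof.
rewrite /normal_peak exprMn sqr_sqrtr// -mulrA -mulrnAr sqrtrM// invfM mulrC.
by rewrite mulrnAr.
Qed.

Lemma expRN_sqr_le (x s delta : R) : 0 < s -> 0 < delta -> delta <= `|x| ->
  expR (- (x ^+ 2 / (2 * (s ^+ 2 *+ 2)))) <= 4 * s ^+ 2 / delta ^+ 2.
Proof.
move=> s0 d0 dx; have s2 : 0 < s ^+ 2 by rewrite exprn_gt0.
have x2 : delta ^+ 2 <= x ^+ 2.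
  by rewrite -[x ^+ 2]real_normK ?num_real// lerXn2r// nnegrE// ltW.
have d2 : 0 < delta ^+ 2 by rewrite exprn_gt0.
have -> : 2 * (s ^+ 2 *+ 2) = 4 * s ^+ 2 by rewrite -mulr_natl; ring.
have t0 : 0 < x ^+ 2 / (4 * s ^+ 2) by apply: divr_gt0; lra.
rewrite expRN (le_trans (y := (x ^+ 2 / (4 * s ^+ 2))^-1))//.
  rewrite lef_pV2 ?posrE ?expR_gt0//; apply: le_trans (expR_ge1Dx _); lra.
by rewrite invf_div; apply: ler_wpM2l; [lra|rewrite lef_pV2 ?posrE//; lra].
Qed.

Lemma normal_tail (y s delta : R) (A : set R) : 0 < s -> 0 < delta ->
  measurable A -> (forall a, A a -> delta <= `|a - y|) ->
  \int[leb]_a (normal_pdf y s a * \1_A a) <= 8 * s ^+ 2 / delta ^+ 2.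
Proof.
move=> s0 d0 mA far; pose s' := Num.sqrt 2 * s.
have r0 : 0 < Num.sqrt 2 :> R by rewrite sqrtr_gt0.
have r2 : Num.sqrt 2 <= 2 :> R.
  by rewrite -[leRHS]ger0_norm// -sqrtr_sqr ler_sqrt//; lra.
have s'0 : s' != 0 by rewrite mulf_neq0// gt_eqF.
have sn0 : s != 0 by rewrite gt_eqF.
pose c := 8 * s ^+ 2 / delta ^+ 2.
have c0 : 0 <= c by rewrite divr_ge0// ?sqr_ge0// mulr_ge0// sqr_ge0.
apply: (@le_trans _ _ (\int[leb]_a (c * normal_pdf y s' a))); last first.
  rewrite RintZ; last exact: integrable_normal_pdf.
  by rewrite /Rintegral integral_normal_pdf mulr1.
apply: Rint_le.
- apply: (@intg_normal_pdfMb _ _ _ _ 1); first exact: measurable_indic.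
  by move=> x; rewrite indicE; case: (_ \in _); rewrite ?normr1 ?normr0.
- exact/intgZ/integrable_normal_pdf.
- move=> a; rewrite indicE; have [/set_mem Aa|_] := boolP (a \in A); last first.
    by rewrite mulr0 mulr_ge0// normal_pdf_ge0.
  rewrite mulr1 !normal_pdfE// normal_peak_sqrt2.
  rewrite /normal_fun /s' exprMn sqr_sqrtr//.
  have -> : 2 * s ^+ 2 *+ 2 = 2 * (s ^+ 2 *+ 2) by rewrite mulrnAr.
  rewrite div_halves.
  rewrite expRD [leLHS]mulrA [leLHS]mulrAC [leRHS]mulrA ler_wpM2r ?expR_ge0//.
  rewrite [leRHS]mulrA [leRHS]mulrAC [leRHS]mulrC ler_wpM2l ?normal_peak_ge0//.
  apply: le_trans (expRN_sqr_le s0 d0 (far _ Aa)) _.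
  rewrite ler_pdivlMr// [leLHS]mulrC /c mulrA ler_wpM2r ?invr_ge0 ?sqr_ge0//.
  rewrite mulrA ler_wpM2r ?sqr_ge0//; lra.
Qed.

End normal_concentration.

Section gaussian_mixture.
Context {R : realType} {d : measure_display} {Omega : measurableType d}.
Variable P : probability Omega R.

(* exp(- k x^2) is the average of cos(sqrt(2k) z x) over a standard normal z. *)
Lemma Rint_gaussian_mixture (rho Y : Omega -> R) (k a : R) : 0 <= k ->
  intg P rho -> measurable_fun setT Y ->
  \int[P]_w (rho w * expR (- (k * (Y w - a) ^+ 2))) =
  \int[lebesgue_measure]_z (normal_pdf 0 1 z *
     \int[P]_w (rho w * cos (Num.sqrt (2 * k) * z * (Y w - a)))).
Proof.
move=> k0 ir mY; pose t := Num.sqrt (2 * k).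
pose f w z := rho w * (normal_pdf 0 1 z * cos (t * z * (Y w - a))).
have m1 : measurable_fun setT (fun p : Omega * R => t * p.2 * (Y p.1 - a)).
  apply: measurable_funM; first exact: measurable_funM.
  apply: measurable_funB => //.
  exact: measurableT_comp mY measurable_fst.
have mf : measurable_fun setT (fun p : Omega * R => f p.1 p.2).
  apply: measurable_funM; first exact: measurableT_comp (intg_mfun ir) measurable_fst.
  apply: measurable_funM.
    exact: measurableT_comp (measurable_normal_pdf _ _) measurable_snd.
  exact: measurableT_comp measurable_cos m1.
have fb w z : `|f w z| <= `|rho w| * normal_pdf 0 1 z.
  rewrite /f !normrM (ger0_norm (normal_pdf_ge0 _ _ _)) ler_wpM2l//.
  by rewrite ler_piMr ?normal_pdf_ge0// cos_max.
have [_ _ F] := @Rint_fubini _ _ _ _ R P lebesgue_measure f (fun w => `|rho w|)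
  (fun z => normal_pdf 0 1 z) mf (intg_norm ir) (integrable_normal_pdf 0 1)
  (fun w => normr_ge0 _) (fun z => normal_pdf_ge0 0 1 z) fb.
transitivity (\int[P]_w \int[lebesgue_measure]_z f w z).
  apply: Rint_eq => w; rewrite /f RintZ; last first.
    apply: (@intg_normal_pdfMb _ _ _ _ 1); last by move=> z; exact: cos_max.
    exact: (measurableT_comp measurable_cos (measurableT_comp m1 (pair1_measurable w))).
  congr (_ * _).
  have -> : \int[lebesgue_measure]_z (normal_pdf 0 1 z * cos (t * z * (Y w - a))) =
     \int[lebesgue_measure]_z (normal_pdf 0 1 z * cos (0 + t * (Y w - a) * z)).
    by apply: Rint_eq => z; congr (_ * cos _); ring.
  rewrite Rint_normal_cos ?oner_eq0// mulr0 addr0 cos0 mulr1 exprMn.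
  rewrite sqr_sqrtr ?mulr_ge0//; by congr expR; field.
rewrite F; apply: Rint_eq => z; rewrite -RintZ.
  by apply: Rint_eq => w; rewrite /f mulrCA.
apply: (intgMb (C := 1) ir); last by move=> w; exact: cos_max.
exact: (measurableT_comp measurable_cos (measurableT_comp m1 (pair2_measurable z))).
Qed.

End gaussian_mixture.

Lemma cvg_le_harmonic {R : realType} (u : nat -> R) (l c : R) (N : nat) :
  (forall n, (N <= n)%N -> `|u n - l| <= c / n.+1%:R) -> u n @[n --> \oo] --> l.
Proof.
move=> h; have c0 : 0 <= c.
  have := le_trans (normr_ge0 _) (h N (leqnn N)).
  by rewrite pmulr_lge0// invr_gt0.
apply/cvgrPdist_le => e e0.
exists (maxn N (Num.truncn (c / e))) => // n /=; rewrite geq_max => /andP[Nn nc].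
rewrite distrC; apply: le_trans (h n Nn) _.
have n0 : 0 < n.+1%:R :> R by [].
rewrite ler_pdivrMr// mulrC -ler_pdivrMr//.
by apply/ltW/(lt_le_trans (truncnS_gt _)); rewrite ler_nat ltnS.
Qed.

Section uniqueness1.
Context {R : realType}.
Local Notation leb := (@lebesgue_measure R).

Lemma normal_prob_le1 (y s : R) (A : set R) : measurable A ->
  0 <= \int[leb]_a (normal_pdf y s a * \1_A a) <= 1.
Proof.
move=> mA; apply/andP; split.
  by apply: Rint_ge0 => a; rewrite mulr_ge0 ?normal_pdf_ge0.
have <- : \int[leb]_a normal_pdf y s a = 1.
  by rewrite /Rintegral integral_normal_pdf.
apply: Rint_le.
- apply: (@intg_normal_pdfMb _ _ _ _ 1); first exact: measurable_indic.
  by move=> x; rewrite indicE; case: (_ \in _); rewrite ?normr1 ?normr0.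
- exact: integrable_normal_pdf.
- by move=> a; rewrite ler_piMr ?normal_pdf_ge0.
Qed.

Lemma normal_probC (y s : R) (A : set R) : measurable A ->
  1 - \int[leb]_a (normal_pdf y s a * \1_A a) =
  \int[leb]_a (normal_pdf y s a * \1_(~` A) a).
Proof.
move=> mA.
have {1}<- : \int[leb]_a normal_pdf y s a = 1.
  by rewrite /Rintegral integral_normal_pdf.
rewrite -RintB; last 2 first.
- exact: integrable_normal_pdf.
- apply: (@intg_normal_pdfMb _ _ _ _ 1); first exact: measurable_indic.
  by move=> x; rewrite indicE; case: (_ \in _); rewrite ?normr1 ?normr0.
apply: Rint_eq => a; rewrite !indicE in_setC.
by case: (a \in A); rewrite /= ?mulr1 ?mulr0 ?subrr ?subr0.
Qed.

Let Iray (b : R) (n : nat) : set R := `[- n.+1%:R, b - n.+1%:R^-1]%classic.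

Lemma normal_smoothing_ray (y b : R) :
  \int[leb]_a (normal_pdf y (n.+1%:R^-1 ^+ 2) a * \1_(Iray b n) a) @[n --> \oo]
  --> (\1_(`]-oo, b[%classic) y : R).
Proof.
have mI n : measurable (Iray b n) by exact: measurable_itv.
have n1 n : 1 <= n.+1%:R :> R by rewrite ler1n.
have i0 n : 0 < n.+1%:R^-1 :> R by rewrite invr_gt0.
have i1 n : n.+1%:R^-1 <= 1 :> R by rewrite invf_le1.
have s0 n : 0 < n.+1%:R^-1 ^+ 2 :> R by rewrite exprn_gt0.
have [yb|by_] := ltP y b.
  rewrite indicE mem_set/=; last by rewrite /= in_itv.
  pose dl := (b - y) / 2.
  have d0 : 0 < dl by rewrite /dl; lra.
  apply: (@cvg_le_harmonic _ _ _ (8 / dl ^+ 2)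
    (maxn (Num.truncn dl^-1) (Num.truncn (`|y| + dl)))).
  move=> n; rewrite geq_max => /andP[h1 h2].
  have k1 : n.+1%:R^-1 <= dl.
    rewrite -[dl]invrK lef_pV2 ?posrE ?invr_gt0//.
    by apply/ltW/(lt_le_trans (truncnS_gt _)); rewrite ler_nat ltnS.
  have k2 : `|y| + dl <= n.+1%:R.
    by apply/ltW/(lt_le_trans (truncnS_gt _)); rewrite ler_nat ltnS.
  rewrite distrC normal_probC// ger0_norm; last first.
    by apply: Rint_ge0 => a; rewrite mulr_ge0 ?normal_pdf_ge0.
  apply: le_trans (@normal_tail _ y _ dl _ (s0 n) d0 _ _) _.
  - exact: measurableC.
  - move=> a /=; rewrite /Iray/= in_itv/= => /negP; rewrite negb_and -!ltNge.
    move: (i0 n) k1 k2; rewrite /dl => i00 k1 k2.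
    have yn := ler_norm (- y); have yp := ler_norm y; rewrite normrN in yn.
    move: k1 k2 i00; move: (n.+1%:R : R) => N k1 k2 i00.
    by case/orP => ?; rewrite ler_normr; apply/orP; [right|left]; lra.
  - move: (i0 n) (i1 n); move: (n.+1%:R^-1 : R) => q q0 q1.
    rewrite [leLHS]mulrAC; apply: ler_wpM2l.
      by rewrite divr_ge0// sqr_ge0.
    rewrite -exprM; apply: ler_iXnr => //; exact: ltW.
rewrite indicE memNset/=; last by rewrite /= in_itv/= ltNge by_.
apply: (@cvg_le_harmonic _ _ _ 8 0%N) => n _.
rewrite subr0 ger0_norm; last first.
  by apply: Rint_ge0 => a; rewrite mulr_ge0 ?normal_pdf_ge0.
apply: le_trans (@normal_tail _ y _ n.+1%:R^-1 _ (s0 n) (i0 n) (mI n) _) _.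
- move=> a; rewrite /Iray/= in_itv/= => /andP[_ h].
  rewrite ler_normr; apply/orP; right; move: h; move: (n.+1%:R^-1 : R) => q h; lra.
- move: (i0 n) (i1 n); move: (n.+1%:R^-1 : R) => q q0 q1.
  rewrite -mulrA ler_wpM2l// -exprM (_ : (2 * 2)%N = (2 + 2)%N)// exprD mulfK ?expf_neq0 ?gt_eqF//.
  by apply: ler_iXnr => //; exact: ltW.
Qed.

Context {d : measure_display} {Omega : measurableType d}.
Variable P : probability Omega R.

Lemma cos_orth_ray (rho Y : Omega -> R) (b : R) : intg P rho ->
  measurable_fun setT Y ->
  (forall v u, \int[P]_w (rho w * cos (v + u * Y w)) = 0) ->
  \int[P]_w (rho w * \1_(`]-oo, b[%classic) (Y w)) = 0.
Proof.
move=> ir mY orth.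
have H0 k a : 0 <= k -> \int[P]_w (rho w * expR (- (k * (Y w - a) ^+ 2))) = 0.
  move=> k0; rewrite Rint_gaussian_mixture// -[RHS](Rint0 leb).
  apply: Rint_eq => z; set t := Num.sqrt (2 * k).
  have -> : \int[P]_w (rho w * cos (t * z * (Y w - a))) =
     \int[P]_w (rho w * cos (- (t * z * a) + t * z * Y w)).
    by apply: Rint_eq => w; congr (_ * cos _); ring.
  by rewrite orth mulr0.
pose s (n : nat) : R := n.+1%:R^-1 ^+ 2.
have s0 n : 0 < s n by rewrite exprn_gt0.
pose f n w a := rho w * (normal_pdf (Y w) (s n) a * \1_(Iray b n) a).
have mI n : measurable (Iray b n) by exact: measurable_itv.
pose k n := (s n ^+ 2 *+ 2)^-1.
have pdfE n y a : normal_pdf y (s n) a = normal_peak (s n) * expR (- (k n * (y - a) ^+ 2)).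
  rewrite normal_pdfE ?gt_eqF//; congr (_ * expR _).
  by rewrite /k -sqrrN opprB; ring.
have mf n : measurable_fun setT (fun p : Omega * R => f n p.1 p.2).
  apply: measurable_funM; first exact: measurableT_comp (intg_mfun ir) measurable_fst.
  apply: measurable_funM; last first.
    have mi : measurable_fun setT (\1_(Iray b n) : R -> R) by exact: measurable_indic.
    exact: measurableT_comp mi measurable_snd.
  under eq_fun do rewrite pdfE; apply: measurable_funM => //.
  apply: measurableT_comp => //; apply: measurableT_comp => //.
  apply: measurable_funM => //; apply: measurable_funX; apply: measurable_funB => //.
  exact: measurableT_comp mY measurable_fst.
have iI n : intg leb (fun a => normal_peak (s n) * \1_(Iray b n) a).
  by apply: intgZ; exact: integrable_indic_itv.
have fb n w a : `|f n w a| <= `|rho w| * (normal_peak (s n) * \1_(Iray b n) a).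
  rewrite /f !normrM (ger0_norm (normal_pdf_ge0 _ _ _)) ler_wpM2l//.
  rewrite ger0_norm// ler_wpM2r// normal_pdf_ub// gt_eqF//.
have hge n a : 0 <= normal_peak (s n) * \1_(Iray b n) a.
  by rewrite mulr_ge0 ?normal_peak_ge0.
have fub n := @Rint_fubini _ _ _ _ R P leb (f n) (fun w => `|rho w|)
  (fun a => normal_peak (s n) * \1_(Iray b n) a) (mf n) (intg_norm ir) (iI n)
  (fun w => normr_ge0 _) (hge n) (fb n).
have inner n w : \int[leb]_a f n w a =
    rho w * \int[leb]_a (normal_pdf (Y w) (s n) a * \1_(Iray b n) a).
  rewrite RintZ//; apply: (@intg_normal_pdfMb _ _ _ _ 1); first exact: measurable_indic.
  by move=> x; rewrite indicE; case: (_ \in _); rewrite ?normr1 ?normr0.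
have F0 n : \int[P]_w (rho w *
    \int[leb]_a (normal_pdf (Y w) (s n) a * \1_(Iray b n) a)) = 0.
  have [_ _ F] := fub n.
  transitivity (\int[P]_w \int[leb]_a f n w a).
    by apply: Rint_eq => w; rewrite inner.
  rewrite F -[RHS](Rint0 leb); apply: Rint_eq => a.
  transitivity ((normal_peak (s n) * \1_(Iray b n) a) *
    \int[P]_w (rho w * expR (- (k n * (Y w - a) ^+ 2)))).
    rewrite -RintZ.
      by apply: Rint_eq => w; rewrite /f pdfE; ring.
    apply: (intgMb (C := 1)) => //.
      apply: measurableT_comp => //; apply: measurableT_comp => //.
      apply: measurable_funM => //; apply: measurable_funX; exact: measurable_funB.
    move=> w; rewrite ger0_norm ?expR_ge0// -[leRHS]expR0 ler_expR oppr_le0.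
    by rewrite mulr_ge0 ?sqr_ge0// invr_ge0 mulrn_wge0// sqr_ge0.
  by rewrite H0 ?mulr0// invr_ge0 mulrn_wge0// sqr_ge0.
pose Fn n w := rho w * \int[leb]_a (normal_pdf (Y w) (s n) a * \1_(Iray b n) a).
have mF n : measurable_fun setT (Fn n).
  by have [h _ _] := fub n; exact: intg_mfun (intg_eq h (inner n)).
have cF w : Fn n w @[n --> \oo] --> rho w * \1_(`]-oo, b[%classic) (Y w).
  by apply: cvgM; [exact: cvg_cst|exact: normal_smoothing_ray].
have bF n w : `|Fn n w| <= `|rho w|.
  rewrite normrM ler_piMr//.
  by have /andP[h1 h2] := normal_prob_le1 (Y w) (s n) (mI n); rewrite ger0_norm.
have [_ L] := Rint_dct mF cF bF (intg_norm ir).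
apply: (cvg_unique _ L) => //.
have -> : (fun n => \int[P]_w Fn n w) = (fun=> 0) by apply/funext => n; exact: F0.
exact: cvg_cst.
Qed.

End uniqueness1.

Section orthogonality.
Context {R : realType} {d : measure_display} {Omega : measurableType d}.
Variable P : probability Omega R.

Lemma indic_abs_le1 (T : Type) (A : set T) (x : T) : `|\1_A x : R| <= 1.
Proof. by rewrite indicE; case: (_ \in _); rewrite ?normr1 ?normr0. Qed.

Lemma measurable_indic_comp (d' : measure_display) (T : measurableType d')
    (Y : Omega -> T) (A : set T) : measurable_fun setT Y -> measurable A ->
  measurable_fun setT (fun w => \1_A (Y w) : R).
Proof.
move=> mY mA; have mi : measurable_fun setT (\1_A : T -> R).
  exact: measurable_indic.
exact: measurableT_comp mi mY.
Qed.

Lemma intg_indic_comp (d' : measure_display) (T : measurableType d')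
    (rho : Omega -> R) (Y : Omega -> T) (A : set T) : intg P rho ->
  measurable_fun setT Y -> measurable A -> intg P (fun w => rho w * \1_A (Y w)).
Proof.
move=> ir mY mA; apply: (intgMb (C := 1)) => //; first exact: measurable_indic_comp.
by move=> x; exact: indic_abs_le1.
Qed.

Lemma orth_dynkin (d' : measure_display) (T : measurableType d')
    (G : set (set T)) (rho : Omega -> R) (Y : Omega -> T) :
  @measurable _ T = <<s G >> -> setI_closed G ->
  intg P rho -> measurable_fun setT Y -> \int[P]_w rho w = 0 ->
  (forall A, G A -> \int[P]_w (rho w * \1_A (Y w)) = 0) ->
  forall A, measurable A -> \int[P]_w (rho w * \1_A (Y w)) = 0.
Proof.
move=> GE GI ir mY r0 GP A mA.
apply: (@dynkin_induction _ T G
  (fun A => \int[P]_w (rho w * \1_A (Y w)) = 0)) => //; last by rewrite -GE.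
- by rewrite -[RHS]r0; apply: Rint_eq => w; rewrite indicT mulr1.
- move=> S mS S0.
  transitivity (\int[P]_w (rho w - rho w * \1_S (Y w))).
    apply: Rint_eq => w; rewrite !indicE in_setC.
    by case: (_ \in _); rewrite /= ?mulr1 ?mulr0 ?subrr ?subr0.
  by rewrite RintB ?S0 ?r0 ?subr0//; exact: intg_indic_comp.
- move=> F mF tF F0.
  pose s n w : R := \sum_(k < n) \1_(F k) (Y w).
  have sE n w j : F j (Y w) -> s n w = (j < n)%N%:R.
    move=> Fj; rewrite /s.
    have z k : k != j -> \1_(F k) (Y w) = 0 :> R.
      move=> kj; rewrite indicE memNset// => Fk.
      by move/trivIsetP: tF => /(_ k j I I kj)/seteqP[+ _] => /(_ (Y w)); apply.
    have [jn|nj] := ltnP j n.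
      rewrite (bigD1 (Ordinal jn))//= big1 ?addr0.
        by rewrite indicE mem_set.
      by move=> k kj; apply: z; apply: contra_neq kj => e; apply/val_inj.
    by rewrite big1// => k _; apply: z; rewrite neq_ltn (leq_trans (ltn_ord k)).
  have sN n w : (forall j, ~ F j (Y w)) -> s n w = 0.
    by move=> h; rewrite /s big1// => k _; rewrite indicE memNset//; exact: h.
  have m1 n : measurable_fun setT (fun w => rho w * s n w).
    apply: measurable_funM; first exact: intg_mfun ir.
    by apply: measurable_sum => k; exact: measurable_indic_comp.
  have c1 w : rho w * s n w @[n --> \oo] --> rho w * \1_(\bigcup_k F k) (Y w).
    apply: cvgM; first exact: cvg_cst.
    have [[j _ Fj]|nF] := pselect ((\bigcup_k F k) (Y w)).
      rewrite indicE mem_set; last by exists j.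
      apply: cvg_near_cst; exists j.+1 => // n /= jn.
      by rewrite (sE _ _ j)// jn.
    rewrite indicE memNset//; apply: cvg_near_cst; exists 0%N => // n _.
    by apply: sN => j Fj; apply: nF; exists j.
  have b1 n w : `|rho w * s n w| <= `|rho w|.
    rewrite normrM ler_piMr//.
    have [[j Fj]|nF] := pselect (exists j, F j (Y w)).
      by rewrite (sE _ _ j)//; case: (j < n)%N; rewrite ?normr1 ?normr0.
    by rewrite sN ?normr0// => j Fj; apply: nF; exists j.
  have [_ L] := Rint_dct m1 c1 b1 (intg_norm ir).
  apply: (cvg_unique _ L) => //.
  have -> : (fun n => \int[P]_w (rho w * s n w)) = fun=> 0; last exact: cvg_cst.
  apply/funext => n; transitivity (\sum_(k < n) \int[P]_w (rho w * \1_(F k) (Y w))).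
    rewrite -Rint_sum; last by move=> k _; exact: intg_indic_comp.
    by apply: Rint_eq => w; rewrite mulr_sumr.
  by apply: big1 => k _; exact: F0.
Qed.

Lemma cos_orth_borel (rho Y : Omega -> R) : intg P rho ->
  measurable_fun setT Y ->
  (forall v u, \int[P]_w (rho w * cos (v + u * Y w)) = 0) ->
  forall A, measurable A -> \int[P]_w (rho w * \1_A (Y w)) = 0.
Proof.
move=> ir mY orth A mA.
apply: (@orth_dynkin _ _ (@RGenInftyO.G R)) => //.
- exact: RGenInftyO.measurableE.
- move=> _ _ [x ->] [y ->]; exists (Num.min x y).
  by apply/seteqP; split=> z /=; rewrite !in_itv/= lt_min => /andP.
- rewrite -[RHS](orth 0 0); apply: Rint_eq => w.
  by rewrite mul0r addr0 cos0 mulr1.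
- by move=> _ [b ->]; exact: cos_orth_ray.
Qed.

Definition tuple_of_fun (n : nat) (Y : 'I_n -> Omega -> R) (w : Omega) :
  n.-tuple R := [tuple Y i w | i < n].

Lemma measurable_tuple_of_fun (n : nat) (Y : 'I_n -> Omega -> R) :
  (forall i, measurable_fun setT (Y i)) -> measurable_fun setT (tuple_of_fun Y).
Proof.
move=> mY; apply/measurable_fun_tnthP => i.
by apply: eq_measurable_fun (mY i) => w _ /=; rewrite tnth_mktuple.
Qed.

Lemma box_orth (n : nat) (Y : 'I_n -> Omega -> R) (rho : Omega -> R) :
  intg P rho -> (forall i, measurable_fun setT (Y i)) ->
  (forall A : 'I_n -> set R, (forall i, measurable (A i)) ->
    \int[P]_w (rho w * \1_[set w | forall i, A i (Y i w)] w) = 0) ->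
  forall B, measurable B -> \int[P]_w (rho w * \1_B (tuple_of_fun Y w)) = 0.
Proof.
move=> ir mY orth B mB.
pose G := [set B : set (n.-tuple R) | exists A : 'I_n -> set R,
  (forall i, measurable (A i)) /\ B = [set t | forall i, A i (tnth t i)]].
apply: (@orth_dynkin _ _ G) => //.
- apply/seteqP; split.
  + apply: smallest_sub; first exact: smallest_sigma_algebra.
    move=> C; rewrite -bigcup_seq/= => -[i _ [D mD <-]].
    apply: sub_sigma_algebra; exists (fun j => if j == i then D else setT); split.
      by move=> j; case: ifP.
    rewrite setTI; apply/seteqP; split=> t /=.
      by move=> Dt j; case: ifP => // /eqP ->.
    by move/(_ i); rewrite eqxx.
  + apply: smallest_sub; first exact: sigma_algebra_measurable.
    move=> _ [A [mA ->]].
    have -> : [set t : n.-tuple R | forall i, A i (tnth t i)] =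
        \big[setI/setT]_(i < n) ((fun t => tnth t i) @^-1` A i).
      rewrite -bigcap_seq; apply/seteqP; split=> t /=; first by move=> h i _; exact: h.
      by move=> h i; apply: h; rewrite /= mem_index_enum.
    apply: bigsetI_measurable => i _.
    by rewrite -[X in measurable X]setTI; exact: measurable_tnth.
- move=> _ _ [A [mA ->]] [A' [mA' ->]]; exists (fun i => A i `&` A' i); split.
    by move=> i; exact: measurableI.
  apply/seteqP; split=> t /=; first by move=> [h h'] i; split.
  by move=> h; split=> i; have [] := h i.
- exact: measurable_tuple_of_fun.
- have := orth (fun=> setT) (fun=> measurableT).
  by move=> h; rewrite -[RHS]h; apply: Rint_eq => w; rewrite indicE mem_set ?mulr1.
- move=> _ [A [mA ->]]; rewrite -[RHS](orth A mA); apply: Rint_eq => w.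
  congr (_ * _); rewrite !indicE; congr (_%:R); congr nat_of_bool.
  by apply/idP/idP => /set_mem/= h; apply/mem_set => i; have := h i;
    rewrite /tuple_of_fun tnth_mktuple.
Qed.

Lemma box_orth_bounded (n : nat) (Y : 'I_n -> Omega -> R) (rho : Omega -> R)
    (f : n.-tuple R -> R) (C : R) :
  intg P rho -> (forall i, measurable_fun setT (Y i)) ->
  (forall A : 'I_n -> set R, (forall i, measurable (A i)) ->
    \int[P]_w (rho w * \1_[set w | forall i, A i (Y i w)] w) = 0) ->
  measurable_fun setT f -> (forall t, `|f t| <= C) ->
  \int[P]_w (rho w * f (tuple_of_fun Y w)) = 0.
Proof.
move=> ir mY orth mf fC.
rewrite (@Rint_transfer _ _ _ _ _ _ _ P P rho (fun=> 0) (tuple_of_fun Y)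
  (tuple_of_fun Y) f C)//.
- by rewrite -[RHS](Rint0 P); apply: Rint_eq => w; rewrite mul0r.
- exact: intg0.
- exact: measurable_tuple_of_fun.
- exact: measurable_tuple_of_fun.
- move=> D mD; rewrite box_orth//.
  by rewrite -[LHS](Rint0 P); apply: Rint_eq => w; rewrite mul0r.
Qed.

Lemma measurable_cos_sum (n : nat) (Q : pred 'I_n) (Y : 'I_n -> Omega -> R)
    (v : R) (u : 'I_n -> R) : (forall i, measurable_fun setT (Y i)) ->
  measurable_fun setT (fun w => cos (v + \sum_(i | Q i) u i * Y i w)).
Proof.
move=> mY; apply: measurableT_comp measurable_cos _; apply: measurable_funD => //.
under eq_fun do rewrite -big_filter.
by apply: measurable_sum => i; exact: measurable_funM.
Qed.

Lemma cos_orth_tuple (n : nat) (Y : 'I_n -> Omega -> R) (rho : Omega -> R) :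
  intg P rho -> (forall i, measurable_fun setT (Y i)) ->
  (forall (v : R) (u : 'I_n -> R),
    \int[P]_w (rho w * cos (v + \sum_i u i * Y i w)) = 0) ->
  forall B, measurable B -> \int[P]_w (rho w * \1_B (tuple_of_fun Y w)) = 0.
Proof.
move=> ir mY orth; apply: box_orth => // A mA.
pose pr k w : R := \prod_(i < n | (i < k)%N) \1_(A i) (Y i w).
have prb k w : `|pr k w| <= 1.
  rewrite /pr; elim/big_ind : _ => [|x y hx hy|i _]; first by rewrite normr1.
    by rewrite normrM mulr_ile1.
  exact: indic_abs_le1.
have mpr k : measurable_fun setT (pr k).
  rewrite /pr; under eq_fun do rewrite -big_filter.
  by apply: measurable_prod => i _; exact: measurable_indic_comp.
have key k : (k <= n)%N -> forall (v : R) (u : 'I_n -> R),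
    \int[P]_w (rho w * pr k w * cos (v + \sum_(i < n | (k <= i)%N) u i * Y i w)) = 0.
  elim: k => [_ v u|k IH kn v u].
    rewrite -[RHS](orth v u); apply: Rint_eq => w.
    by rewrite /pr big_pred0 ?mulr1.
  pose ok := Ordinal kn.
  have prS w : pr k.+1 w = pr k w * \1_(A ok) (Y ok w).
    rewrite /pr (bigD1 ok) ?ltnSn//= mulrC; congr (_ * _); apply: eq_bigl => i.
    by rewrite ltnS [in RHS]ltn_neqAle andbC.
  pose rho' w := rho w * pr k w * cos (v + \sum_(i < n | (k < i)%N) u i * Y i w).
  have ir' : intg P rho'.
    apply: (intgMb (C := 1)); [|exact: measurable_cos_sum|by move=> w; exact: cos_max].
    exact: (intgMb (C := 1)).
  have := @cos_orth_borel rho' (Y ok) ir' (mY ok) _ (A ok) (mA ok).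
  move=> h; rewrite -[RHS]h; last first.
    move=> v' u'.
    pose up i := if i == ok then u' else u i.
    pose um i := if i == ok then - u' else u i.
    have split_sum (f : 'I_n -> R) w :
        \sum_(i < n | (k <= i)%N) f i * Y i w = f ok * Y ok w + \sum_(i < n | (k < i)%N) f i * Y i w.
      rewrite (bigD1 ok)//=; congr (_ + _); apply: eq_bigl => i.
      by rewrite [in RHS]ltn_neqAle andbC eq_sym.
    have same (x : R) w : \sum_(i < n | (k < i)%N) (if i == ok then x else u i) * Y i w =
        \sum_(i < n | (k < i)%N) u i * Y i w.
      by apply: eq_bigr => i ki; case: eqP ki => // ->; rewrite /= ltnn.
    have E w : rho' w * cos (v' + u' * Y ok w) =
        2^-1 * (rho w * pr k w * cos (v + v' + \sum_(i < n | (k <= i)%N) up i * Y i w)) +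
        2^-1 * (rho w * pr k w * cos (v - v' + \sum_(i < n | (k <= i)%N) um i * Y i w)).
      rewrite !split_sum /up /um !same !eqxx /rho'.
      set S := \sum_(i < n | _) _; set y := Y ok w.
      have -> : v + v' + (u' * y + S) = (v + S) + (v' + u' * y) by ring.
      have -> : v - v' + (- u' * y + S) = (v + S) - (v' + u' * y) by ring.
      by move: (v + S) (v' + u' * y) => a b; rewrite cosD cosB; field.
    under Rint_eq do rewrite E.
    have ic (v2 : R) (u2 : 'I_n -> R) :
        intg P (fun w => rho w * pr k w * cos (v2 + \sum_(i < n | (k <= i)%N) u2 i * Y i w)).
      apply: (intgMb (C := 1)); [|exact: measurable_cos_sum|by move=> w; exact: cos_max].
      exact: (intgMb (C := 1)).
    rewrite RintD ?RintZ//; [|exact: intgZ..].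
    by rewrite !IH ?mulr0 ?addr0// ltnW.
  by apply: Rint_eq => w; rewrite prS /rho'; ring.
have := key n (leqnn n) 0 (fun=> 0); move=> h; rewrite -[RHS]h.
apply: Rint_eq => w; rewrite big1 ?addr0; last by move=> i _; rewrite mul0r.
rewrite cos0 mulr1; congr (_ * _); rewrite /pr indicE.
have [/set_mem/= Aw|] := boolP (w \in _).
  by rewrite big1// => i _; rewrite indicE mem_set.
move=> /negP nA; have [j nj] : exists j, ~ A j (Y j w).
  by apply/existsNP => h'; apply: nA; exact/mem_set.
by rewrite (bigD1 j)//= indicE memNset// mul0r.
Qed.

End orthogonality.

(** * Normal vectors and rate *)

Section gaussian_vector.
Context {R : realType} {d : measure_display} {Omega : measurableType d}.
Variable P : probability Omega R.

(* The weight with which a normal vector is tilted: up to a constant factor,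
   the ratio of the densities of N(m, s^2) and N(0, 1), with a = m / (1 - s^2). *)
Definition bump (s a x : R) : R := expR (- ((s ^- 2 - 1) / 2 * (x - a) ^+ 2)).

Definition bump_mean (s a : R) : R := s * expR (- ((1 - s ^+ 2) * a ^+ 2) / 2).

Lemma bump_exponent_ge0 (s : R) : 0 < s <= 1 -> 0 <= (s ^- 2 - 1) / 2.
Proof.
move=> /andP[s0 s1]; rewrite divr_ge0// subr_ge0 -exprVn exprn_ege1//.
by rewrite invf_ge1.
Qed.

Lemma bump_le1 (s a x : R) : 0 < s <= 1 -> 0 <= bump s a x <= 1.
Proof.
move=> s01; rewrite expR_ge0/= -[leRHS]expR0 ler_expR oppr_le0.
by rewrite mulr_ge0 ?sqr_ge0// bump_exponent_ge0.
Qed.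

Lemma bump_abs_le1 (s a x : R) : 0 < s <= 1 -> `|bump s a x| <= 1.
Proof. by move=> /(bump_le1 a x)/andP[b0 b1]; rewrite ger0_norm. Qed.

Lemma measurable_bump (s a : R) : measurable_fun setT (bump s a).
Proof.
apply: measurableT_comp => //; apply: measurableT_comp => //.
apply: measurable_funM => //; apply: measurable_funX; exact: measurable_funB.
Qed.

Lemma Rint_bump_cos (s a : R) : 0 < s <= 1 ->
  \int[lebesgue_measure]_z (normal_pdf 0 1 z *
    (expR (- ((s ^- 2 - 1) / 2 * 2 * z ^+ 2) / 2) *
     cos (Num.sqrt (2 * ((s ^- 2 - 1) / 2)) * z * a))) = bump_mean s a.
Proof.
move=> /andP[s0 s1]; set t := Num.sqrt _.
have s20 : s ^+ 2 != 0 by rewrite expf_neq0// gt_eqF.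
have s2 : 0 <= s ^- 2 - 1.
  have := @bump_exponent_ge0 s; rewrite s0 s1 => /(_ isT); lra.
have peakE : normal_peak 1 = s * normal_peak s :> R.
  rewrite /normal_peak expr1n mul1r -mulrnAr sqrtrM ?sqr_ge0// sqrtr_sqr.
  by rewrite ger0_norm ?ltW// invfM mulrA mulfV ?mul1r// gt_eqF.
transitivity (\int[lebesgue_measure]_z (s * (normal_pdf 0 s z * cos (0 + t * a * z)))).
  apply: Rint_eq => z; rewrite !normal_pdfE ?oner_eq0 ?gt_eqF// peakE.
  rewrite /normal_fun !subr0 expr1n.
  have e : - z ^+ 2 / (s ^+ 2 *+ 2) = - z ^+ 2 / (1 *+ 2) + - ((s ^- 2 - 1) / 2 * 2 * z ^+ 2) / 2.
    by rewrite -[s ^+ 2 *+ 2]mulr_natr; field; rewrite gt_eqF.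
  by rewrite e expRD add0r (_ : t * z * a = t * a * z); ring.
rewrite RintZ; last first.
  apply: (@intg_normal_pdfMb _ _ _ _ 1); last by move=> z; exact: cos_max.
  apply: measurableT_comp measurable_cos _.
  by apply: measurable_funD => //; exact: measurable_funM.
rewrite Rint_normal_cos ?gt_eqF// mulr0 addr0 cos0 mulr1 /bump_mean.
rewrite exprMn sqr_sqrtr; last by lra.
congr (_ * expR _); by field; rewrite gt_eqF.
Qed.

Definition standard_normal_cos (r : nat) (g : 'I_r -> Omega -> R) : Prop :=
  forall (v : R) (u : 'I_r -> R),
    \int[P]_w cos (v + \sum_i u i * g i w) =
    expR (- (\sum_i u i ^+ 2) / 2) * cos v.

Lemma Rint_prod_bump (r : nat) (g : 'I_r -> Omega -> R) (s a : 'I_r -> R) :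
  (forall i, measurable_fun setT (g i)) -> standard_normal_cos g ->
  (forall i, 0 < s i <= 1) ->
  \int[P]_w \prod_i bump (s i) (a i) (g i w) = \prod_i bump_mean (s i) (a i).
Proof.
move=> mg std s01.
pose W k w : R := \prod_(i < r | (i < k)%N) bump (s i) (a i) (g i w).
pose c k : R := \prod_(i < r | (i < k)%N) bump_mean (s i) (a i).
have Wb k w : `|W k w| <= 1.
  rewrite /W; elim/big_ind : _ => [|x y hx hy|i _]; first by rewrite normr1.
    by rewrite normrM mulr_ile1.
  exact: bump_abs_le1.
have mW k : measurable_fun setT (W k).
  rewrite /W; under eq_fun do rewrite -big_filter.
  apply: measurable_prod => i _.
  exact: measurableT_comp (measurable_bump _ _) (mg i).
have key k : (k <= r)%N -> forall (v : R) (u : 'I_r -> R),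
    \int[P]_w (W k w * cos (v + \sum_(i < r | (k <= i)%N) u i * g i w)) =
    c k * (expR (- (\sum_(i < r | (k <= i)%N) u i ^+ 2) / 2) * cos v).
  elim: k => [_ v u|k IH kr v u].
    rewrite /c big_pred0// mul1r -std; apply: Rint_eq => w.
    by rewrite /W big_pred0// mul1r.
  pose ok := Ordinal kr.
  have lt_iff (i : 'I_r) : (i < k.+1)%N && (i != ok) = (i < k)%N.
    by rewrite ltnS [in RHS]ltn_neqAle andbC.
  have gt_iff (i : 'I_r) : (k <= i)%N && (i != ok) = (k < i)%N.
    by rewrite [in RHS]ltn_neqAle andbC eq_sym.
  have WS w : W k.+1 w = W k w * bump (s ok) (a ok) (g ok w).
    by rewrite /W (bigD1 ok) ?ltnSn//= mulrC; congr (_ * _); apply: eq_bigl.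
  have cS : c k.+1 = c k * bump_mean (s ok) (a ok).
    by rewrite /c (bigD1 ok) ?ltnSn//= mulrC; congr (_ * _); apply: eq_bigl.
  pose rho w := W k w * cos (v + \sum_(i < r | (k < i)%N) u i * g i w).
  have irho : intg P rho.
    apply: (@intg_bd _ _ _ P _ 1).
      by apply: measurable_funM => //; exact: measurable_cos_sum.
    by move=> w; rewrite normrM mulr_ile1// cos_max.
  pose kap := (s ok ^- 2 - 1) / 2.
  have kap0 : 0 <= kap by exact: bump_exponent_ge0.
  transitivity (\int[P]_w (rho w * expR (- (kap * (g ok w - a ok) ^+ 2)))).
    by apply: Rint_eq => w; rewrite WS /rho /bump; ring.
  rewrite Rint_gaussian_mixture// cS -(Rint_bump_cos (a ok) (s01 ok)) -/kap.
  set t := Num.sqrt (2 * kap).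
  set E := expR (- (\sum_(i < r | (k < i)%N) u i ^+ 2) / 2).
  set J := (X in _ = c k * X * _).
  have -> : c k * J * (E * cos v) = c k * E * cos v * J by ring.
  rewrite -RintZ; last first.
    apply: (@intg_normal_pdfMb _ _ _ _ 1).
      apply: measurable_funM.
        apply: measurableT_comp => //; apply: measurable_funM => //.
        by apply: measurableT_comp => //; apply: measurable_funM => //; exact: measurable_funX.
      apply: measurableT_comp measurable_cos _; apply: measurable_funM => //; exact: measurable_funM.
    move=> z; rewrite normrM mulr_ile1 ?cos_max// ger0_norm ?expR_ge0//.
    rewrite -[leRHS]expR0 ler_expR mulNr oppr_le0 divr_ge0//.
    by apply: mulr_ge0; [exact: mulr_ge0|exact: sqr_ge0].
  apply: Rint_eq => z.
  pose up x (i : 'I_r) := if i == ok then x else u i.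
  have upk x : up x ok = x by rewrite /up eqxx.
  have split_sum (F : 'I_r -> R) :
      \sum_(i < r | (k <= i)%N) F i = F ok + \sum_(i < r | (k < i)%N) F i.
    by rewrite (bigD1 ok)//=; congr (_ + _); apply: eq_bigl.
  have same (F : 'I_r -> R -> R) x : \sum_(i < r | (k < i)%N) F i (up x i) =
      \sum_(i < r | (k < i)%N) F i (u i).
    by apply: eq_bigr => i ki; rewrite /up; case: eqP ki => // ->; rewrite /= ltnn.
  have EE x v2 : \int[P]_w (W k w * cos (v2 + (x * g ok w +
      \sum_(i < r | (k < i)%N) u i * g i w))) =
      c k * (expR (- (x ^+ 2) / 2) * E * cos v2).
    have := IH (ltnW kr) v2 (up x).
    rewrite (split_sum (fun i => up x i ^+ 2)) (same (fun _ y => y ^+ 2)).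
    rewrite upk opprD mulrDl expRD -/E => <-; apply: Rint_eq => w.
    rewrite (split_sum (fun i => up x i * g i w)) (same (fun i y => y * g i w)).
    by rewrite upk.
  have ie x v2 : intg P (fun w => W k w * cos (v2 + (x * g ok w +
      \sum_(i < r | (k < i)%N) u i * g i w))).
    apply: (@intg_bd _ _ _ P _ 1); last by move=> w; rewrite normrM mulr_ile1// cos_max.
    apply: measurable_funM => //; apply: measurableT_comp measurable_cos _.
    apply: measurable_funD => //; apply: measurable_funD; first exact: measurable_funM.
    under eq_fun do rewrite -big_filter.
    by apply: measurable_sum => i; exact: measurable_funM.
  transitivity (normal_pdf 0 1 z * \int[P]_w (
     2^-1 * (W k w * cos (v - t * z * a ok + (t * z * g ok w +
       \sum_(i < r | (k < i)%N) u i * g i w))) +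
     2^-1 * (W k w * cos (v + t * z * a ok + ((- (t * z)) * g ok w +
       \sum_(i < r | (k < i)%N) u i * g i w))))).
    congr (_ * _); apply: Rint_eq => w; rewrite /rho.
    set S := \sum_(i < r | _) _; set y := g ok w.
    have -> : v - t * z * a ok + (t * z * y + S) = (v + S) + t * z * (y - a ok) by ring.
    have -> : v + t * z * a ok + (- (t * z) * y + S) = (v + S) - t * z * (y - a ok) by ring.
    by move: (v + S) (t * z * (y - a ok)) => p q; rewrite cosD cosB; field.
  rewrite RintD ?RintZ//; [|exact: intgZ..].
  rewrite !EE cosB cosD sqrrN exprMn sqr_sqrtr; last by rewrite mulr_ge0.
  by rewrite [kap * 2]mulrC; field.
have := key r (leqnn r) 0 (fun=> 0).
have -> : \sum_(i < r | (r <= i)%N) (0 : R) ^+ 2 = 0.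
  by rewrite big1// => i _; rewrite expr0n.
rewrite cos0 mulr1 oppr0 mul0r expR0 mulr1 => h.
transitivity (c r); last by apply: eq_bigl => i; rewrite ltn_ord.
rewrite -h; apply: Rint_eq => w.
have -> : \sum_(i < r | (r <= i)%N) 0 * g i w = 0.
  by rewrite big1// => i _; rewrite mul0r.
by rewrite addr0 cos0 mulr1; apply: eq_bigl => i; rewrite ltn_ord.
Qed.

End gaussian_vector.

Section cells.
Context {R : realType} {d : measure_display} {Omega : measurableType d}.
Variable P : probability Omega R.

Lemma L2_indic (A : set Omega) : measurable A -> L2 P (\1_A : Omega -> R).
Proof.
move=> mA; apply: (L2_eq (f := fun w => (cst 1 w : R) * \1_A w)); last first.
  by move=> w; rewrite mul1r.
apply: (L2Mb (C := 1)); first exact: L2_cst.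
  exact: measurable_indic.
by move=> w; exact: indic_abs_le1.
Qed.

(* Gibbs' variational inequality for the conditioning on an event. *)
Lemma event_tilt_le (A : set Omega) (H : Omega -> R) (K : R) : measurable A ->
  measurable_fun setT H -> (forall w, expR (H w) <= K) ->
  \int[P]_w expR (H w) <= 1 -> intg P (fun w => H w * \1_A w) ->
  \int[P]_w (H w * \1_A w) <=
    - (\int[P]_w \1_A w * ln (\int[P]_w \1_A w)).
Proof.
move=> mA mH HK e1 iH; set p := \int[P]_w \1_A w.
have iA : intg P (\1_A : Omega -> R) by exact/L2_intg/L2_indic.
have p0 : 0 <= p by apply: Rint_ge0.
set h := \int[P]_w _.
have [pz|pn] := eqVneq p 0.
  have -> : h = 0; last by rewrite pz mul0r oppr0.
  have PA0 : P A = 0.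
    rewrite -[LHS]fineK ?fin_num_measure//; congr _%:E.
    by rewrite -pz /p /Rintegral integral_indic ?setIT.
  rewrite /h /Rintegral.
  have -> : (\int[P]_w (H w * \1_A w)%:E = \int[P]_(w in A) (H w)%:E)%E.
    rewrite [RHS]integral_mkcond; apply: eq_integral => w _.
    by rewrite patchE indicE; case: (w \in A); rewrite ?mulr1 ?mulr0.
  by rewrite null_set_integral//; apply/measurable_EFinP/measurable_funTS.
have {p0}p0 : 0 < p by rewrite lt_def pn.
have ie : intg P (fun w => expR (H w)).
  apply: (@intg_bd _ _ _ P _ K); first exact: measurableT_comp.
  by move=> w; rewrite ger0_norm ?expR_ge0.
pose x := h / p.
have : expR x * (\int[P]_w ((1 - x) * \1_A w + H w * \1_A w)) <= 1.
  apply: le_trans e1; rewrite -RintZ; last by apply: intgD => //; exact: intgZ.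
  apply: Rint_le => //; first by apply: intgZ; apply: intgD => //; exact: intgZ.
  move=> w; rewrite indicE; case: (_ \in _); last by rewrite !mulr0 addr0 mulr0 expR_ge0.
  rewrite !mulr1 [leRHS](_ : _ = expR x * expR (H w - x)); last first.
    by rewrite -expRD; congr expR; ring.
  by rewrite ler_wpM2l ?expR_ge0//; apply: le_trans (expR_ge1Dx _); lra.
rewrite RintD//; last exact: intgZ.
rewrite RintZ// -/p -/h.
have -> : (1 - x) * p + h = p by rewrite /x; field.
rewrite -ler_pdivlMl ?expR_gt0// mulr1 -expRN => xp.
have lx : ln p <= - x by rewrite -(expRK (- x)) ler_ln ?posrE ?expR_gt0.
have -> : h = x * p by rewrite /x divfK.
by rewrite mulrC -mulrN ler_pM2l//; lra.
Qed.

Variables (M : nat) (enc : Omega -> 'I_M).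
Hypothesis measurable_cell : forall m, measurable (enc @^-1` [set m]).

Definition cell (m : 'I_M) : Omega -> R := \1_(enc @^-1` [set m]).
Definition cell_prob (m : 'I_M) : R := \int[P]_w cell m w.
Definition cell_moment (W : Omega -> R) (m : 'I_M) : R := \int[P]_w (W w * cell m w).
Definition decoded_energy (W : Omega -> R) : R :=
  \sum_m cell_moment W m ^+ 2 / cell_prob m.

Lemma cellE m w : cell m w = (enc w == m)%:R.
Proof.
rewrite /cell indicE; congr (nat_of_bool _)%:R.
by apply/idP/idP => [/set_mem/= ->//|/eqP e]; apply/mem_set.
Qed.

Lemma measurable_cell_fun m : measurable_fun setT (cell m).
Proof. exact: measurable_indic. Qed.

Lemma L2_cell m : L2 P (cell m). Proof. exact: L2_indic. Qed.

Lemma cell_abs_le1 m w : `|cell m w| <= 1. Proof. exact: indic_abs_le1. Qed.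

Lemma cell_sqr m w : cell m w ^+ 2 = cell m w.
Proof. by rewrite cellE; case: (_ == _); rewrite ?expr1n ?expr0n. Qed.

Lemma intg_cell W m : intg P W -> intg P (fun w => W w * cell m w).
Proof.
move=> iW; apply: (intgMb (C := 1)) => //; first exact: measurable_cell_fun.
by move=> w; exact: cell_abs_le1.
Qed.

Lemma sum_cell (f : 'I_M -> R) w : \sum_m f m * cell m w = f (enc w).
Proof.
rewrite (bigD1 (enc w))//= big1 ?addr0; first by rewrite cellE eqxx mulr1.
by move=> m mw; rewrite cellE eq_sym (negbTE mw) mulr0.
Qed.

Lemma sum_cell_moment W : intg P W -> \sum_m cell_moment W m = \int[P]_w W w.
Proof.
move=> iW; rewrite -Rint_sum; last by move=> m _; exact: intg_cell.
by apply: Rint_eq => w; rewrite (sum_cell (fun=> W w)).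
Qed.

Lemma cell_prob_ge0 m : 0 <= cell_prob m.
Proof. by apply: Rint_ge0 => w; rewrite cellE. Qed.

Lemma sum_cell_prob : \sum_m cell_prob m = 1.
Proof.
rewrite -[RHS](Rint_cst P 1) -[RHS]sum_cell_moment; last exact: intg_cst.
by apply: eq_bigr => m _; apply: Rint_eq => w; rewrite mul1r.
Qed.

Lemma cell_moment0 W m : L2 P W -> cell_prob m = 0 -> cell_moment W m = 0.
Proof.
move=> lW p0; rewrite /cell_moment.
under Rint_eq do rewrite mulrC.
apply: (Rint_eq0_sqr (L2_cell m)) => //.
by rewrite -[RHS]p0; apply: Rint_eq => w; rewrite cell_sqr.
Qed.

Lemma L2_decoder (x : 'I_M -> R) : L2 P (fun w => x (enc w)).
Proof.
apply: (L2_eq (f := fun w => \sum_m x m * cell m w)); last by move=> w; rewrite sum_cell.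
by apply: L2_sum => m _; exact/L2Z/L2_cell.
Qed.

Lemma decoder_error W (x : 'I_M -> R) : L2 P W ->
  \int[P]_w ((W w - x (enc w)) ^+ 2) =
  \int[P]_w (W w ^+ 2) - 2 * (\sum_m x m * cell_moment W m) + \sum_m x m ^+ 2 * cell_prob m.
Proof.
move=> lW.
have i1 : intg P (fun w => W w ^+ 2) by exact: L2_sqr.
have i2 m : intg P (fun w => W w * cell m w) by exact: intg_cell (L2_intg lW).
have i3 m : intg P (cell m) by exact/L2_intg/L2_cell.
have i4 : intg P (fun w => \sum_m x m * (W w * cell m w)).
  by apply: intg_sum => m _; exact: intgZ.
have i5 : intg P (fun w => \sum_m x m ^+ 2 * cell m w).
  by apply: intg_sum => m _; exact: intgZ.
transitivity (\int[P]_w (W w ^+ 2 - 2 * (\sum_m x m * (W w * cell m w)) +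
    \sum_m x m ^+ 2 * cell m w)).
  apply: Rint_eq => w; rewrite (sum_cell (fun m => x m ^+ 2)).
  under eq_bigr do rewrite mulrA; rewrite (sum_cell (fun m => x m * W w)); ring.
rewrite RintD ?RintB ?RintZ//; last 2 first.
- exact: intgZ.
- by apply: intgB => //; exact: intgZ.
rewrite !Rint_sum; last 2 first.
- by move=> m _; exact: intgZ.
- by move=> m _; exact: intgZ.
by congr (_ - 2 * _ + _); apply: eq_bigr => m _; rewrite RintZ.
Qed.

Lemma decoder_error_ge W (x : 'I_M -> R) : L2 P W ->
  \int[P]_w (W w ^+ 2) - decoded_energy W <= \int[P]_w ((W w - x (enc w)) ^+ 2).
Proof.
move=> lW; rewrite decoder_error// -addrA lerD2l /decoded_energy mulr_sumr.
rewrite -!sumrN -big_split/=; apply: ler_sum => m _.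
have [p0|pn] := eqVneq (cell_prob m) 0.
  by rewrite p0 cell_moment0// invr0 !mulr0 oppr0 addr0.
have pp : 0 < cell_prob m by rewrite lt_def pn cell_prob_ge0.
rewrite -subr_ge0; set q := cell_moment W m; set p := cell_prob m in pn pp *.
have -> : - (2 * (x m * q)) + x m ^+ 2 * p - - (q ^+ 2 / p) = (x m * p - q) ^+ 2 / p.
  by field.
by rewrite divr_ge0 ?sqr_ge0// ltW.
Qed.

Lemma decoded_energy_ge0 W : 0 <= decoded_energy W.
Proof. by apply: sumr_ge0 => m _; rewrite divr_ge0 ?sqr_ge0 ?cell_prob_ge0. Qed.

Lemma decoded_energy_le W : L2 P W -> decoded_energy W <= \int[P]_w (W w ^+ 2).
Proof.
move=> lW; have := decoder_error (fun m => cell_moment W m / cell_prob m) lW.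
have -> : \sum_m cell_moment W m / cell_prob m * cell_moment W m = decoded_energy W.
  by apply: eq_bigr => m _; rewrite mulrAC -expr2.
have -> : \sum_m (cell_moment W m / cell_prob m) ^+ 2 * cell_prob m = decoded_energy W.
  apply: eq_bigr => m _; have [p0|pn] := eqVneq (cell_prob m) 0.
    by rewrite p0 invr0 !mulr0.
  by field.
have : 0 <= \int[P]_w ((W w - cell_moment W (enc w) / cell_prob (enc w)) ^+ 2).
  by apply: Rint_ge0 => w; exact: sqr_ge0.
by move=> /[swap] ->; lra.
Qed.

Lemma cell_entropy_le : (0 < M)%N -> \sum_m - (cell_prob m * ln (cell_prob m)) <= ln M%:R.
Proof.
move=> M0; have M0' : 0 < M%:R :> R by rewrite ltr0n.
have key m : - (cell_prob m * ln (cell_prob m)) <=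
    cell_prob m * ln M%:R + (M%:R^-1 - cell_prob m).
  have [p0|pn] := eqVneq (cell_prob m) 0.
    by rewrite p0 !mul0r oppr0 addr0 add0r invr_ge0 ltW.
  have pp : 0 < cell_prob m by rewrite lt_def pn cell_prob_ge0.
  set p := cell_prob m in pn pp *.
  have : ln (M%:R * p)^-1 <= (M%:R * p)^-1 - 1.
    rewrite -[X in ln X](subrK 1) [X in ln X]addrC; apply: le_ln1Dx.
    by rewrite ltrBrDl subrr invr_gt0 mulr_gt0.
  rewrite lnV ?posrE ?mulr_gt0// lnM ?posrE// => h.
  have := ler_wpM2l (ltW pp) h.
  have -> : p * ((M%:R * p)^-1 - 1) = M%:R^-1 - p by field; rewrite gt_eqF.
  lra.
apply: le_trans (ler_sum _ (fun m _ => key m)) _.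
rewrite big_split/= -mulr_suml sum_cell_prob mul1r sumrB sum_cell_prob.
by rewrite sumr_const card_ord -[_^-1 *+ _]mulr_natr mulVf ?gt_eqF// subrr addr0.
Qed.

End cells.

Section rate.
Context {R : realType} {d : measure_display} {Omega : measurableType d}.
Variable P : probability Omega R.
Variables (M : nat) (enc : Omega -> 'I_M).
Hypothesis measurable_cell : forall m, measurable (enc @^-1` [set m]).
Hypothesis M_gt0 : (0 < M)%N.
Variables (r : nat) (g : 'I_r -> Omega -> R).
Hypothesis L2g : forall i, L2 P (g i).
Hypothesis g1 : forall i, \int[P]_w (g i w ^+ 2) = 1.
Hypothesis std : standard_normal_cos P g.

Local Notation energy := (decoded_energy P enc).
Local Notation moment := (cell_moment P enc).
Local Notation prob := (cell_prob P enc).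
Local Notation cell := (@cell R d Omega M enc).

Let mg i : measurable_fun setT (g i). Proof. exact: L2_mfun (L2g i). Qed.

Lemma cell_rate_le (s : 'I_r -> R) (m : 'I_M) : (forall i, 0 < s i < 1) ->
  \sum_i (- ((s i ^- 2 - 1) / 2 * moment (fun w => g i w ^+ 2) m) +
    moment (g i) m ^+ 2 / prob m / (2 * s i ^+ 2) - prob m * ln (s i))
  <= - (prob m * ln (prob m)).
Proof.
move=> s01; have s01' i : 0 < s i <= 1 by have /andP[-> /ltW] := s01 i.
have s0 i : 0 < s i by have /andP[] := s01 i.
pose mu i := moment (g i) m / prob m.
have ds i : 0 < 1 - s i ^+ 2.
  by have /andP[a b] := s01 i; rewrite subr_gt0 exprn_ilt1// ltW.
pose a i := mu i / (1 - s i ^+ 2).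
pose k i : R := (s i ^- 2 - 1) / 2.
have k0 i : 0 <= k i by exact: bump_exponent_ge0.
have c0 i : 0 < bump_mean (s i) (a i) by rewrite mulr_gt0// expR_gt0.
pose H w := \sum_i (- (k i * (g i w - a i) ^+ 2) - ln (bump_mean (s i) (a i))).
have L2s i : intg P (fun w => (g i w - a i) ^+ 2).
  by apply: L2_sqr; apply: L2B => //; exact: L2_cst.
have iH : intg P H.
  apply: intg_sum => i _; apply: intgB; last exact: intg_cst.
  exact/intgN/intgZ.
have eH w : expR (H w) = (\prod_i bump_mean (s i) (a i))^-1 *
    \prod_i bump (s i) (a i) (g i w).
  rewrite /H expR_sum -prodfV -big_split/=; apply: eq_bigr => i _.
  by rewrite expRD [expR (- ln _)]expRN lnK ?posrE// mulrC.
have pc : 0 < \prod_i bump_mean (s i) (a i) by exact: prodr_gt0.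
have pb w : 0 <= \prod_i bump (s i) (a i) (g i w) <= 1.
  rewrite prodr_ge0 => [|i _]; last by have /andP[] := bump_le1 (a i) (g i w) (s01' i).
  by apply: prodr_ile1 => i _; exact: bump_le1.
have mb : measurable_fun setT (fun w => \prod_i bump (s i) (a i) (g i w)).
  by apply: measurable_prod => i _; exact: measurableT_comp (measurable_bump _ _) (mg i).
have HK w : expR (H w) <= (\prod_i bump_mean (s i) (a i))^-1.
  rewrite eH; have /andP[p0 p1] := pb w.
  by rewrite ler_piMr// invr_ge0 ltW.
have e1 : \int[P]_w expR (H w) <= 1.
  have -> : \int[P]_w expR (H w) = \int[P]_w ((\prod_i bump_mean (s i) (a i))^-1 *
      \prod_i bump (s i) (a i) (g i w)) by apply: Rint_eq => w; rewrite eH.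
  rewrite RintZ; last first.
    apply: (@intg_bd _ _ _ P _ 1) => // w.
    by have /andP[? ?] := pb w; rewrite ger0_norm.
  by rewrite Rint_prod_bump// mulVf ?gt_eqF.
apply: le_trans _ (event_tilt_le (measurable_cell m) (intg_mfun iH) HK e1
  (intg_cell measurable_cell m iH)).
rewrite -/(cell m).
have L2c i : intg P (fun w => g i w ^+ 2 * cell m w).
  by apply: intg_cell => //; exact: L2_sqr.
have L1c i : intg P (fun w => g i w * cell m w).
  by apply: intg_cell => //; exact: L2_intg.
have ic : intg P (cell m) by exact/L2_intg/L2_cell.
pose T i w := - k i * (g i w ^+ 2 * cell m w) + 2 * k i * a i * (g i w * cell m w)
   + (- (k i * a i ^+ 2) - ln (bump_mean (s i) (a i))) * cell m w.
have iT i : intg P (T i).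
  by apply: intgD; [apply: intgD; exact: intgZ|exact: intgZ].
have HT w : H w * cell m w = \sum_i T i w.
  by rewrite /H mulr_suml; apply: eq_bigr => i _; rewrite /T; ring.
have -> : \int[P]_w (H w * cell m w) = \sum_i \int[P]_w T i w.
  by rewrite -Rint_sum//; apply: Rint_eq => w; rewrite HT.
apply: ler_sum => i _; rewrite le_eqVlt; apply/orP; left; apply/eqP.
rewrite /T RintD ?RintZ//; [|by apply: intgD; exact: intgZ|exact: intgZ].
rewrite RintD ?RintZ//; [|exact: intgZ..].
rewrite -/(prob m) -/(moment (g i) m) -/(moment (fun w => g i w ^+ 2) m).
have lnc : ln (bump_mean (s i) (a i)) = ln (s i) - (1 - s i ^+ 2) * a i ^+ 2 / 2.
  by rewrite /bump_mean lnM ?posrE ?expR_gt0// expRK mulNr.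
rewrite lnc -/(k i) /a /mu; set t := moment (fun _ => _) m.
have [p0|pn] := eqVneq (prob m) 0.
  by rewrite p0 cell_moment0// invr0 !mulr0; ring.
have dn := ds i; have sn := s0 i.
rewrite /k; move: (moment (g i) m) (prob m) pn (s i) sn dn (ln (s i)) => q p pn x x0 dx l.
by field; rewrite pn gt_eqF// gt_eqF.
Qed.

Lemma rate_le (s : 'I_r -> R) : (forall i, 0 < s i < 1) ->
  \sum_i (- ln (s i ^+ 2) + 1 - (1 - energy (g i)) / s i ^+ 2) <= 2 * ln M%:R.
Proof.
move=> s01.
have := @ler_sum R _ (index_enum 'I_M) xpredT _ _ (fun m _ => cell_rate_le m s01).
move=> /le_trans/(_ (cell_entropy_le P measurable_cell M_gt0)).
rewrite exchange_big/= => h.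
rewrite mulrC -ler_pdivrMr// mulr_suml; apply: le_trans h.
apply: ler_sum => i _; rewrite big_split/= big_split/= sumrN -!mulr_sumr.
rewrite sum_cell_moment; last exact: L2_sqr.
rewrite g1 sumrN -!mulr_suml sum_cell_prob// -/(energy (g i)) mul1r mulr1.
have /andP[s0 s1] := s01 i.
rewrite lnXn// le_eqVlt; apply/orP; left; apply/eqP.
  by field; rewrite gt_eqF.
exact: measurable_cell.
Qed.

(* Up to the term theta ln M, the largest energy that a code of size M retains
   of a normal vector with variances x_i, in Lagrangian form. *)
Definition waterfill (theta x : R) : R :=
  Num.max (x - theta) 0 - theta * Num.max (ln (x / theta)) 0.

Lemma energy_waterfill_le (lam : 'I_r -> R) (theta : R) : 0 < theta ->
  (forall i, 0 <= lam i) ->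
  \sum_i lam i * energy (g i) <=
    \sum_i waterfill theta (lam i) + 2 * theta * ln M%:R.
Proof.
move=> t0 lam0.
have approx (eta : R) : 0 < eta <= 2^-1 ->
    \sum_i lam i * energy (g i) - \sum_i waterfill theta (lam i)
      - 2 * theta * ln M%:R <= r%:R * theta * eta.
  move=> /andP[e0 e1].
  pose dd i := if theta < lam i then theta / lam i else 1 - eta.
  have dd01 i : 0 < dd i < 1.
    rewrite /dd; case: ifPn => [tl|_]; last by apply/andP; split; lra.
    have l0 : 0 < lam i by exact: lt_trans tl.
    by rewrite divr_gt0//= ltr_pdivrMr// mul1r.
  pose s i := Num.sqrt (dd i).
  have s01 i : 0 < s i < 1.
    have /andP[a b] := dd01 i.
    by rewrite sqrtr_gt0 a/= -sqrtr1 ltr_sqrt.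
  have ss i : s i ^+ 2 = dd i.
    by rewrite sqr_sqrtr// ltW//; have /andP[] := dd01 i.
  have := rate_le s01.
  rewrite -(ler_pM2l t0) mulr_sumr => h.
  suff key i : lam i * energy (g i) - waterfill theta (lam i) <=
      theta * (- ln (s i ^+ 2) + 1 - (1 - energy (g i)) / s i ^+ 2) + theta * eta.
    rewrite -sumrB lerBlDl [2 * theta]mulrC -mulrA.
    apply: le_trans (ler_sum _ (fun i _ => key i)) _.
    rewrite big_split/= lerD//; first by rewrite -mulrA.
    by rewrite sumr_const card_ord mulr_natl.
  rewrite ss /dd /waterfill; have E0 := decoded_energy_ge0 P enc (g i).
  have l0 := lam0 i; case: ifPn => [tl|]; last rewrite -leNgt => lt.
    have l1 : 0 < lam i by exact: lt_trans tl.
    rewrite max_l; last by rewrite subr_ge0 ltW.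
    rewrite max_l; last by rewrite ln_ge0// ler_pdivlMr// mul1r ltW.
    have -> : ln (theta / lam i) = - ln (lam i / theta).
      by rewrite -lnV ?posrE ?divr_gt0// invf_div.
    set L := ln _; set E := energy (g i) in E0 *.
    have -> : theta * (- - L + 1 - (1 - E) / (theta / lam i)) =
       theta * L + theta - (1 - E) * lam i by field; rewrite !gt_eqF.
    have : 0 <= theta * eta by rewrite mulr_ge0// ltW.
    lra.
  have wf0 : 0 <= waterfill theta (lam i).
    rewrite /waterfill max_r; last by rewrite subr_le0.
    rewrite max_r ?mulr0 ?subrr//.
    by rewrite ln_le0// ler_pdivrMr// mul1r.
  have lne : ln (1 - eta) <= - eta.
    by apply: le_ln1Dx; lra.
  apply: (@le_trans _ _ (theta * energy (g i))).
    by rewrite -/(waterfill theta (lam i)); have := ler_wpM2r E0 lt; lra.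
  rewrite -mulrDr; apply: ler_wpM2l; first exact: ltW.
  set E := energy (g i) in E0 *.
  have : (1 - E) / (1 - eta) <= 1 - E + 2 * eta.
    rewrite ler_pdivrMr; last by lra.
    nra.
  lra.
rewrite -lerBlDl -subr_le0.
set X := _ - _ in approx *.
rewrite leNgt; apply/negP => X0.
pose c := r%:R * theta.
have c0 : 0 <= c by rewrite mulr_ge0// ltW.
have hc : 0 < 2 * c + 1 by lra.
have := approx (Num.min 2^-1 (X / (2 * c + 1))).
rewrite lt_min invr_gt0 ltr0n divr_gt0//= ge_min lexx/= => /(_ isT).
rewrite -/c => h; have : X <= c * (X / (2 * c + 1)).
  apply: le_trans h _; rewrite ler_wpM2l// ge_min lexx orbT//.
rewrite mulrA ler_pdivlMr//; nra.
Qed.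

End rate.

(** * Diagonalisation of a Gram matrix *)

Section symmetric.
Context {R : realType}.

Definition dot {n} (u v : 'rV[R]_n) : R := \sum_j u 0 j * v 0 j.

Lemma dotE n (u v : 'rV[R]_n) : dot u v = (u *m v^T) 0 0.
Proof. by rewrite mxE; apply: eq_bigr => k _; rewrite mxE. Qed.

Lemma dotC n (u v : 'rV[R]_n) : dot u v = dot v u.
Proof. by apply: eq_bigr => j _; rewrite mulrC. Qed.

Lemma dot_ge0 n (u : 'rV[R]_n) : 0 <= dot u u.
Proof. by apply: sumr_ge0 => j _; rewrite -expr2 sqr_ge0. Qed.

Lemma dot_eq0 n (u : 'rV[R]_n) : dot u u = 0 -> u = 0.
Proof.
move=> u0; apply/rowP => j; rewrite mxE; apply/eqP; rewrite -sqrf_eq0 expr2.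
have := psumr_eq0P (F := fun j => u 0 j * u 0 j) _ u0 => ->//.
by move=> k _; rewrite -expr2 sqr_ge0.
Qed.

Lemma dot_sym_mx n (B : 'M[R]_n) (u v : 'rV[R]_n) : B^T = B ->
  dot (u *m B) v = dot (v *m B) u.
Proof.
move=> sB; rewrite !dotE.
have -> : u *m B *m v^T = (v *m B *m u^T)^T by rewrite !trmx_mul trmxK sB mulmxA.
by rewrite mxE.
Qed.

Lemma real_eigenvector n (B : 'M[R]_n.+1) : B^T = B ->
  exists (a : R) (v : 'rV[R]_n.+1), dot v v = 1 /\ v *m B = a *: v.
Proof.
move=> sB; pose A : 'M[R[i]]_n.+1 := map_mx (fun x => (x%:C)%C) B.
have [a /eigenvalueP[v vA vn0]] := eigenvalue_closed A (ltn0Sn n).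
pose x : 'rV[R]_n.+1 := \row_j complex.Re (v 0 j).
pose y : 'rV[R]_n.+1 := \row_j complex.Im (v 0 j).
pose ar := complex.Re a; pose ai := complex.Im a.
have xB : x *m B = ar *: x - ai *: y.
  apply/rowP => j; rewrite !mxE.
  have : complex.Re ((v *m A) 0 j) = complex.Re ((a *: v) 0 j) by rewrite vA.
  rewrite !mxE raddf_sum/= => e.
  rewrite (eq_bigr (fun k => complex.Re (v 0 k * A k j))); last first.
    by move=> k _; rewrite !mxE; case: (v 0 k) => p q /=; ring.
  by rewrite e /ar /ai; case: (a) => p q; case: (v 0 j) => p' q' /=.
have yB : y *m B = ar *: y + ai *: x.
  apply/rowP => j; rewrite !mxE.
  have : complex.Im ((v *m A) 0 j) = complex.Im ((a *: v) 0 j) by rewrite vA.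
  rewrite !mxE raddf_sum/= => e.
  rewrite (eq_bigr (fun k => complex.Im (v 0 k * A k j))); last first.
    by move=> k _; rewrite !mxE; case: (v 0 k) => p q /=; ring.
  by rewrite e /ar /ai; case: (a) => p q; case: (v 0 j) => p' q' /=.
have := dot_sym_mx x y sB; rewrite xB yB.
have lin (b c : R) (p q t : 'rV[R]_n.+1) : dot (b *: p + c *: q) t = b * dot p t + c * dot q t.
  by rewrite /dot !mulr_sumr -big_split/=; apply: eq_bigr => j _; rewrite !mxE; ring.
rewrite -scaleNr !lin (dotC y x) => e.
have ai0 : ai * (dot x x + dot y y) = 0 by rewrite mulrDr; lra.
have [w [w0 wB]] : exists w : 'rV[R]_n.+1, w != 0 /\ w *m B = ar *: w.
  have [x0|xn] := eqVneq x 0; last first.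
    exists x; split => //; move/eqP: ai0; rewrite mulf_eq0 => /orP[/eqP z|].
      by rewrite xB z scale0r subr0.
    rewrite paddr_eq0 ?dot_ge0// => /andP[/eqP/dot_eq0 x0 _].
    by rewrite x0 eqxx in xn.
  have yn : y != 0.
    apply: contra_neq vn0 => y0; apply/rowP => j.
    have := congr1 (fun z : 'rV[R]_n.+1 => z 0 j) x0.
    have := congr1 (fun z : 'rV[R]_n.+1 => z 0 j) y0.
    by rewrite !mxE; case: (v 0 j) => p q /= -> ->.
  by exists y; split => //; rewrite yB x0 scaler0 addr0.
have dw : 0 < dot w w.
  by rewrite lt_def dot_ge0 andbT; apply: contra_neq w0 => /dot_eq0.
exists ar, ((Num.sqrt (dot w w))^-1 *: w); split; last first.
  by rewrite -scalemxAl wB !scalerA mulrC.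
rewrite /dot; under eq_bigr do rewrite !mxE mulrACA.
by rewrite -mulr_sumr -/(dot w w) -invfM -expr2 sqr_sqrtr ?dot_ge0// mulVf// gt_eqF.
Qed.

Lemma householder n (v : 'rV[R]_n.+1) : dot v v = 1 ->
  exists H : 'M[R]_n.+1, [/\ H^T = H, H *m H = 1%:M & delta_mx 0 0 *m H = v].
Proof.
move=> v1; pose e : 'rV[R]_n.+1 := delta_mx 0 0; pose w := v - e.
have [w0|wn] := eqVneq w 0.
  exists 1%:M; rewrite trmx1 !mulmx1; split=> //.
  by apply/esym/eqP; rewrite -subr_eq0 -/e -/w w0.
have e1 : e *m w^T = (v 0 0 - 1)%:M.
  by apply/matrixP => i j; rewrite !ord1 -rowE !mxE !eqxx ?mulr1n.
have cE : dot w w = 2 - 2 * v 0 0.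
  rewrite /dot (eq_bigr (fun j => v 0 j * v 0 j - 2 * v 0 j * e 0 j + e 0 j * e 0 j)); last first.
    by move=> j _; rewrite !mxE; ring.
  rewrite big_split/= sumrB -/(dot v v) v1.
  rewrite (bigD1 ord0)//= big1 ?addr0; last first.
    by move=> j /negbTE j0; rewrite !mxE j0 mulr0.
  rewrite (bigD1 ord0)//= big1 ?addr0; last first.
    by move=> j /negbTE j0; rewrite !mxE j0 mulr0.
  by rewrite !mxE eqxx/=; ring.
have c0 : dot w w != 0.
  by apply: contra_neq wn; exact: dot_eq0.
have ww : w *m w^T = (dot w w)%:M.
  by apply/matrixP => i j; rewrite !ord1 dotE [RHS]mxE eqxx mulr1n.
pose b := 2 / dot w w.
exists (1%:M - b *: (w^T *m w)); split.
- by rewrite linearB/= linearZ/= trmx_mul trmxK trmx1.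
- set X := b *: _.
  have XX : X *m X = X + X.
    rewrite /X -scalemxAl -scalemxAr scalerA mulmxA -(mulmxA w^T w) ww.
    rewrite mul_mx_scalar -scalemxAl scalerA -scalerDl; congr (_ *: _).
    by rewrite /b; field.
  by rewrite mulmxBl mul1mx mulmxBr mulmx1 XX opprB addrK subrK.
- rewrite mulmxBr mulmx1 -scalemxAr mulmxA e1 mul_scalar_mx scalerA.
  have -> : b * (v 0 0 - 1) = -1.
    by rewrite /b cE; field; move: c0; rewrite cE; apply: contra_neq => h; lra.
  by rewrite scaleN1r opprK /w addrC subrK.
Qed.

Theorem symmetric_spectral n (B : 'M[R]_n) : B^T = B ->
  exists (O : 'M[R]_n) (D : 'rV[R]_n),
    O *m O^T = 1%:M /\ O *m B *m O^T = diag_mx D.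
Proof.
elim: n B => [B _|n IH B sB].
  by exists 1%:M, 0; split; apply/matrixP => -[].
have [a [v [v1 vB]]] := real_eigenvector sB.
have [H [sH HH eH]] := householder v1.
pose B1 : 'M[R]_(1 + n) := H *m B *m H.
have sB1 : B1^T = B1 by rewrite /B1 !trmx_mul sH sB mulmxA.
have r0 : (delta_mx 0 0 : 'rV[R]_n.+1) *m B1 = a *: delta_mx 0 0.
  by rewrite /B1 !mulmxA eH vB -scalemxAl -eH -mulmxA HH mulmx1.
have ur0 : ursubmx B1 = 0.
  apply/matrixP => i j; rewrite !ord1 !mxE.
  have := congr1 (fun z : 'rV[R]_(1 + n) => z 0 (rshift 1 j)) r0.
  rewrite -rowE !mxE/= => h.
  have -> : lshift n (0 : 'I_1) = 0 by apply/val_inj.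
  by rewrite h mulr0.
have dl0 : dlsubmx B1 = 0 by rewrite -sB1 -trmx_ursub ur0 trmx0.
have sdr : (drsubmx B1)^T = drsubmx B1 by rewrite trmx_drsub sB1.
have [U [E [orthU diagU]]] := IH _ sdr.
pose K : 'M[R]_(1 + n) := block_mx 1%:M 0 0 U.
have KK : K *m K^T = 1%:M.
  rewrite /K tr_block_mx mulmx_block !trmx0 trmx1 !mulmx0 !mul0mx !mulmx1 !addr0 add0r.
  by rewrite orthU -scalar_mx_block.
have [a0 a0E] : exists a0 : R, a0 = B1 0 0 by exists (B1 0 0).
exists (K *m H), (row_mx (const_mx a0 : 'rV_1) E); split.
  by rewrite trmx_mul sH !mulmxA -(mulmxA K) HH mulmx1.
rewrite trmx_mul sH !mulmxA.
have -> : K *m H *m B *m H *m K^T = K *m B1 *m K^T by rewrite /B1 !mulmxA.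
rewrite -[B1]submxK ur0 dl0 /K tr_block_mx !mulmx_block !trmx0 trmx1.
rewrite !mulmx0 !mul0mx !mulmx1 !mul1mx !addr0 !add0r diagU.
refine (etrans _ (esym (diag_mx_row (const_mx a0 : 'rV[R]_1) E))).
rewrite mul0mx; congr block_mx; apply/matrixP => i j; rewrite !ord1 !mxE eqxx mulr1n a0E.
have -> : (0 : 'I_n.+1) = lshift n (0 : 'I_1) by apply/val_inj.
by rewrite /B1 [RHS]mxE.
Qed.

Lemma gram_diagonalisation (N n : nat) (Gam : 'M[R]_N) (c : 'M[R]_(n, N)) :
  Gam^T = Gam -> (forall v : 'cV[R]_N, Gam *m v = 0 -> c *m v = 0) ->
  exists (L : 'M[R]_(n, N)) (O : 'M[R]_n) (D : 'rV[R]_n),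
    [/\ L *m Gam = c, O *m O^T = 1%:M, O *m (L *m Gam *m L^T) *m O^T = diag_mx D &
        (#|[pred j | D ord0 j != 0%R]| <= N)%N].
Proof.
move=> sG cG.
have sub : (c <= Gam)%MS.
  rewrite submxE; apply/eqP/matrixP => i j.
  have h : c *m (cokermx Gam *m delta_mx j 0) = 0 :> 'cV_n.
    by apply: cG; rewrite mulmxA mulmx_coker mul0mx.
  rewrite mulmxA in h.
  have := congr1 (fun z : 'cV[R]_n => z i ord0) h.
  by rewrite -colE [LHS]mxE [RHS]mxE => ->; rewrite mxE.
have [L LG] : exists L, L *m Gam = c by exists (c *m pinvmx Gam); rewrite mulmxKpV.
have sB : (L *m Gam *m L^T)^T = L *m Gam *m L^T by rewrite !trmx_mul trmxK sG mulmxA.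
have [Q [D [orthO diagO]]] := symmetric_spectral sB.
exists L, Q, D; split=> //.
set J := [pred j | _].
pose A := rowsub (fun i : 'I_#|J| => enum_val i) (Q *m L).
have AGA : A *m Gam *m A^T = diag_mx (\row_i D 0 (enum_val i)).
  apply/matrixP => i j.
  have e : Q *m L *m Gam *m (Q *m L)^T = diag_mx D by rewrite trmx_mul -diagO !mulmxA.
  rewrite /A mul_rowsub_mx trmx_mxsub mulmx_colsub mul_rowsub_mx e !mxE.
  by congr (_ *+ _); rewrite (inj_eq enum_val_inj).
have uA : A *m Gam *m A^T \in unitmx.
  rewrite AGA unitmxE det_diag unitfE prodf_seq_neq0; apply/allP => i _ /=.
  by rewrite mxE; have := enum_valP i; rewrite inE.
rewrite -(mxrank_unit uA) -mulmxA; apply: leq_trans (mxrankM_maxl _ _) _.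
exact: rank_leq_col.
Qed.

End symmetric.

(** * Waterfilling *)

Section waterfill_theory.
Context {R : realType}.
Variable theta : R.
Hypothesis theta_gt0 : 0 < theta.
Implicit Types x y lam : R.

Lemma waterfill_le x : x <= theta -> 0 <= x -> waterfill theta x = 0.
Proof.
move=> xt x0; rewrite /waterfill max_r ?subr_le0// max_r ?mulr0 ?subrr//.
by rewrite ln_le0// ler_pdivrMr// mul1r.
Qed.

Lemma waterfill_gt x : theta <= x ->
  waterfill theta x = x - theta - theta * ln (x / theta).
Proof.
move=> xt; rewrite /waterfill max_l ?subr_ge0// max_l//.
by rewrite ln_ge0// ler_pdivlMr// mul1r.
Qed.

Lemma ge_ln_sub1 y : 0 < y -> ln y <= y - 1.
Proof.
by move=> y0; rewrite -[X in ln X](subrK 1) [X in ln X]addrC; apply: le_ln1Dx; lra.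
Qed.

Lemma waterfill_tangent lam x : theta < lam -> 0 <= x ->
  (1 - theta / lam) * x - theta * ln (lam / theta) <= waterfill theta x.
Proof.
move=> tl x0; have l0 : 0 < lam by exact: lt_trans tl.
have [xt|tx] := leP x theta.
  rewrite waterfill_le//.
  have h : ln (theta / lam) <= theta / lam - 1 by apply: ge_ln_sub1; rewrite divr_gt0.
  have e : ln (lam / theta) = - ln (theta / lam).
    by rewrite -lnV ?posrE ?divr_gt0// invf_div.
  have q : 0 <= 1 - theta / lam by rewrite subr_ge0 ler_pdivrMr// mul1r ltW.
  by rewrite e; nra.
rewrite (waterfill_gt (ltW tx)); have xp : 0 < x by exact: lt_trans tx.
have h : ln (x / lam) <= x / lam - 1 by apply: ge_ln_sub1; rewrite divr_gt0.
have e : ln (x / lam) = ln (x / theta) - ln (lam / theta).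
  rewrite -ln_div ?posrE ?divr_gt0//; congr ln.
  by field; rewrite !gt_eqF.
have := ler_wpM2l (ltW theta_gt0) h; rewrite e.
have -> : theta * (x / lam - 1) = theta / lam * x - theta by ring.
lra.
Qed.

Lemma waterfill_eq_tangent lam : theta < lam ->
  waterfill theta lam = (1 - theta / lam) * lam - theta * ln (lam / theta).
Proof.
move=> tl; have l0 : 0 < lam by exact: lt_trans tl.
by rewrite (waterfill_gt (ltW tl)); field; rewrite gt_eqF.
Qed.

Lemma waterfill_ge0 x : 0 <= x -> 0 <= waterfill theta x.
Proof.
move=> x0; have [xt|tx] := leP x theta; first by rewrite waterfill_le.
rewrite (waterfill_gt (ltW tx)).
have h : ln (x / theta) <= x / theta - 1.
  by apply: ge_ln_sub1; rewrite divr_gt0// (lt_trans theta_gt0).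
have := ler_wpM2l (ltW theta_gt0) h.
have -> : theta * (x / theta - 1) = x - theta by field; rewrite gt_eqF.
lra.
Qed.

Lemma waterfill_le_id x : 0 <= x -> waterfill theta x <= x.
Proof.
move=> x0; have [xt|tx] := leP x theta; first by rewrite waterfill_le.
rewrite (waterfill_gt (ltW tx)).
have : 0 <= theta * ln (x / theta).
  by rewrite mulr_ge0 ?ltW// ln_gt0// ltr_pdivlMr// mul1r.
have := theta_gt0; lra.
Qed.

Lemma waterfill_homo x y : 0 <= x -> x <= y -> waterfill theta x <= waterfill theta y.
Proof.
move=> x0 xy; have y0 := le_trans x0 xy.
have [xt|tx] := leP x theta; first by rewrite waterfill_le// waterfill_ge0.
apply: le_trans (waterfill_tangent tx y0); rewrite waterfill_eq_tangent//.
rewrite lerD2r ler_wpM2l// subr_ge0 ler_pdivrMr ?mul1r ?ltW//.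
exact: lt_trans tx.
Qed.

Lemma measurable_waterfill : measurable_fun setT (waterfill theta).
Proof.
apply: measurable_funB.
  by apply: measurable_maxr => //; exact: measurable_funB.
apply: measurable_funM => //; apply: measurable_maxr => //.
by apply: measurableT_comp; [exact: measurable_ln|exact: measurable_funM].
Qed.

(* Jensen's inequality for the measure w(f) df on [in], tested on the tangent
   of the convex function [waterfill theta] at lam. *)
Lemma waterfill_jensen (S w : R -> R) (A : set R) (lam c C : R) :
  measurable A -> intg lebesgue_measure S -> measurable_fun setT w ->
  (forall f, 0 <= S f) -> (forall f, 0 <= w f <= C) -> 0 <= c ->
  intg lebesgue_measure (fun f => w f * \1_A f) ->
  \int[lebesgue_measure]_f (w f * \1_A f) = 1 ->
  theta < lam -> lam <= \int[lebesgue_measure]_f (S f * w f) ->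
  waterfill theta lam <=
    \int[lebesgue_measure]_f (Num.max (waterfill theta (S f) - c) 0 * w f) + c +
    \int[lebesgue_measure]_f (S f * (w f * \1_(~` A) f)).
Proof.
move=> mA iS mw S0 wC c0 iwA wA1 tl lS; have l0 : 0 < lam by exact: lt_trans tl.
have w0 f : 0 <= w f by have /andP[] := wC f.
have wb f : `|w f| <= C by rewrite ger0_norm//; have /andP[] := wC f.
have C0 : 0 <= C by apply: le_trans (wb 0).
pose s := 1 - theta / lam.
have s01 : 0 <= s <= 1.
  rewrite /s subr_ge0 ler_pdivrMr// mul1r ltW//= gerBl divr_ge0// ltW//.
have /andP[s0 s1] := s01.
pose k := theta * ln (lam / theta).
have k0 : 0 <= k by rewrite mulr_ge0 ?ltW// ln_gt0// ltr_pdivlMr// mul1r.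
pose V f := Num.max (waterfill theta (S f) - c) 0.
have mV : measurable_fun setT V.
  apply: measurable_maxr => //; apply: measurable_funB => //.
  exact: measurableT_comp measurable_waterfill (intg_mfun iS).
have iV : intg lebesgue_measure V.
  apply: (@intg_le _ _ _ lebesgue_measure _ _ mV iS) => f; rewrite /V ger0_norm; last by rewrite le_max lexx orbT.
  rewrite ge_max S0 andbT lerBlDr; apply: le_trans (waterfill_le_id (S0 f)) _.
  by rewrite lerDl.
have iVw : intg lebesgue_measure (fun f => V f * w f) by exact: (intgMb iV mw wb).
have iSw : intg lebesgue_measure (fun f => S f * w f) by exact: (intgMb iS mw wb).
have iSo : intg lebesgue_measure (fun f => S f * (w f * \1_(~` A) f)).
  apply: (intgMb (C := C) iS).
    by apply: measurable_funM => //; apply: measurable_indic; exact: measurableC.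
  move=> f; rewrite normrM -[leRHS]mulr1 ler_pM//; exact: indic_abs_le1.
have pw f : s * (S f * w f) <= V f * w f + (c + k) * (w f * \1_A f) +
    S f * (w f * \1_(~` A) f).
  have t := waterfill_tangent tl (S0 f); rewrite -/s -/k in t.
  have v1 : waterfill theta (S f) - c <= V f by rewrite /V le_max lexx.
  have v0 : 0 <= V f by rewrite /V le_max lexx orbT.
  have wf := w0 f; have Sf := S0 f.
  rewrite !indicE in_setC; case: (f \in A) => /=; rewrite ?mulr1 ?mulr0 ?addr0.
    have : (s * S f) * w f <= (V f + (c + k)) * w f by rewrite ler_wpM2r//; lra.
    lra.
  have h1 : 0 <= V f * w f by exact: mulr_ge0.
  have h2 : 0 <= S f * w f by exact: mulr_ge0.
  have h3 : s * (S f * w f) <= 1 * (S f * w f) by rewrite ler_wpM2r.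
  lra.
have := Rint_le (intgZ s iSw) (intgD (intgD iVw (intgZ (c + k) iwA)) iSo) pw.
rewrite RintZ// RintD//; last by apply: intgD => //; exact: intgZ.
rewrite RintD//; last exact: intgZ.
rewrite RintZ// wA1 mulr1 waterfill_eq_tangent// -/s -/k.
have := ler_wpM2l s0 lS; rewrite /V; lra.
Qed.

End waterfill_theory.

Section trigonometric_energy.
Context {R : realType}.
Local Notation leb := (@lebesgue_measure R).

Definition trig_energy (n : nat) (e t : 'I_n -> R) (f : R) : R :=
  (\sum_k e k * cos (2 * pi * f * t k)) ^+ 2 +
  (\sum_k e k * sin (2 * pi * f * t k)) ^+ 2.

Lemma trig_energy_ge0 n (e t : 'I_n -> R) f : 0 <= trig_energy e t f.
Proof. by rewrite addr_ge0// sqr_ge0. Qed.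

Lemma trig_energyE n (e t : 'I_n -> R) f : trig_energy e t f =
  \sum_k \sum_l e k * e l * cos (2 * pi * f * (t k - t l)).
Proof.
rewrite /trig_energy !expr2 !mulr_suml -big_split/=; apply: eq_bigr => k _.
rewrite !mulr_sumr -big_split/=; apply: eq_bigr => l _.
by rewrite mulrBr cosB; ring.
Qed.

Lemma measurable_trig_energy n (e t : 'I_n -> R) : measurable_fun setT (trig_energy e t).
Proof.
have m1 k : measurable_fun setT (fun f : R => 2 * pi * f * t k).
  by apply: measurable_funM => //; exact: measurable_funM.
apply: measurable_funD; apply: measurable_funX; apply: measurable_sum => k;
  apply: measurable_funM => //; apply: measurableT_comp (m1 k).
- exact: measurable_cos.
- exact: measurable_sin.
Qed.

Lemma trig_energy_sum n (U : 'M[R]_n) (t : 'I_n -> R) f : U *m U^T = 1%:M ->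
  \sum_j trig_energy (U j) t f = n%:R.
Proof.
move=> UU; have {UU}UU : U^T *m U = 1%:M by exact: mulmx1C.
have key (x : 'I_n -> R) : \sum_j (\sum_k U j k * x k) ^+ 2 = \sum_k x k ^+ 2.
  transitivity (\sum_j \sum_k \sum_l U j k * U j l * (x k * x l)).
    apply: eq_bigr => j _; rewrite expr2 mulr_suml; apply: eq_bigr => k _.
    by rewrite mulr_sumr; apply: eq_bigr => l _; ring.
  rewrite exchange_big/=; apply: eq_bigr => k _.
  rewrite exchange_big/= (bigD1 k)//= [X in _ + X]big1 ?addr0.
    rewrite -mulr_suml expr2; have := congr1 (fun M : 'M[R]_n => M k k) UU.
    rewrite !mxE eqxx mulr1n => h.
    suff -> : \sum_i U i k * U i k = 1 by rewrite mul1r.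
    by rewrite -[RHS]h; apply: eq_bigr => j _; rewrite mxE.
  move=> l lk; rewrite -mulr_suml; have := congr1 (fun M : 'M[R]_n => M k l) UU.
  rewrite !mxE eq_sym (negbTE lk) mulr0n => h.
  suff -> : \sum_i U i k * U i l = 0 by rewrite mul0r.
  by rewrite -[RHS]h; apply: eq_bigr => j _; rewrite mxE.
rewrite big_split/= !key -big_split/=.
under eq_bigr do rewrite cos2Dsin2.
by rewrite sumr_const card_ord.
Qed.

Lemma trig_energy_row_le n (U : 'M[R]_n) (t : 'I_n -> R) f j : U *m U^T = 1%:M ->
  trig_energy (U j) t f <= n%:R.
Proof.
move=> /(trig_energy_sum t f) <-; rewrite (bigD1 j)//= lerDl.
by apply: sumr_ge0 => i _; exact: trig_energy_ge0.
Qed.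

Lemma sin_pi_nat (k : nat) : sin (k%:R * pi) = 0 :> R.
Proof.
elim: k => [|k IH]; first by rewrite mul0r sin0.
by rewrite -addn1 natrD mulrDl mul1r sinDpi IH oppr0.
Qed.

Lemma Rint_cos_period (dl : R) (k l : nat) : 0 < dl ->
  \int[leb]_(f in `[- (2 * dl)^-1, (2 * dl)^-1]) cos (2 * pi * f * (k%:R * dl - l%:R * dl)) =
  (k == l)%:R / dl.
Proof.
move=> d0; set B := (2 * dl)^-1.
have B0 : 0 < B by rewrite invr_gt0 mulr_gt0.
have BB : - B < B by lra.
have [->|kl] := eqVneq k l.
  under eq_Rintegral do rewrite subrr mulr0 cos0.
  rewrite Rintegral_cst//= lebesgue_measure_itv/= lte_fin BB mul1r opprK/= mul1r.
  by rewrite /B; field; rewrite gt_eqF.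
pose c := 2 * pi * (k%:R * dl - l%:R * dl).
have c0 : c != 0.
  apply: mulf_neq0; first by rewrite gt_eqF// mulr_gt0 ?pi_gt0.
  by rewrite -mulrBl; apply: mulf_neq0; [rewrite subr_eq0 eqr_nat|rewrite gt_eqF].
have dF (x : R) : is_derive x 1 (fun x => c^-1 * sin (0 + c * x)) (cos (0 + c * x)).
  apply: is_derive_eq (is_deriveM (is_derive_cst c^-1 x 1) (sin_affine_is_derive 0 c x)) _.
  by rewrite /GRing.scale/=; field.
have E f : cos (2 * pi * f * (k%:R * dl - l%:R * dl)) = cos (0 + c * f).
  by congr cos; rewrite /c; ring.
under eq_Rintegral do rewrite E.
rewrite /Rintegral (@continuous_FTC2 _ _ (fun x => c^-1 * sin (0 + c * x)) _ _ BB).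
- rewrite /= !add0r mulrN sinN.
  have -> : c * B = k%:R * pi - l%:R * pi by rewrite /c /B; field; rewrite gt_eqF.
  by rewrite sinB !sin_pi_nat mul0r mulr0 subrr oppr0 mulr0 subrr mul0r.
- apply: continuous_subspaceT; exact: is_derive_continuous (cos_affine_is_derive 0 c).
- split; first by move=> x _; case: (dF x).
  + apply: cvg_at_right_filter; exact: (is_derive_continuous dF).
  + apply: cvg_at_left_filter; exact: (is_derive_continuous dF).
- by move=> x _; rewrite derive1E; apply: derive_val.
Qed.

End trigonometric_energy.

Section bathtub.
Context {R : realType}.
Local Notation leb := (@lebesgue_measure R).

Lemma subset_of_measure (B : set R) (m : R) : measurable B -> 0 <= m ->
  (m%:E < leb B)%E -> exists B', [/\ measurable B', B' `<=` B & leb B' = m%:E].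
Proof.
move=> mB m0 mlt.
pose K (n : nat) : set R := `[- n%:R, n%:R]%classic.
have mBK n : measurable (B `&` K n) by apply: measurableI => //; exact: measurable_itv.
have bigK : \bigcup_n (B `&` K n) = B by rewrite -setI_bigcupr bigcup_itvT setIT.
have cvgK : (fun n => leb (B `&` K n)) @ \oo --> leb B.
  rewrite -[X in _ --> leb X]bigK; apply: nondecreasing_cvg_mu => //.
    by rewrite bigK.
  move=> n p np; apply/subsetPset => x [Bx].
  rewrite /K/= !in_itv/= => /andP[h1 h2]; split=> //.
  have : n%:R <= p%:R :> R by rewrite ler_nat.
  by move: (n%:R : R) (p%:R : R) h1 h2 => a b; lra.
have [n mn] : exists n, (m%:E < leb (B `&` K n))%E.
  apply: contrapT => /forallNP h; move: mlt; apply/negP; rewrite -leNgt.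
  rewrite -(cvg_lim _ cvgK)//; apply: lime_le; first by apply/cvg_ex; exists (leb B).
  by apply: nearW => n; rewrite leNgt; apply/negP; exact: h.
have n0 : - n%:R <= n%:R :> R by apply: (@le_trans _ _ 0); [rewrite oppr_le0|]; exact: ler0n.
pose J (x : R) : set R := `[- n%:R, x]%classic.
have mJ x : measurable (J x) by exact: measurable_itv.
pose h x := parameterized_integral leb (- n%:R) x (\1_B : R -> R).
have mBJ x : measurable (B `&` J x) by apply: measurableI => //; exact: mJ.
have indic_int x : (\int[leb]_(t in J x) (\1_B t)%:E = leb (B `&` J x))%E.
  rewrite integral_indic; [by []|exact: mJ|exact: mB]. 
have fin x : (leb (B `&` J x) < +oo)%E.
  apply: (@le_lt_trans _ _ (leb (J x))).
    by apply: le_measure; [apply: mem_set; exact: mBJ|apply: mem_set; exact: mJ|exact: subIsetr].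
  by rewrite /= lebesgue_measure_itv/=; case: ifP => _; rewrite -?EFinB ltry.
have hE x : (h x)%:E = leb (B `&` J x).
  rewrite /h /parameterized_integral /Rintegral indic_int fineK//.
  by rewrite ge0_fin_numE.
have ch : {within `[- n%:R, n%:R], continuous h}.
  apply: parameterized_integral_continuous => //.
  apply: measurable_bounded_integrable => //=.
  - by rewrite lebesgue_measure_itv/=; case: ifP => _; rewrite -?EFinB ltry.
  - by exists 1; split=> // y y1 x _; apply: le_trans (ltW y1); exact: indic_abs_le1.
have hl : h (- n%:R) = 0.
  apply: EFin_inj; rewrite hE /J set_itv1.
  apply: (subset_measure0 _ _ _ (lebesgue_measure_set1 (- n%:R : R))) => //.
  by apply: measurableI => //; exact: measurable_set1.
have hr : m < h n%:R by rewrite -lte_fin hE.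
have [c _ hc] : exists2 c, c \in `[(- n%:R : R), n%:R] & h c = m.
  apply: IVT => //; rewrite hl min_l; last by rewrite (le_trans m0)// ltW.
  by rewrite m0/= le_max (ltW hr) orbT.
exists (B `&` J c); split; last by rewrite -hE hc.
- exact: mBJ.
- exact: subIsetl.
Qed.

Lemma integral_ge_cst (S : R -> R) (B : set R) (s m : R) : measurable_fun setT S ->
  measurable B -> 0 <= s -> leb B = m%:E -> (forall f, B f -> s <= S f) ->
  ((s * m)%:E <= \int[leb]_(f in B) (S f)%:E)%E.
Proof.
move=> mS mB s0 Bm sS; rewrite EFinM -Bm -integral_cst//.
apply: ge0_le_integral => //.
- by apply/measurable_EFinP; exact: (measurable_funS _ _ mS).
Qed.

Lemma integral_le_cst (S : R -> R) (B : set R) (s m : R) : measurable_fun setT S ->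
  measurable B -> leb B = m%:E -> (forall f, B f -> 0 <= S f <= s) ->
  (\int[leb]_(f in B) (S f)%:E <= (s * m)%:E)%E.
Proof.
move=> mS mB Bm sS; rewrite EFinM -Bm -integral_cst//.
apply: ge0_le_integral => //.
- by move=> f Bf; rewrite lee_fin; have /andP[] := sS f Bf.
- by apply/measurable_EFinP; exact: (measurable_funS _ _ mS).
- by move=> f Bf; rewrite lee_fin; have /andP[] := sS f Bf.
Qed.

Variables (S : R -> R) (fs : R) (F : set R).
Hypothesis iS : intg leb S.
Hypothesis S0 : forall f, 0 <= S f.
Hypothesis F_opt : optimal_passband S fs F.

Let mS : measurable_fun setT S. Proof. exact: intg_mfun iS. Qed.
Let mF : measurable F. Proof. by case: F_opt. Qed.
Let Ffs : (leb F <= fs%:E)%E. Proof. by case: F_opt. Qed.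

Let Flty : (leb F < +oo)%E. Proof. exact: le_lt_trans Ffs (ltry _). Qed.

Let intG_fin (G : set R) : measurable G -> (\int[leb]_(f in G) (S f)%:E)%E \is a fin_num.
Proof.
move=> mG; apply: integrable_fin_num => //.
by apply: (integrableS _ _ _ iS).
Qed.

Let upper s : set R := [set f | s <= S f].
Let lower s : set R := [set f | S f <= s].

Let mupper s : measurable (upper s).
Proof.
have -> : upper s = S @^-1` `[s, +oo[%classic.
  by apply/seteqP; split=> f; rewrite /upper /= in_itv/= andbT.
by rewrite -[X in measurable X]setTI; exact: mS.
Qed.

Let mlower s : measurable (lower s).
Proof.
have -> : lower s = S @^-1` `]-oo, s]%classic.
  by apply/seteqP; split=> f; rewrite /lower /= in_itv.
by rewrite -[X in measurable X]setTI; exact: mS.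
Qed.

Let setU_int (A B : set R) : measurable A -> measurable B -> A `&` B = set0 ->
  (\int[leb]_(f in A `|` B) (S f)%:E =
   \int[leb]_(f in A) (S f)%:E + \int[leb]_(f in B) (S f)%:E)%E.
Proof.
move=> mA mB AB; apply: ge0_integral_setU => //.
- by apply/measurable_EFinP; apply: (measurable_funS _ _ mS) => //; exact: measurableU.
- by move=> f _; rewrite lee_fin.
- by apply/disj_setPS => f; rewrite AB.
Qed.

Let exchange (A B : set R) (m s1 s2 : R) : measurable A -> measurable B ->
  A `<=` F -> B `&` F = set0 -> leb A = m%:E -> leb B = m%:E -> 0 < m ->
  0 <= s2 -> A `<=` lower s1 -> B `<=` upper s2 -> s2 <= s1.
Proof.
move=> mA mB AF BF Am Bm m0 s20 Al Bu.
have mFA : measurable (F `\` A) by exact: measurableD.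
have disj1 : (F `\` A) `&` B = set0.
  by apply/seteqP; split=> // f [[Ff _] Bf]; rewrite -BF.
have disj2 : (F `\` A) `&` A = set0 by rewrite setDE -setIA setICl setI0.
have FE : F = (F `\` A) `|` A.
  by rewrite setUC setDUK.
have GE : leb ((F `\` A) `|` B) = leb F.
  rewrite [in RHS]FE !measureU//.
  by congr (_ + _)%E; transitivity (m%:E).
have [_ _] := F_opt => /(_ ((F `\` A) `|` B)).
rewrite GE => /(_ (measurableU _ _ mFA mB) Ffs).
rewrite [X in (_ <= \int[leb]_(f in X) _)%E -> _]FE !setU_int//.
rewrite leeD2lE ?intG_fin// => h.
have h1 := integral_ge_cst mS mB s20 Bm Bu.
have h2 : (\int[leb]_(f in A) (S f)%:E <= (s1 * m)%:E)%E.
  by apply: integral_le_cst => // f /Al ->; rewrite S0.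
have := le_trans h1 (le_trans h h2).
by rewrite lee_fin ler_pM2r.
Qed.

Let dichotomy s1 s2 : s1 < s2 -> 0 <= s2 ->
  leb (upper s2 `\` F) = 0 \/ leb (lower s1 `&` F) = 0.
Proof.
move=> s12 s20; have [->|Bn] := eqVneq (leb (upper s2 `\` F)) 0; first by left.
have [->|An] := eqVneq (leb (lower s1 `&` F)) 0; first by right.
have mB : measurable (upper s2 `\` F) by exact: measurableD.
have mA : measurable (lower s1 `&` F) by exact: measurableI.
have Bp : (0 < leb (upper s2 `\` F))%E by rewrite lt_def Bn measure_ge0.
have Ap : (0 < leb (lower s1 `&` F))%E by rewrite lt_def An measure_ge0.
have [m m0 [m1 m2]] : exists2 m : R, 0 < m &
    (m%:E < leb (upper s2 `\` F))%E /\ (m%:E < leb (lower s1 `&` F))%E.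
  have half (x : \bar R) : (0 < x)%E -> exists2 m : R, 0 < m & (m%:E < x)%E.
    case: x => [r|_|//]; last by exists 1 => //; exact: ltry.
    by rewrite lte_fin => r0; exists (r / 2); rewrite ?lte_fin; lra.
  have [m1 m10 h1] := half _ Bp; have [m2 m20 h2] := half _ Ap.
  exists (Num.min m1 m2); first by rewrite lt_min m10.
  split; [apply: le_lt_trans h1|apply: le_lt_trans h2];
    by rewrite lee_fin ge_min lexx ?orbT.
have [B' [mB' B'B B'm]] := subset_of_measure mB (ltW m0) m1.
have [A' [mA' A'A A'm]] := subset_of_measure mA (ltW m0) m2.
have := exchange (s1 := s1) (s2 := s2) mA' mB' _ _ A'm B'm m0 s20 _ _.
move=> h; suff : s2 <= s1 by rewrite leNgt s12.
apply: h.
- by move=> f /A'A[].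
- by apply/seteqP; split=> // f [/B'B[_ nF] Ff].
- by move=> f /A'A[].
- by move=> f /B'B[].
Qed.

Let full s : 0 < s -> leb (upper s `\` F) != 0 -> leb F = fs%:E.
Proof.
move=> s0 Bn; apply/eqP; rewrite eq_le Ffs/= leNgt; apply/negP => Flt.
have mB : measurable (upper s `\` F) by exact: measurableD.
have Bp : (0 < leb (upper s `\` F))%E by rewrite lt_def Bn measure_ge0.
have [r Fr] : exists r : R, leb F = r%:E.
  by exists (fine (leb F)); rewrite fineK// ge0_fin_numE.
rewrite Fr lte_fin in Flt.
have [m [m0 mr m1]] : exists m : R, [/\ 0 < m, m <= fs - r & (m%:E < leb (upper s `\` F))%E].
  case: (leb (upper s `\` F)) Bp => [x|_|//]; last first.
    by exists (fs - r); split; rewrite ?ltry//; lra.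
  rewrite lte_fin => x0; exists (Num.min (fs - r) (x / 2)).
  by rewrite lt_min ge_min lexx lte_fin gt_min; split=> //;
    [apply/andP; split; lra|apply/orP; right; lra].
have [B' [mB' B'B B'm]] := subset_of_measure mB (ltW m0) m1.
have disj : F `&` B' = set0 by apply/seteqP; split=> // f [Ff /B'B[_]].
have GU : (leb (F `|` B') <= fs%:E)%E.
  have -> : leb (F `|` B') = (leb F + leb B')%E by exact: measureU.
  by rewrite Fr B'm -EFinD lee_fin; lra.
have [_ _] := F_opt => /(_ (F `|` B') (measurableU _ _ mF mB') GU).
rewrite setU_int//.
rewrite -[leRHS]adde0 leeD2lE ?intG_fin// => h.
have h1 : ((s * m)%:E <= \int[leb]_(f in B') (S f)%:E)%E.
  by apply: integral_ge_cst => //; [exact: ltW|move=> f /B'B[]].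
have := le_trans h1 h; rewrite lee_fin.
by apply/negP; rewrite -ltNge mulr_gt0.
Qed.

Let null_bigcup (A : nat -> set R) : (forall n, measurable (A n)) ->
  (forall n, leb (A n) = 0) -> leb (\bigcup_n A n) = 0.
Proof.
move=> mA A0; apply/negligibleP; first exact: bigcupT_measurable.
apply: negligible_bigcup => n; apply/negligibleP; [exact: mA|exact: A0].
Qed.

Lemma waterfill_bathtub (theta : R) : 0 < theta -> 0 < fs ->
  exists2 c : R, 0 <= c &
    \int[leb]_f Num.max (waterfill theta (S f) - c) 0 <=
    \int[leb]_f (waterfill theta (S f) * \1_F f) - c * fs.
Proof.
move=> t0 fs0.
pose W f := waterfill theta (S f).
have W0 f : 0 <= W f by exact: waterfill_ge0.
have mW : measurable_fun setT W by exact: measurableT_comp (measurable_waterfill _) mS.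
have iW : intg leb W.
  apply: (@intg_le _ _ _ leb _ _ mW iS) => f.
  by rewrite ger0_norm//; exact: waterfill_le_id.
have iWF : intg leb (fun f => W f * \1_F f).
  apply: (intgMb (C := 1) iW); first exact: measurable_indic.
  by move=> f; exact: indic_abs_le1.
have iF : intg leb (\1_F : R -> R).
  apply/integrableP; split; first by apply/measurable_EFinP; exact: measurable_indic.
  rewrite (_ : (\int[leb]_x _)%E = leb F)//.
  transitivity (\int[leb]_x (\1_F x)%:E)%E; last by rewrite integral_indic ?setIT.
  by apply: eq_integral => x _; rewrite gee0_abs ?lee_fin.
have mUF s : measurable (upper s `\` F) by exact: measurableD.
have mLF s : measurable (lower s `&` F) by exact: measurableI.
have ae_le (c : R) (Z : set R) : 0 <= c -> measurable Z -> leb Z = 0 ->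
    (forall f, ~ Z f -> Num.max (W f - c) 0 <= W f * \1_F f - c * \1_F f) ->
    \int[leb]_f Num.max (W f - c) 0 <= \int[leb]_f (W f * \1_F f) - c * \int[leb]_f \1_F f.
  move=> c0 mZ Z0 h.
  have iL : intg leb (fun f => Num.max (W f - c) 0).
    apply: (@intg_le _ _ _ leb _ _ _ iW) => [|f].
      by apply: measurable_maxr => //; exact: measurable_funB.
    rewrite ger0_norm; last by rewrite le_max lexx orbT.
    by rewrite ge_max W0 andbT lerBlDr lerDl.
  have iR : intg leb (fun f => W f * \1_F f - c * \1_F f) by apply: intgB => //; exact: intgZ.
  rewrite -RintZ// -RintB//; last exact: intgZ.
  rewrite /Rintegral; apply: fine_le; [exact: intg_fin_num|exact: intg_fin_num|].
  have off (g : R -> R) : intg leb g ->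
      (\int[leb]_f (g f)%:E = \int[leb]_(f in setT `\` Z) (g f)%:E)%E.
    by move=> ig; apply: negligible_integral.
  rewrite (off _ iL) (off _ iR).
  apply: le_integral.
  - by apply: measurableD.
  - by apply: (integrableS _ _ _ iL) => //; apply: measurableD.
  - by apply: (integrableS _ _ _ iR) => //; apply: measurableD.
  - by move=> f /set_mem[_ nZ]; rewrite lee_fin; exact: h.
have [allU|] := pselect (forall s, theta < s -> leb (upper s `\` F) = 0).
  exists 0 => //; rewrite mul0r subr0.
  pose A n := upper (theta + n.+1%:R^-1) `\` F.
  have mA n : measurable (A n) by exact: measurableD.
  have := @ae_le 0 (\bigcup_n A n); rewrite mul0r subr0; apply => //.
  - exact: bigcupT_measurable.
  - by apply: null_bigcup => // n; apply: allU; rewrite ltrDl invr_gt0.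
  - move=> f nA; rewrite mul0r !subr0 max_l// indicE.
    have [_|/negP nF] := boolP (f \in F); first by rewrite mulr1.
    have [St|tS] := leP (S f) theta; first by rewrite /W waterfill_le// mul0r.
    exfalso; apply: nA.
    have [n _ hn] : exists2 n, True & theta + n.+1%:R^-1 <= S f.
      have d0 : 0 < S f - theta by rewrite subr_gt0.
      exists (Num.truncn (S f - theta)^-1) => //.
      rewrite -lerBrDl -[leRHS]invrK lef_pV2 ?posrE ?invr_gt0//.
      exact/ltW/truncnS_gt.
    exists n => //; split=> //; apply: contra_not nF; exact: mem_set.
move=> /existsNP[s0 /not_implyP[ts0 Bn]].
have s00 : 0 < s0 by exact: lt_trans ts0.
have FE : leb F = fs%:E by apply: (full s00); exact/eqP.
pose E := [set s | 0 < s /\ leb (upper s `\` F) != 0].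
have Es0 : E s0 by split=> //; exact/eqP.
have upperE s s' : E s -> 0 < s' -> s' <= s -> E s'.
  move=> [_ us] s'0 ss'; split=> //; apply: contra us => /eqP h; apply/eqP.
  apply: (subset_measure0 _ _ _ h); [exact: mUF|exact: mUF|].
  by move=> f [sf nF]; split=> //; exact: le_trans sf.
have bnd : has_sup E.
  split; first by exists s0.
  apply: contrapT => nb.
  have allE s : 0 < s -> E s.
    move=> sp; apply: contrapT => nE; apply: nb; exists s => s' Es'.
    by rewrite leNgt; apply/negP => ss'; apply: nE; apply: upperE Es' sp (ltW ss').
  have Ffull : F = \bigcup_n (lower n%:R `&` F).
    rewrite -setI_bigcupl; apply/seteqP; split=> [f Ff|f []//]; split=> //.
    exists (Num.truncn (S f)).+1 => //=; exact/ltW/truncnS_gt.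
  have : leb F = 0.
    rewrite Ffull; apply: null_bigcup => n; first exact: mLF.
    have [] := @dichotomy n%:R n.+1%:R _ _ => //; first by rewrite ltr_nat.
    by have [_ /eqP] := allE n.+1%:R (ltr0Sn _ _).
  by rewrite FE => -[]; move/eqP; rewrite gt_eqF.
pose t := sup E.
have ts0' : s0 <= t by exact: (sup_upper_bound bnd Es0).
have tt : theta < t by exact: lt_le_trans ts0'.
have t00 : 0 < t by exact: lt_trans tt.
pose A n := upper (t + n.+1%:R^-1) `\` F.
pose B n := lower (t - n.+1%:R^-1) `&` F.
have mA n : measurable (A n) by exact: measurableD.
have mB n : measurable (B n) by exact: measurableI.
have A0 n : leb (A n) = 0.
  apply: contrapT => /eqP h; have : E (t + n.+1%:R^-1).
    by split => //; rewrite addr_gt0// invr_gt0.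
  by move/(sup_upper_bound bnd); rewrite -/t gerDl leNgt invr_gt0 ltr0Sn.
have B0 n : leb (B n) = 0.
  have [] := @sup_adherent _ E (n.+1%:R^-1 / 2) _ bnd; first by rewrite divr_gt0// invr_gt0.
  move=> s Es; rewrite -/t => ts; have [sp us] := Es.
  have [] := @dichotomy (t - n.+1%:R^-1) s _ (ltW sp) => //.
    have : 0 < n.+1%:R^-1 :> R by rewrite invr_gt0.
    by move: (n.+1%:R^-1 : R) ts => q ts q0; lra.
  by move/eqP; rewrite (negbTE us).
exists (waterfill theta t); first by apply: waterfill_ge0 => //; exact: ltW.
have mF1 : \int[leb]_f \1_F f = fs.
  have h : (\int[leb]_x (\1_F x)%:E = fs%:E)%E by rewrite integral_indic ?setIT//; exact: FE.
  by rewrite /Rintegral h.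
have := @ae_le (waterfill theta t) ((\bigcup_n A n) `|` (\bigcup_n B n)).
rewrite mF1; apply; first by apply: waterfill_ge0 => //; exact: ltW.
- by apply: measurableU; exact: bigcupT_measurable.
- by rewrite null_set_setU//; [exact: bigcupT_measurable|exact: bigcupT_measurable|
    exact: null_bigcup|exact: null_bigcup].
- move=> f /not_orP[nA nB]; rewrite indicE.
  have pos (x y : R) : x < y -> exists n, x + n.+1%:R^-1 <= y.
    move=> xy; have d0 : 0 < y - x by rewrite subr_gt0.
    exists (Num.truncn (y - x)^-1).
    rewrite -lerBrDl -[leRHS]invrK lef_pV2 ?posrE ?invr_gt0//.
    exact/ltW/truncnS_gt.
  have [/set_mem Ff|/negP nF] := boolP (f \in F).
    rewrite !mulr1 max_l// subr_ge0; apply: (waterfill_homo t0 (ltW t00)).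
    rewrite leNgt; apply/negP => /pos[n hn]; apply: nB; exists n => //; split=> //.
    by rewrite /lower/= lerBrDr.
  rewrite !mulr0 subrr ge_max lexx andbT subr_le0; apply: (waterfill_homo t0 (S0 f)).
  rewrite leNgt; apply/negP => /pos[n hn]; apply: nA; exists n => //; split=> //.
  by apply: contra_not nF; exact: mem_set.
Qed.

End bathtub.

(** * Gaussian processes *)

Section difference_quotients.
Context {R : realType}.

Lemma cvg_quotient0 (f : R -> R) (l : R) (h : nat -> R) :
  is_derive (0 : R) 1 f l -> f 0 = 0 -> (forall n, h n != 0) ->
  h n @[n --> \oo] --> (0 : R) ->
  (f (h n) / h n) @[n --> \oo] --> l.
Proof.
move=> [df <-] f0 hn0 h0.
have := df => /cvg_ex[/= l' hl].
have -> : 'D_1 f 0 = l' by apply/cvg_lim.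
move/cvgr_dnbhsP : hl => /(_ h (conj hn0 h0)).
apply: cvg_trans; apply: near_eq_cvg; apply: nearW => n.
by rewrite /= f0 subr0 addr0 /GRing.scale/= mulr1 mulrC.
Qed.

Lemma harmonic_cvg0 : (n.+1%:R^-1 : R) @[n --> \oo] --> (0 : R).
Proof. exact: cvg_harmonic. Qed.

Lemma sin_abs_le (x : R) : `|sin x| <= `|x|.
Proof.
wlog x0 : x / 0 <= x => [h|].
  have [/h//|x0] := leP 0 x.
  by rewrite -normrN -sinN -(normrN x); apply: h; rewrite oppr_ge0 ltW.
have dsin (y : R) : is_derive y 1 sin (cos y) by exact: is_derive_sin.
have [->|xn] := eqVneq x 0; first by rewrite sin0.
have xp : 0 < x by rewrite lt_def xn.
have [c _] := @MVT R sin cos 0 x xp (fun y _ => dsin y)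
  (continuous_subspaceT (fun y => @continuous_sin R y)).
rewrite sin0 !subr0 => ->; rewrite normrM ler_piMl//.
exact: cos_max.
Qed.

Lemma cvg_sin_quotient (x : R) :
  (sin (n.+1%:R^-1 * x) * n.+1%:R) @[n --> \oo] --> x.
Proof.
have d : is_derive (0 : R) 1 (fun h : R => sin (0 + x * h)) x.
  apply: is_derive_eq (sin_affine_is_derive 0 x 0) _.
  by rewrite mulr0 addr0 cos0 mulr1.
have := cvg_quotient0 d _ (fun n => _) harmonic_cvg0.
rewrite mulr0 addr0 sin0 => /(_ erefl) h.
have : (sin (0 + x * n.+1%:R^-1) / n.+1%:R^-1) @[n --> \oo] --> x by apply: h => n; rewrite gt_eqF// invr_gt0.
apply: cvg_trans; apply: near_eq_cvg; apply: nearW => n.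
by rewrite /= add0r invrK (mulrC x).
Qed.

End difference_quotients.

Section moments_from_cosines.
Context {R : realType} {d : measure_display} {Omega : measurableType d}.
Variable P : probability Omega R.

Let q (n : nat) : R := n.+1%:R^-1.

Let qK n : q n * n.+1%:R = 1. Proof. by rewrite mulVf. Qed.

Let q2_cvg0 : q n ^+ 2 @[n --> \oo] --> (0 : R).
Proof.
have h : q n * q n @[n --> \oo] --> (0 * 0 : R).
  by apply: cvgM; exact: harmonic_cvg0.
by rewrite mulr0 in h.
Qed.

Lemma cos_mean (L : Omega -> R) (m s2 : R) : L2 P L ->
  (forall u, \int[P]_w sin (u * L w) = expR (- (s2 * u ^+ 2) / 2) * sin (u * m)) ->
  \int[P]_w L w = m.
Proof.
move=> lL hL; have mL := L2_mfun lL.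
have m1 n : measurable_fun setT (fun w => sin (q n * L w) * n.+1%:R).
  apply: measurable_funM => //; apply: measurableT_comp measurable_sin _.
  exact: measurable_funM.
have c1 w : (sin (q n * L w) * n.+1%:R) @[n --> \oo] --> L w by exact: cvg_sin_quotient.
have b1 n w : `|sin (q n * L w) * n.+1%:R| <= `|L w|.
  rewrite normrM (ger0_norm (x := n.+1%:R))//.
  apply: (@le_trans _ _ (`|q n * L w| * n.+1%:R)); first by rewrite ler_wpM2r// sin_abs_le.
  by rewrite normrM mulrAC (ger0_norm (x := q n)) ?qK ?mul1r// invr_ge0.
have [_ lim] := Rint_dct m1 c1 b1 (intg_norm (L2_intg lL)).
apply: (cvg_unique _ lim) => //.
have -> : (fun n => \int[P]_w (sin (q n * L w) * n.+1%:R)) =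
    (fun n => expR (- (s2 * q n ^+ 2) / 2) * (sin (q n * m) * n.+1%:R)).
  apply/funext => n; rewrite RintZr ?hL ?mulrA//.
  apply: (@intg_bd _ _ _ P _ 1); last by move=> w; exact: sin_max.
  by apply: measurableT_comp measurable_sin _; exact: measurable_funM.
have e1 : - (s2 * q n ^+ 2) / 2 @[n --> \oo] --> - (s2 * 0) / 2.
  apply: cvgM; last exact: cvg_cst.
  by apply: cvgN; apply: cvgM; [exact: cvg_cst|exact: q2_cvg0].
have e2 : expR (- (s2 * q n ^+ 2) / 2) @[n --> \oo] --> expR (- (s2 * 0) / 2).
  by apply: (cvg_comp _ _ e1); exact: continuous_expR.
have := cvgM e2 (@cvg_sin_quotient R m).
rewrite mulr0 oppr0 mul0r expR0 mul1r. exact.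
Qed.

Lemma cos_second_moment (L : Omega -> R) (s2 : R) : L2 P L ->
  (forall u, \int[P]_w cos (u * L w) = expR (- (s2 * u ^+ 2) / 2)) ->
  \int[P]_w (L w ^+ 2) = s2.
Proof.
move=> lL hL; have mL := L2_mfun lL.
have E n w : 2 * (1 - cos (q n * L w)) / q n ^+ 2 =
    (2 * (sin (q n * (L w / 2)) * n.+1%:R)) ^+ 2.
  have -> : q n * L w = q n * (L w / 2) + q n * (L w / 2) by field.
  move: (q n * (L w / 2)) => y; rewrite cosD.
  have -> : 1 - (cos y * cos y - sin y * sin y) = 2 * sin y ^+ 2.
    by have := cos2Dsin2 y; lra.
  by rewrite /q; field.
have mc n : measurable_fun setT (fun w => cos (q n * L w)).
  by apply: measurableT_comp measurable_cos _; exact: measurable_funM.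
have m1 n : measurable_fun setT (fun w => 2 * (1 - cos (q n * L w)) / q n ^+ 2).
  by apply: measurable_funM => //; apply: measurable_funM => //; exact: measurable_funB.
have c1 w : (2 * (1 - cos (q n * L w)) / q n ^+ 2) @[n --> \oo] --> L w ^+ 2.
  have h : (2 * (sin (q n * (L w / 2)) * n.+1%:R)) @[n --> \oo] --> L w.
    have {2}-> : L w = 2 * (L w / 2) by field.
    by apply: cvgM; [exact: cvg_cst|exact: cvg_sin_quotient].
  under eq_fun do rewrite E expr2.
  by rewrite expr2; apply: cvgM.
have b1 n w : `|2 * (1 - cos (q n * L w)) / q n ^+ 2| <= L w ^+ 2.
  rewrite E ger0_norm ?sqr_ge0// -[leLHS]real_normK ?num_real//.
  rewrite -[leRHS]real_normK ?num_real// lerXn2r ?nnegrE//.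
  rewrite !normrM (ger0_norm (x := n.+1%:R))// (ger0_norm (x := 2))//.
  have := sin_abs_le (q n * (L w / 2)).
  rewrite normrM (ger0_norm (x := q n)) ?invr_ge0// => h.
  apply: (@le_trans _ _ (2 * (q n * `|L w / 2| * n.+1%:R))).
    by rewrite ler_wpM2l// ler_wpM2r.
  rewrite (mulrAC (q n)) qK mul1r normrM (ger0_norm (x := 2^-1))//.
  by rewrite mulrCA divff ?mulr1.
have [_ lim] := Rint_dct m1 c1 b1 (L2_sqr lL).
apply: (cvg_unique _ lim) => //.
have -> : (fun n => \int[P]_w (2 * (1 - cos (q n * L w)) / q n ^+ 2)) =
    (fun n => 2 * (1 - expR (- (s2 * q n ^+ 2) / 2)) / q n ^+ 2).
  have ic n : intg P (fun w => cos (q n * L w)).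
    by apply: (@intg_bd _ _ _ P _ 1) => // w; exact: cos_max.
  have i1 n : intg P (fun w => 1 - cos (q n * L w)) by apply: intgB => //; exact: intg_cst.
  apply/funext => n; rewrite RintZr; last exact: intgZ.
  by rewrite RintZ// RintB ?Rint_cst ?hL//; exact: intg_cst.
apply: (@cvg_quotient0 _ (fun y => 2 * (1 - expR (- (s2 * y) / 2))) s2 (fun n => q n ^+ 2)).
- have h : is_derive (0 : R) 1 (fun y : R => - (s2 * y) / 2) (- s2 / 2).
    by apply: trigger_derive; rewrite /GRing.scale/=; field.
  have h2 := is_derive1_comp (is_derive_expR _) h.
  have h3 := is_deriveB (is_derive_cst (1 : R) (0 : R) 1) h2.
  apply: is_derive_eq (is_deriveM (is_derive_cst (2 : R) (0 : R) 1) h3) _.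
  by rewrite /GRing.scale/= mulr0 oppr0 mul0r expR0; field.
- by rewrite mulr0 oppr0 mul0r expR0 subrr mulr0.
- by move=> n; rewrite expf_neq0// gt_eqF// invr_gt0.
- exact: q2_cvg0.
Qed.

Lemma gaussian_cos (L : Omega -> R) : L2 P L -> gaussian_rv P L ->
  \int[P]_w L w = 0 -> forall v,
  \int[P]_w cos (v + L w) = expR (- (\int[P]_w (L w ^+ 2)) / 2) * cos v.
Proof.
move=> lL gL L0; have [m [s hs]] := gaussian_rv_cos (L2_mfun lL) gL.
have m0 : m = 0.
  rewrite -L0; apply/esym/(@cos_mean _ _ (s ^+ 2) lL) => u.
  have := hs (- (pi / 2)) u.
  have -> : cos (- (pi / 2) + u * m) = sin (u * m) by rewrite addrC cosBpihalf.
  by move=> <-; apply: Rint_eq => w; rewrite addrC cosBpihalf.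
have s2 : \int[P]_w (L w ^+ 2) = s ^+ 2.
  apply: cos_second_moment => // u; have := hs 0 u.
  rewrite m0 mulr0 addr0 cos0 mulr1 => <-.
  by apply: Rint_eq => w; rewrite add0r.
move=> v; rewrite s2; have := hs v 1; rewrite m0 mulr0 addr0 expr1n mulr1 => <-.
by apply: Rint_eq => w; rewrite mul1r.
Qed.

End moments_from_cosines.

Section combinations.
Context {R : realType} {d : measure_display} {Omega : measurableType d}.
Variable P : probability Omega R.

Definition comb (Z : R -> Omega -> R) (a : seq (R * R)) (w : Omega) : R :=
  \sum_(p <- a) p.1 * Z p.2 w.

Lemma comb_cat Z a b w : comb Z (a ++ b) w = comb Z a w + comb Z b w.
Proof. by rewrite /comb big_cat. Qed.

Definition scale_comb (c : R) (a : seq (R * R)) : seq (R * R) :=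
  [seq (c * p.1, p.2) | p <- a].

Lemma comb_scale Z c a w : comb Z (scale_comb c a) w = c * comb Z a w.
Proof. by rewrite /comb big_map mulr_sumr; apply: eq_bigr => p _; rewrite mulrA. Qed.

Lemma combD Z1 Z2 a w : comb (fun t w => Z1 t w + Z2 t w) a w = comb Z1 a w + comb Z2 a w.
Proof. by rewrite /comb -big_split/=; apply: eq_bigr => p _; rewrite mulrDr. Qed.

Lemma comb_tnth Z a w : comb Z a w =
  \sum_(i < size a) (tnth (in_tuple a) i).1 * Z (tnth (in_tuple a) i).2 w.
Proof. by rewrite /comb (big_tnth _ _ a). Qed.

Lemma L2_comb Z a : (forall t, L2 P (Z t)) -> L2 P (comb Z a).
Proof. by move=> lZ; apply: L2_sum => p _; exact: L2Z. Qed.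

Lemma Rint_comb (Z : R -> Omega -> R) a : (forall t, L2 P (Z t)) ->
  \int[P]_w comb Z a w = \sum_(p <- a) p.1 * \int[P]_w Z p.2 w.
Proof.
move=> lZ; rewrite Rint_sum; last by move=> p _; exact/intgZ/L2_intg.
by apply: eq_bigr => p _; rewrite RintZ//; exact: L2_intg.
Qed.

Lemma Rint_combM (Z : R -> Omega -> R) a W : (forall t, L2 P (Z t)) -> L2 P W ->
  \int[P]_w (W w * comb Z a w) = \sum_(p <- a) p.1 * \int[P]_w (W w * Z p.2 w).
Proof.
move=> lZ lW; transitivity (\int[P]_w (\sum_(p <- a) p.1 * (W w * Z p.2 w))).
  by apply: Rint_eq => w; rewrite mulr_sumr; apply: eq_bigr => p _; rewrite mulrCA.
rewrite Rint_sum; last by move=> p _; exact/intgZ/L2M.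
by apply: eq_bigr => p _; rewrite RintZ//; exact: L2M.
Qed.

End combinations.

Section processes.
Context {R : realType} {d : measure_display} {Omega : measurableType d}.
Variable P : probability Omega R.
Implicit Types (X Z : R -> {RV P >-> R}).

Lemma psd_moment X S : has_psd X S -> forall t s,
  L2 P (X t) /\ \int[P]_w (X t w * X s w) =
    \int[lebesgue_measure]_f (S f * cos (2 * pi * (t - s) * f)).
Proof.
move=> [S0 iS h] t s; split.
  split; first exact: measurable_funPT.
  have [c hc _] := h t t; rewrite unlock in hc.
  apply/integrableP; split.
    by apply/measurable_EFinP; apply: measurable_funX; exact: measurable_funPT.
  rewrite (_ : (\int[P]_x _)%E = c%:E) ?ltry// -hc.
  by apply: eq_integral => w _; rewrite /= ger0_norm ?sqr_ge0// expr2.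
have [c hc cE] := h t s; rewrite unlock in hc.
transitivity c; first by rewrite /Rintegral hc.
have := congr1 (@complex.Re R) cE => /= ->.
by apply: Rint_eq => f; rewrite mul0r subr0.
Qed.

Lemma zero_mean_Rint X t : zero_mean X -> \int[P]_w X t w = 0.
Proof. by move=> /(_ t); rewrite unlock /Rintegral => ->. Qed.

Lemma comb_gaussian X a : gaussian_process X -> gaussian_rv P (comb X a).
Proof.
move=> gX; have := gX (size a) (fun i => (tnth (in_tuple a) i).1) (fun i => (tnth (in_tuple a) i).2).
by congr (gaussian_rv P _); apply/funext => w; rewrite comb_tnth.
Qed.

Lemma comb_cos X S a v : gaussian_process X -> zero_mean X -> has_psd X S ->
  \int[P]_w cos (v + comb X a w) = expR (- (\int[P]_w (comb X a w ^+ 2)) / 2) * cos v.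
Proof.
move=> gX zX pX; have lX t : L2 P (X t) by have [] := psd_moment pX t t.
apply: gaussian_cos; [exact: L2_comb|exact: comb_gaussian|].
by rewrite Rint_comb// big1// => p _; rewrite zero_mean_Rint// mulr0.
Qed.

Lemma independent_cos X Z a b u v : independent_processes X Z ->
  (forall t, L2 P (X t)) -> (forall t, L2 P (Z t)) ->
  \int[P]_w (cos (u + comb X a w) * cos (v + comb Z b w)) =
  (\int[P]_w cos (u + comb X a w)) * \int[P]_w cos (v + comb Z b w).
Proof.
move=> ind lX lZ.
pose n := size a; pose m := size b.
pose ta (i : 'I_n) := tnth (in_tuple a) i; pose tb (i : 'I_m) := tnth (in_tuple b) i.
pose XX (i : 'I_n) : Omega -> R := X (ta i).2; pose ZZ (i : 'I_m) : Omega -> R := Z (tb i).2.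
have mX i : measurable_fun setT (XX i) by exact: measurable_funPT.
have mZ i : measurable_fun setT (ZZ i) by exact: measurable_funPT.
have meas_box k (Y : 'I_k -> Omega -> R) (A : 'I_k -> set R) :
    (forall i, measurable_fun setT (Y i)) -> (forall i, measurable (A i)) ->
    measurable [set w | forall i, A i (Y i w)].
  move=> mY mA; have -> : [set w | forall i, A i (Y i w)] = \big[setI/setT]_(i < k) (Y i @^-1` A i).
    rewrite -bigcap_seq; apply/seteqP; split=> w /=; first by move=> h i _; exact: h.
    by move=> h i; apply: h; rewrite /= mem_index_enum.
  apply: bigsetI_measurable => i _.
  by rewrite -[X in measurable X]setTI; exact: mY.
pose cosf k (c : 'I_k -> R) (x : R) (t : k.-tuple R) := cos (x + \sum_i c i * tnth t i).
have mcosf k (c : 'I_k -> R) x : measurable_fun setT (cosf k c x).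
  apply: measurableT_comp measurable_cos _; apply: measurable_funD => //.
  by apply: measurable_sum => i; apply: measurable_funM => //; exact: measurable_tnth.
have cosfE (Y : R -> Omega -> R) (l : seq (R * R)) (x : R) w :
    cos (x + comb Y l w) = cosf _ (fun i => (tnth (in_tuple l) i).1) x
      (tuple_of_fun (fun i : 'I_(size l) => Y (tnth (in_tuple l) i).2) w).
  rewrite comb_tnth; congr cos; congr (_ + _); apply: eq_bigr => i _.
  by rewrite tnth_mktuple.
have ind_int (A : set Omega) : measurable A -> \int[P]_w \1_A w = fine (P A).
  by move=> mA; rewrite /Rintegral integral_indic ?setIT.
have step1 (B : 'I_m -> set R) : (forall i, measurable (B i)) ->
    \int[P]_w ((\1_[set w | forall i, B i (ZZ i w)] w -
       fine (P [set w | forall i, B i (ZZ i w)])) * cos (u + comb X a w)) = 0.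
  move=> mB; set EB := [set w | _]; have mEB : measurable EB by exact: meas_box.
  have iEB : intg P (\1_EB : Omega -> R) by exact/L2_intg/L2_indic.
  have ir : intg P (fun w => \1_EB w - fine (P EB)) by apply: intgB => //; exact: intg_cst.
  under Rint_eq do rewrite (cosfE X).
  apply: (@box_orth_bounded _ _ _ P n XX _ _ 1) => // [A mA|t]; last exact: cos_max.
  set EA := [set w | _]; have mEA : measurable EA by exact: meas_box.
  transitivity (\int[P]_w (\1_(EA `&` EB) w - fine (P EB) * \1_EA w)).
    apply: Rint_eq => w; rewrite !indicE in_setI.
    by case: (w \in EA); case: (w \in EB); rewrite /= ?mulr1 ?mulr0 ?subr0 ?sub0r ?mul1r ?mulr0.
  have mAB : measurable (EA `&` EB) by exact: measurableI.
  have iAB : intg P (\1_(EA `&` EB) : Omega -> R) by exact/L2_intg/L2_indic.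
  have iA : intg P (\1_EA : Omega -> R) by exact/L2_intg/L2_indic.
  rewrite RintB// ?RintZ//; last exact: intgZ.
  rewrite !ind_int// /EA /EB ind//= fineM ?fin_num_measure//.
  by rewrite mulrC subrr.
have mcX : measurable_fun setT (fun w => cos (u + comb X a w)).
  apply: measurableT_comp measurable_cos _; apply: measurable_funD => //.
  exact: L2_mfun (L2_comb a lX).
have iX : intg P (fun w => cos (u + comb X a w)).
  by apply: (@intg_bd _ _ _ P _ 1) => // w; exact: cos_max.
have mcZ : measurable_fun setT (fun w => cos (v + comb Z b w)).
  apply: measurableT_comp measurable_cos _; apply: measurable_funD => //.
  exact: L2_mfun (L2_comb b lZ).
have iZ : intg P (fun w => cos (v + comb Z b w)).
  by apply: (@intg_bd _ _ _ P _ 1) => // w; exact: cos_max.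
set EX := \int[P]_w cos (u + comb X a w).
have ir : intg P (fun w => cos (u + comb X a w) - EX) by apply: intgB => //; exact: intg_cst.
have : \int[P]_w ((cos (u + comb X a w) - EX) * cos (v + comb Z b w)) = 0.
  under Rint_eq do rewrite [in X in _ * X](cosfE Z).
  apply: (@box_orth_bounded _ _ _ P m ZZ _ _ 1) => // [B mB|t]; last exact: cos_max.
  have := step1 B mB; set EB := [set w | _]; have mEB : measurable EB by exact: meas_box.
  have iEB : intg P (\1_EB : Omega -> R) by exact/L2_intg/L2_indic.
  have iXB : intg P (fun w => \1_EB w * cos (u + comb X a w)).
    by apply: (intgMb (C := 1)) => // w; exact: cos_max.
  have -> : \int[P]_w ((\1_EB w - fine (P EB)) * cos (u + comb X a w)) =
     \int[P]_w (\1_EB w * cos (u + comb X a w) - fine (P EB) * cos (u + comb X a w)).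
    by apply: Rint_eq => w; ring.
  rewrite RintB ?RintZ//; last exact: intgZ.
  have -> : \int[P]_w ((cos (u + comb X a w) - EX) * \1_EB w) =
     \int[P]_w (\1_EB w * cos (u + comb X a w) - EX * \1_EB w).
    by apply: Rint_eq => w; ring.
  rewrite RintB ?RintZ//; last exact: intgZ.
  by rewrite ind_int// mulrC.
have -> : \int[P]_w ((cos (u + comb X a w) - EX) * cos (v + comb Z b w)) =
   \int[P]_w (cos (u + comb X a w) * cos (v + comb Z b w) - EX * cos (v + comb Z b w)).
  by apply: Rint_eq => w; ring.
rewrite RintB ?RintZ//; last 2 first.
- by apply: (intgMb (C := 1)) => // w; exact: cos_max.
- exact: intgZ.
by move/eqP; rewrite subr_eq0 => /eqP.
Qed.

End processes.

Lemma le_of_small {R : realType} (x y K : R) : 0 <= K ->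
  (forall e : R, 0 < e <= 1 -> x <= y + e * K) -> x <= y.
Proof.
move=> K0 h; rewrite leNgt; apply/negP => yx.
have hp : 0 < 2 * (K + (x - y)) by lra.
have := h ((x - y) / (2 * (K + (x - y)))).
rewrite divr_gt0 ?subr_gt0// ler_pdivrMr// => /(_ _).
have -> : x - y <= 1 * (2 * (K + (x - y))) by lra.
move=> /(_ isT); apply/negP; rewrite -ltNge -ltrBrDl mulrAC ltr_pdivrMr//.
have : 0 < x - y by lra.
move: (x - y) => z z0; nra.
Qed.

Section closure.
Context {R : realType} {d : measure_display} {Omega : measurableType d}.
Variable P : probability Omega R.
Implicit Types (C : set (Omega -> R)) (f g L W : Omega -> R).

Definition L2closure C L : Prop := L2 P L /\
  forall e : R, 0 < e -> exists L', [/\ C L', L2 P L' & \int[P]_w ((L w - L' w) ^+ 2) <= e].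

Lemma L2closure_L2 C L : L2closure C L -> L2 P L. Proof. by case. Qed.

Lemma subset_L2closure C L : L2 P L -> C L -> L2closure C L.
Proof.
move=> lL CL; split=> // e e0; exists L; split=> //.
under Rint_eq do rewrite subrr expr0n/=.
by rewrite Rint0 ltW.
Qed.

Lemma L2closure_mono C1 C2 L : C1 `<=` C2 -> L2closure C1 L -> L2closure C2 L.
Proof.
by move=> C12 [lL h]; split=> // e /h[L' [CL lL' ?]]; exists L'; split=> //; exact: C12.
Qed.

Definition linear_set C := forall f g (c : R), C f -> C g -> C (fun w => f w + c * g w).

Lemma L2closure_lin C f g (c : R) : linear_set C -> L2closure C f -> L2closure C g ->
  L2closure C (fun w => f w + c * g w).
Proof.
move=> lin [lf hf] [lg hg]; split; first by apply: L2D => //; exact: L2Z.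
move=> e e0; have c0 : 0 < 4 * (c ^+ 2 + 1) by have := sqr_ge0 c; lra.
have e4 : 0 < e / 4 by lra.
have e5 : 0 < e / (4 * (c ^+ 2 + 1)) by rewrite divr_gt0.
have [f' [Cf lf' fe]] := hf _ e4; have [g' [Cg lg' ge]] := hg _ e5.
exists (fun w => f' w + c * g' w); split; [exact: lin|by apply: L2D => //; exact: L2Z|].
have i1 : intg P (fun w => (f w - f' w) ^+ 2) by apply: L2_sqr; exact: L2B.
have i2 : intg P (fun w => (g w - g' w) ^+ 2) by apply: L2_sqr; exact: L2B.
apply: (@le_trans _ _ (\int[P]_w (2 * (f w - f' w) ^+ 2 + (2 * c ^+ 2) * (g w - g' w) ^+ 2))).
  apply: Rint_le.
  - by apply: L2_sqr; apply: L2B; apply: L2D => //; exact: L2Z.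
  - by apply: intgD; exact: intgZ.
  - move=> w; set x := f w - f' w; set y := g w - g' w.
    have -> : f w + c * g w - (f' w + c * g' w) = x + c * y by rewrite /x /y; ring.
    rewrite -subr_ge0 (_ : _ - _ = (x - c * y) ^+ 2) ?sqr_ge0//; ring.
rewrite RintD ?RintZ//; [|exact: intgZ..].
have c2 : 0 <= c ^+ 2 by exact: sqr_ge0.
have h : 2 * c ^+ 2 * \int[P]_w ((g w - g' w) ^+ 2) <= e / 2.
  apply: (@le_trans _ _ (2 * c ^+ 2 * (e / (4 * (c ^+ 2 + 1))))).
    by apply: ler_wpM2l => //; lra.
  rewrite mulrA ler_pdivrMr//; nra.
lra.
Qed.

Lemma L2closure_sum C (I : Type) (s : seq I) (c : I -> R) (F : I -> Omega -> R) :
  linear_set C -> C (fun=> 0) -> (forall i, L2closure C (F i)) ->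
  L2closure C (fun w => \sum_(i <- s) c i * F i w).
Proof.
move=> lin C0 CF; elim: s => [|i s ih].
  have -> : (fun w => \sum_(i <- [::]) c i * F i w) = fun=> 0.
    by apply/funext => w; rewrite big_nil.
  by apply: subset_L2closure => //; exact: L2_cst.
have -> : (fun w => \sum_(j <- i :: s) c j * F j w) =
    (fun w => \sum_(j <- s) c j * F j w + c i * F i w).
  by apply/funext => w; rewrite big_cons addrC.
exact: L2closure_lin.
Qed.

Definition gaussian_cosine L : Prop := forall v,
  \int[P]_w cos (v + L w) = expR (- (\int[P]_w (L w ^+ 2)) / 2) * cos v.

Lemma cos_lipschitz (x y : R) : `|cos x - cos y| <= `|x - y|.
Proof.
have key (a b : R) : a < b -> `|cos b - cos a| <= `|b - a|.
  move=> ab; have dcos (z : R) : is_derive z 1 cos (- sin z) by exact: is_derive_cos.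
  have [c _ ->] := @MVT R cos (fun z => - sin z) a b ab (fun z _ => dcos z)
    (continuous_subspaceT (fun z => @continuous_cos R z)).
  by rewrite normrM normrN ler_piMl// sin_max.
have [xy|yx|->] := ltgtP x y.
- by rewrite distrC (distrC x); exact: key.
- exact: key.
- by rewrite !subrr.
Qed.

Lemma expRN_lipschitz (x y : R) : 0 <= x -> 0 <= y ->
  `|expR (- x / 2) - expR (- y / 2)| <= `|x - y|.
Proof.
have key (a b : R) : 0 <= a -> a <= b -> `|expR (- a / 2) - expR (- b / 2)| <= b - a.
  move=> a0 ab; rewrite ger0_norm; last by rewrite subr_ge0 ler_expR; lra.
  have -> : expR (- b / 2) = expR (- a / 2) * expR (- (b - a) / 2).
    by rewrite -expRD; congr expR; field.
  have e1 : expR (- a / 2) <= 1 by rewrite -[leRHS]expR0 ler_expR; lra.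
  have e0 := expR_ge0 (- a / 2).
  have h : 1 + - (b - a) / 2 <= expR (- (b - a) / 2) by exact: expR_ge1Dx.
  nra.
move=> x0 y0; have [xy|yx] := leP x y.
  by rewrite [leRHS]distrC [leRHS]ger0_norm ?subr_ge0//; exact: key.
by rewrite distrC [leRHS]ger0_norm ?subr_ge0 ?(ltW yx)//; apply: key => //; exact: ltW.
Qed.

Lemma L2closure_gaussian C L : C `<=` gaussian_cosine -> L2closure C L ->
  gaussian_cosine L.
Proof.
move=> CG [lL hL] v.
have mcos f : L2 P f -> intg P (fun w => cos (v + f w)).
  move=> lf; apply: (@intg_bd _ _ _ P _ 1); last by move=> w; exact: cos_max.
  by apply: measurableT_comp measurable_cos _; apply: measurable_funD => //; exact: L2_mfun lf.
pose K : R := 2 + \int[P]_w (L w ^+ 2) + 2.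
have q0 f : 0 <= \int[P]_w (f w ^+ 2) by apply: Rint_ge0 => w; exact: sqr_ge0.
have K0 : 0 <= K by rewrite /K; have := q0 L; lra.
apply/eqP; rewrite -subr_eq0 -normr_eq0 eq_le normr_ge0 andbT.
apply: (le_of_small K0) => e /andP[e0 e1]; rewrite add0r.
have [L' [CL' lL' he]] := hL (e ^+ 2) (exprn_gt0 2 e0).
set D := \int[P]_w ((L w - L' w) ^+ 2) in he.
have lD : L2 P (fun w => L w - L' w) by exact: L2B.
have iD := L2_sqr lD.
have h1 : `|\int[P]_w cos (v + L w) - \int[P]_w cos (v + L' w)| <= e.
  rewrite -RintB; [|exact: mcos..].
  apply: le_trans (Rint_abs _) _; first by apply: intgB; exact: mcos.
  apply: (@le_trans _ _ (\int[P]_w (e / 2 + e^-1 / 2 * (L w - L' w) ^+ 2))).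
    apply: Rint_le.
    - by apply: intg_norm; apply: intgB; exact: mcos.
    - by apply: intgD; [exact: intg_cst|exact: intgZ].
    - move=> w; apply: le_trans (cos_lipschitz _ _) _.
      have -> : v + L w - (v + L' w) = L w - L' w by ring.
      rewrite -[(L w - L' w) ^+ 2]real_normK ?num_real//; set x := `|_|.
      rewrite -subr_ge0 (_ : _ - _ = e^-1 / 2 * (e - x) ^+ 2); last by field; rewrite gt_eqF.
      by rewrite mulr_ge0 ?sqr_ge0// divr_ge0// invr_ge0 ltW.
  have j2 : intg P (fun w => e^-1 / 2 * (L w - L' w) ^+ 2) by exact: intgZ.
  rewrite RintD ?Rint_cst// ?RintZ//; last exact: intg_cst.
  have : e^-1 / 2 * D <= e / 2.
    rewrite [leRHS](_ : e / 2 = e^-1 / 2 * e ^+ 2); last by field; rewrite gt_eqF.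
    by rewrite ler_wpM2l// divr_ge0// invr_ge0 ltW.
  by rewrite /D; lra.
have iL := L2_sqr lL; have iL' := L2_sqr lL'; have iLD := L2M lL lD.
have h2 : `|\int[P]_w (L w ^+ 2) - \int[P]_w (L' w ^+ 2)| <= e * (\int[P]_w (L w ^+ 2) + 2).
  have -> : \int[P]_w (L' w ^+ 2) = \int[P]_w (L w ^+ 2 - 2 * (L w * (L w - L' w)) + (L w - L' w) ^+ 2).
    by apply: Rint_eq => w; ring.
  have j1 : intg P (fun w => 2 * (L w * (L w - L' w))) by exact: intgZ.
  have j2 := intgB iL j1.
  rewrite RintD// RintB// RintZ//.
  rewrite -/D; set A := \int[P]_w (L w ^+ 2); set B := \int[P]_w (L w * _).
  have hB : `|2 * B| <= e * A + e^-1 * D.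
    rewrite -RintZ//; apply: le_trans (Rint_abs _) _; first exact: intgZ.
    apply: (@le_trans _ _ (\int[P]_w (e * L w ^+ 2 + e^-1 * (L w - L' w) ^+ 2))).
      apply: Rint_le.
      - exact/intg_norm/intgZ.
      - by apply: intgD; exact: intgZ.
      - move=> w; set x := L w; set y := L w - L' w.
        have ei : 0 <= e^-1 by rewrite invr_ge0 ltW.
        rewrite ler_norml; apply/andP; split.
          rewrite -subr_ge0 (_ : _ - _ = e^-1 * (e * x + y) ^+ 2); last by field; rewrite gt_eqF.
          by rewrite mulr_ge0 ?sqr_ge0.
        rewrite -subr_ge0 (_ : _ - _ = e^-1 * (e * x - y) ^+ 2); last by field; rewrite gt_eqF.
        by rewrite mulr_ge0 ?sqr_ge0.
    by rewrite RintD ?RintZ//; exact: intgZ.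
  have hD : e^-1 * D <= e.
    rewrite [leRHS](_ : e = e^-1 * e ^+ 2); last by field; rewrite gt_eqF.
    by rewrite ler_wpM2l// invr_ge0 ltW.
  have D0 : 0 <= D by exact: q0.
  have -> : A - (A - 2 * B + D) = 2 * B - D by ring.
  apply: le_trans (ler_normB _ _) _; rewrite (ger0_norm D0).
  have : D <= e by nra.
  lra.
have h3 := expRN_lipschitz (q0 L') (q0 L).
rewrite distrC in h3.
have -> : \int[P]_w cos (v + L w) - expR (- (\int[P]_w (L w ^+ 2)) / 2) * cos v =
   (\int[P]_w cos (v + L w) - \int[P]_w cos (v + L' w)) -
   (expR (- (\int[P]_w (L w ^+ 2)) / 2) - expR (- (\int[P]_w (L' w ^+ 2)) / 2)) * cos v.
  by rewrite (CG _ CL' v); ring.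
apply: le_trans (ler_normB _ _) _; rewrite normrM.
have h4 : `|expR (- (\int[P]_w (L w ^+ 2)) / 2) - expR (- (\int[P]_w (L' w ^+ 2)) / 2)| * `|cos v|
    <= `|expR (- (\int[P]_w (L w ^+ 2)) / 2) - expR (- (\int[P]_w (L' w ^+ 2)) / 2)|.
  by rewrite ler_piMr// cos_max.
rewrite [X in _ <= X]distrC in h3.
rewrite /K; lra.
Qed.

Lemma L2closure_le C W L (Q : R) : L2 P W ->
  (forall L', C L' -> 2 * \int[P]_w (W w * L' w) - \int[P]_w (L' w ^+ 2) <= Q) ->
  L2closure C L -> 2 * \int[P]_w (W w * L w) - \int[P]_w (L w ^+ 2) <= Q.
Proof.
move=> lW hQ [lL hL].
pose A := \int[P]_w ((W w - L w) ^+ 2).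
have A0 : 0 <= A + 2 by rewrite addr_ge0// Rint_ge0// => w; exact: sqr_ge0.
apply: (le_of_small A0) => e /andP[e0 e1].
have [L' [CL' lL' he]] := hL (e ^+ 2) (exprn_gt0 2 e0).
set D := \int[P]_w ((L w - L' w) ^+ 2) in he.
have lD : L2 P (fun w => L w - L' w) by exact: L2B.
have lWL : L2 P (fun w => W w - L w) by exact: L2B.
apply: le_trans (_ : Q + (e * A + e^-1 * D + D) <= _).
  apply: le_trans (lerD (hQ _ CL') (lexx _)).
  have iWL := L2M lW lL; have iWL' := L2M lW lL'; have i1 := L2_sqr lL; have i2 := L2_sqr lL'.
  have i3 := L2_sqr lWL; have i4 := L2_sqr lD.
  have -> : 2 * \int[P]_w (W w * L w) - \int[P]_w (L w ^+ 2) =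
      \int[P]_w (2 * (W w * L w) - L w ^+ 2).
    by rewrite RintB ?RintZ//; exact: intgZ.
  have -> : 2 * \int[P]_w (W w * L' w) - \int[P]_w (L' w ^+ 2) + (e * A + e^-1 * D + D) =
      \int[P]_w ((2 * (W w * L' w) - L' w ^+ 2) +
         (e * (W w - L w) ^+ 2 + (e^-1 + 1) * (L w - L' w) ^+ 2)).
    have j1 : intg P (fun w => 2 * (W w * L' w)) by exact: intgZ.
    have j2 : intg P (fun w => e * (W w - L w) ^+ 2) by exact: intgZ.
    have j3 : intg P (fun w => (e^-1 + 1) * (L w - L' w) ^+ 2) by exact: intgZ.
    rewrite RintD; [|exact: intgB|exact: intgD].
    by rewrite RintB// RintD// !RintZ// -/A -/D; ring.
  apply: Rint_le.
  - by apply: intgB => //; exact: intgZ.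
  - by apply: intgD; [apply: intgB => //|apply: intgD]; exact: intgZ.
  - move=> w; rewrite -subr_ge0; have ei : 0 <= e^-1 by rewrite invr_ge0 ltW.
    rewrite (_ : _ - _ = e^-1 * (e * (W w - L w) - (L w - L' w)) ^+ 2).
      by rewrite mulr_ge0// sqr_ge0.
    by field; rewrite gt_eqF.
have hD : e^-1 * D <= e.
  rewrite [leRHS](_ : e = e^-1 * e ^+ 2); last by field; rewrite gt_eqF.
  by rewrite ler_wpM2l// invr_ge0 ltW.
have : D <= e by nra.
rewrite mulrDr; lra.
Qed.

End closure.

Lemma ge0_le_integral_setT {R : realType} {d : measure_display} {T : measurableType d}
  (mu : {measure set T -> \bar R}) (D : set T) (f g : T -> \bar R) :
  (forall x, D x -> 0 <= f x)%E -> (forall x, D x -> f x <= g x)%E ->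
  (\int[mu]_(x in D) f x <= \int[mu]_(x in D) g x)%E.
Proof.
move=> f0 fg.
rewrite ge0_integralE// ge0_integralE//; last by move=> x Dx; exact: le_trans (f0 _ Dx) (fg _ Dx).
apply: le_ereal_sup => _ [h hf <-]; exists h => // x.
apply: le_trans (hf x) _; rewrite /patch; case: ifPn => // /set_mem; exact: fg.
Qed.

Section spectral_form.
Context {R : realType}.
Implicit Types (S : R -> R) (a b : seq (R * R)).

Definition cosine_sum a (f : R) : R := \sum_(p <- a) p.1 * cos (2 * pi * f * p.2).
Definition sine_sum a (f : R) : R := \sum_(p <- a) p.1 * sin (2 * pi * f * p.2).

Lemma intg_cos S (x : R) : intg (@lebesgue_measure R) S ->
  intg lebesgue_measure (fun f => S f * cos (2 * pi * x * f)).
Proof.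
move=> iS; apply: (intgMb (C := 1)) => //; last by move=> f; exact: cos_max.
by apply: measurableT_comp measurable_cos _; exact: measurable_funM.
Qed.

Context {d : measure_display} {Omega : measurableType d}.
Variable P : probability Omega R.
Implicit Types (U V : R -> Omega -> R).

Definition cross_spectrum U V S := [/\ intg lebesgue_measure S,
   (forall t, L2 P (U t)), (forall t, L2 P (V t)) &
   forall t s, \int[P]_w (U t w * V s w) =
    \int[lebesgue_measure]_f (S f * cos (2 * pi * (t - s) * f))].

Lemma cross_spectrum_comb U V S a b : cross_spectrum U V S ->
  intg lebesgue_measure (fun f => S f *
     (cosine_sum a f * cosine_sum b f + sine_sum a f * sine_sum b f)) /\
  \int[P]_w (comb U a w * comb V b w) =
  \int[lebesgue_measure]_f (S f *
     (cosine_sum a f * cosine_sum b f + sine_sum a f * sine_sum b f)).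
Proof.
move=> [iS lU lV UV].
have E f : S f * (cosine_sum a f * cosine_sum b f + sine_sum a f * sine_sum b f) =
    \sum_(p <- a) \sum_(q <- b) p.1 * q.1 * (S f * cos (2 * pi * (p.2 - q.2) * f)).
  rewrite /cosine_sum /sine_sum !mulr_suml -big_split/= mulr_sumr.
  apply: eq_bigr => p _; rewrite !mulr_sumr -big_split/= mulr_sumr.
  apply: eq_bigr => q _.
  rewrite (_ : 2 * pi * (p.2 - q.2) * f = 2 * pi * f * p.2 - 2 * pi * f * q.2); last by ring.
  by rewrite cosB; ring.
have i0 p q : intg lebesgue_measure (fun f => p * (S f * cos (2 * pi * q * f))).
  by apply: intgZ; exact: intg_cos.
have i1 (p : R * R) : intg lebesgue_measure (fun f =>
    \sum_(q <- b) p.1 * q.1 * (S f * cos (2 * pi * (p.2 - q.2) * f))).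
  by apply: intg_sum => q _; exact: i0.
split.
  rewrite (funext E).
  by apply: intg_sum => p _; exact: i1.
rewrite (funext E) Rint_sum => [|p _]; last exact: i1.
rewrite Rint_combM//; last exact: L2_comb.
under eq_bigr do under Rint_eq do rewrite mulrC.
under eq_bigr do rewrite Rint_combM//.
rewrite (eq_bigr (fun q : R * R => \sum_(p <- a) p.1 * q.1 *
    \int[lebesgue_measure]_f (S f * cos (2 * pi * (p.2 - q.2) * f)))); last first.
  move=> q _; rewrite mulr_sumr; apply: eq_bigr => p _.
  by under Rint_eq do rewrite mulrC; rewrite UV mulrCA mulrA.
rewrite exchange_big/=; apply: eq_bigr => p _; rewrite Rint_sum => [|q _]; last exact: i0.
by apply: eq_bigr => q _; rewrite RintZ//; exact: intg_cos.
Qed.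

End spectral_form.

Section conditional_spectrum.
Context {R : realType}.
Variables (S_X S_eps : R -> R).
Hypotheses (SX0 : forall f, 0 <= S_X f) (Se0 : forall f, 0 <= S_eps f).
Hypotheses (iX : intg (@lebesgue_measure R) S_X) (ie : intg (@lebesgue_measure R) S_eps).

Lemma S_cond_ge0 f : 0 <= S_cond S_X S_eps f.
Proof. by rewrite divr_ge0// ?sqr_ge0// addr_ge0. Qed.

Lemma S_cond_le f : S_cond S_X S_eps f <= S_X f.
Proof.
rewrite /S_cond; have := SX0 f; rewrite le_eqVlt => /orP[/eqP<-|h].
  by rewrite expr0n/= mul0r.
rewrite ler_pdivrMr ?ltr_wpDr// expr2 ler_wpM2l//; have := Se0 f; lra.
Qed.

Lemma intg_S_cond : intg lebesgue_measure (S_cond S_X S_eps).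
Proof.
apply: intg_le iX _.
  have mX := intg_mfun iX; have me := intg_mfun ie.
  apply: measurable_funM; first exact: measurable_funX.
  rewrite (_ : (fun f => _^-1) = (fun f => (S_X f + S_eps f) `^ (-1))).
    by apply: (measurableT_comp (measurable_powR _)); exact: measurable_funD.
  by apply/funext => f; rewrite powR_inv1// addr_ge0.
by move=> f; rewrite !ger0_norm ?S_cond_ge0//; exact: S_cond_le.
Qed.

Lemma S_cond_quadratic f (x y x' y' : R) :
  2 * (S_X f * (x * x' + y * y')) - (S_X f + S_eps f) * (x' * x' + y' * y') <=
  S_cond S_X S_eps f * (x ^+ 2 + y ^+ 2).
Proof.
have := SX0 f; rewrite le_eqVlt => /orP[/eqP h|h].
  rewrite /S_cond -h expr0n/= !mul0r add0r.
  have : 0 <= S_eps f * (x' * x' + y' * y') by rewrite mulr_ge0// -!expr2 addr_ge0// sqr_ge0.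
  lra.
have s0 : 0 < S_X f + S_eps f by rewrite ltr_wpDr.
rewrite -subr_ge0 /S_cond.
rewrite (_ : _ - _ = (S_X f + S_eps f)^-1 * ((S_X f * x - (S_X f + S_eps f) * x') ^+ 2 +
   (S_X f * y - (S_X f + S_eps f) * y') ^+ 2)); last by field; rewrite gt_eqF.
by rewrite mulr_ge0 ?invr_ge0 ?(ltW s0)// addr_ge0// sqr_ge0.
Qed.

End conditional_spectrum.

Section observation.
Context {R : realType} {d : measure_display} {Omega : measurableType d}.
Variables (P : probability Omega R) (X eps : R -> {RV P >-> R}) (S_X S_eps : R -> R).
Hypotheses (X_gaussian : gaussian_process X) (X_zero_mean : zero_mean X)
  (X_psd : has_psd X S_X) (eps_gaussian : gaussian_process eps)
  (eps_zero_mean : zero_mean eps) (eps_psd : has_psd eps S_eps)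
  (X_eps_indep : independent_processes X eps).

Let lX t : L2 P (X t). Proof. by have [] := psd_moment X_psd t t. Qed.
Let le t : L2 P (eps t). Proof. by have [] := psd_moment eps_psd t t. Qed.

Lemma sum_cos a b v :
  \int[P]_w cos (v + (comb X a w + comb eps b w)) =
  expR (- (\int[P]_w (comb X a w ^+ 2) + \int[P]_w (comb eps b w ^+ 2)) / 2) * cos v.
Proof.
have E w : cos (v + (comb X a w + comb eps b w)) =
   cos (v + comb X a w) * cos (0 + comb eps b w) -
   cos (v - pi / 2 + comb X a w) * cos (- (pi / 2) + comb eps b w).
  rewrite (addrC (- (pi / 2))) cosBpihalf addrAC cosBpihalf add0r -cosD.
  by congr cos; ring.
have mc (Z : R -> {RV P >-> R}) c u : (forall t, L2 P (Z t)) ->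
    measurable_fun setT (fun w => cos (u + comb Z c w)).
  move=> lZ; apply: measurableT_comp measurable_cos _; apply: measurable_funD => //.
  exact: L2_mfun (L2_comb c lZ).
have ic u u' : intg P (fun w => cos (u + comb X a w) * cos (u' + comb eps b w)).
  apply: (intgMb (C := 1)); [|exact: mc|by move=> w; exact: cos_max].
  by apply: (@intg_bd _ _ _ P _ 1); [exact: mc|move=> w; exact: cos_max].
rewrite (funext E) RintB// !independent_cos//.
rewrite !(comb_cos _ _ X_gaussian X_zero_mean X_psd).
rewrite !(comb_cos _ _ eps_gaussian eps_zero_mean eps_psd).
have -> : cos (- (pi / 2)) = 0 :> R by rewrite -[X in cos X]add0r cosBpihalf sin0.
rewrite cos0 !mulr0 subr0 mulr1 mulrAC -expRD; congr (expR _ * _).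
by ring.
Qed.

Lemma sum_moment2 a b : \int[P]_w ((comb X a w + comb eps b w) ^+ 2) =
  \int[P]_w (comb X a w ^+ 2) + \int[P]_w (comb eps b w ^+ 2).
Proof.
apply: cos_second_moment; first by apply: L2D; exact: L2_comb.
move=> u; have := sum_cos (scale_comb u a) (scale_comb u b) 0.
have E (Z : R -> Omega -> R) c : (forall t, L2 P (Z t)) ->
    \int[P]_w (comb Z (scale_comb u c) w ^+ 2) = u ^+ 2 * \int[P]_w (comb Z c w ^+ 2).
  move=> lZ; under Rint_eq do rewrite comb_scale exprMn.
  by rewrite RintZ//; exact: L2_sqr (L2_comb c lZ).
rewrite cos0 mulr1 (E X)// (E eps)// -mulrDr [u ^+ 2 * _]mulrC => <-.
by apply: Rint_eq => w; rewrite add0r !comb_scale mulrDr.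
Qed.

Definition linear_observables : set (Omega -> R) :=
  [set L | exists a b, L = fun w => comb X a w + comb eps b w].

Lemma linear_observables_gaussian : linear_observables `<=` gaussian_cosine P.
Proof. by move=> _ [a [b ->]] v; rewrite sum_moment2 sum_cos. Qed.

Lemma linear_observables_linear : linear_set linear_observables.
Proof.
move=> _ _ c [a [b ->]] [a' [b' ->]].
exists (a ++ scale_comb c a'), (b ++ scale_comb c b'); apply/funext => w.
by rewrite !comb_cat !comb_scale; ring.
Qed.

Lemma linear_observables0 : linear_observables (fun=> 0).
Proof. by exists [::], [::]; apply/funext => w; rewrite /comb !big_nil addr0. Qed.

Lemma signal_observable t : linear_observables (X t).
Proof.
exists [:: (1, t)], [::]; apply/funext => w.
by rewrite /comb big_seq1 big_nil addr0 mul1r.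
Qed.

Lemma signal_noise_uncorrelated t s : \int[P]_w (X t w * eps s w) = 0.
Proof.
have := sum_moment2 [:: (1, t)] [:: (1, s)].
under Rint_eq do rewrite /comb !big_seq1/= !mul1r.
under [in X in _ = X + _ -> _]Rint_eq do rewrite /comb !big_seq1/= !mul1r.
under [in X in _ = _ + X -> _]Rint_eq do rewrite /comb !big_seq1/= !mul1r.
have i1 := L2_sqr (lX t); have i2 := L2_sqr (le s); have i3 := L2M (lX t) (le s).
have -> : \int[P]_w ((X t w + eps s w) ^+ 2) =
    \int[P]_w (X t w ^+ 2 + (2 * (X t w * eps s w) + eps s w ^+ 2)).
  by apply: Rint_eq => w; ring.
have i4 : intg P (fun w => 2 * (X t w * eps s w)) by exact: intgZ.
rewrite RintD//; last exact: intgD.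
rewrite RintD// RintZ//; lra.
Qed.

Let Z t w := X t w + eps t w.

Let iX : intg lebesgue_measure S_X. Proof. by case: X_psd. Qed.
Let ie : intg lebesgue_measure S_eps. Proof. by case: eps_psd. Qed.

Lemma signal_observation_spectrum : cross_spectrum P X Z S_X.
Proof.
split=> // [t|t s]; first exact: L2D.
have i1 := L2M (lX t) (lX s); have i2 := L2M (lX t) (le s).
have -> : \int[P]_w (X t w * Z s w) = \int[P]_w (X t w * X s w + X t w * eps s w).
  by apply: Rint_eq => w; rewrite /Z mulrDr.
rewrite RintD// signal_noise_uncorrelated addr0.
by have [] := psd_moment X_psd t s.
Qed.

Lemma observation_spectrum : cross_spectrum P Z Z (fun f => S_X f + S_eps f).
Proof.
split=> [|t|t|t s]; [exact: intgD|exact: L2D|exact: L2D|].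
have i1 := L2M (lX t) (lX s); have i2 := L2M (lX t) (le s).
have i3 := L2M (le t) (lX s); have i4 := L2M (le t) (le s).
have -> : \int[P]_w (Z t w * Z s w) = \int[P]_w ((X t w * X s w + X t w * eps s w) +
   (eps t w * X s w + eps t w * eps s w)).
  by apply: Rint_eq => w; rewrite /Z; ring.
have -> : \int[lebesgue_measure]_f ((S_X f + S_eps f) * cos (2 * pi * (t - s) * f)) =
  \int[lebesgue_measure]_f (S_X f * cos (2 * pi * (t - s) * f) +
     S_eps f * cos (2 * pi * (t - s) * f)) by apply: Rint_eq => f; rewrite mulrDl.
rewrite !RintD//; [|exact: intg_cos|exact: intg_cos|exact: intgD|exact: intgD].
rewrite signal_noise_uncorrelated.
have -> : \int[P]_w (eps t w * X s w) = 0.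
  by under Rint_eq do rewrite mulrC; exact: signal_noise_uncorrelated.
have [_ ->] := psd_moment X_psd t s; have [_ ->] := psd_moment eps_psd t s.
by rewrite addr0 add0r.
Qed.

Definition observations : set (Omega -> R) := [set L | exists a, L = comb Z a].

Lemma observations_linear : linear_set observations.
Proof.
move=> _ _ c [a ->] [a' ->]; exists (a ++ scale_comb c a').
by apply/funext => w; rewrite comb_cat comb_scale.
Qed.

Lemma observations0 : observations (fun=> 0).
Proof. by exists [::]; apply/funext => w; rewrite /comb big_nil. Qed.

Lemma observations_linear_observables : observations `<=` linear_observables.
Proof. by move=> _ [a ->]; exists a, a; apply/funext => w; rewrite -combD. Qed.

Lemma spectral_inequality n (e t : 'I_n -> R) L : L2closure P observations L ->
  2 * \int[P]_w ((\sum_k e k * X (t k) w) * L w) - \int[P]_w (L w ^+ 2) <=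
  \int[lebesgue_measure]_f (S_cond S_X S_eps f * trig_energy e t f).
Proof.
have [SX0 _ _] := X_psd; have [Se0 _ _] := eps_psd.
pose a := [seq (e k, t k) | k <- index_enum 'I_n].
have WE w : \sum_k e k * X (t k) w = comb X a w by rewrite /comb big_map.
under Rint_eq do rewrite WE.
apply: L2closure_le; first exact: L2_comb.
move=> _ [b ->].
have [i1 ->] := cross_spectrum_comb a b signal_observation_spectrum.
have [i2 hZ] := cross_spectrum_comb b b observation_spectrum.
under [X in _ - X <= _]Rint_eq do rewrite expr2.
rewrite hZ -RintZ// -RintB//; last exact: intgZ.
have TE f : trig_energy e t f = cosine_sum a f ^+ 2 + sine_sum a f ^+ 2.
  by rewrite /trig_energy /cosine_sum /sine_sum !big_map.
apply: Rint_le.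
- by apply: intgB => //; exact: intgZ.
- apply: (intgMb (C := (\sum_k `|e k|) ^+ 2 + (\sum_k `|e k|) ^+ 2)).
  + exact: intg_S_cond.
  + exact: measurable_trig_energy.
  + have sb (c : R -> R) f : (forall x, `|c x| <= 1) ->
      (\sum_k e k * c (2 * pi * f * t k)) ^+ 2 <= (\sum_k `|e k|) ^+ 2.
      move=> c1; rewrite -[leLHS]real_normK ?num_real// lerXn2r ?nnegrE ?sumr_ge0//.
      apply: le_trans (ler_norm_sum _ _ _) _; apply: ler_sum => k _.
      by rewrite normrM ler_piMr.
    move=> f; rewrite ger0_norm ?trig_energy_ge0// lerD// sb//.
    * by move=> x; exact: cos_max.
    * by move=> x; exact: sin_max.
- by move=> f; rewrite TE; exact: S_cond_quadratic.
Qed.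

End observation.

Section sample_closure.
Context {R : realType} {d : measure_display} {Omega : measurableType d}.
Variable P : probability Omega R.

Lemma Re_time_combination (Z : R -> Omega -> R) (a : seq (R[i] * R)) w :
  complex.Re (time_combination Z a w) = comb Z [seq (complex.Re p.1, p.2) | p <- a] w.
Proof.
rewrite /time_combination /comb big_map; elim: a => [|p a ih]; first by rewrite !big_nil.
rewrite !big_cons -ih; case: (\sum_(_ <- _) _) => x y; case: p => -[u v] t /=.
by rewrite mulr0 subr0.
Qed.

Lemma linear_functional_closure (Z : R -> Omega -> R) (S : R -> R)
    (phi : (R -> R[i]) -> R[i]) (V : {RV P >-> R}) :
  (forall t, L2 P (Z t)) -> is_linear_functional P Z S phi V ->
  L2closure P [set L | exists a, L = comb Z a] V.
Proof.
move=> lZ [h [_ _ [a [_ ha]]]].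
have mV : measurable_fun setT (V : Omega -> R) by exact: measurable_funPT.
have key e : 0 < e -> exists b, intg P (fun w => (V w - comb Z b w) ^+ 2) /\
    \int[P]_w ((V w - comb Z b w) ^+ 2) <= e.
  move=> e0.
  have ne : nbhs (0%E : \bar R) [set x | (x < e%:E)%E].
    rewrite nbhsE/=; exists [set x | (x < e%:E)%E] => //; split=> /=; last by rewrite lte_fin.
    exact: open_ereal_lt_ereal.
  have [k _ /(_ k (leqnn k))/= hk] := ha _ ne.
  pose b := [seq (complex.Re p.1, p.2) | p <- a k]; exists b.
  have mb : measurable_fun setT (fun w => (V w - comb Z b w) ^+ 2).
    apply: measurable_funX; apply: measurable_funB => //.
    exact: L2_mfun (L2_comb b lZ).
  have hb : (\int[P]_w ((V w - comb Z b w) ^+ 2)%:E < e%:E)%E.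
    apply: le_lt_trans hk; rewrite unlock; apply: ge0_le_integral_setT => w _.
      by rewrite lee_fin sqr_ge0.
    rewrite lee_fin /sqmod -Re_time_combination.
    case: (time_combination _ _ _) => x y /=.
    by rewrite lerDl sqr_ge0.
  have ib : intg P (fun w => (V w - comb Z b w) ^+ 2).
    apply/integrableP; split; first exact/measurable_EFinP.
    apply: le_lt_trans (lt_trans hb (ltry _)).
    by under eq_integral => w _ do rewrite /= ger0_norm ?sqr_ge0//.
  by split=> //; rewrite -lee_fin -RintE// ltW.
have lV : L2 P V.
  have [b [ib _]] := key 1 ltr01.
  have lb : L2 P (comb Z b) by exact: L2_comb.
  have : L2 P (fun w => V w - comb Z b w).
    by split=> //; apply: measurable_funB => //; exact: L2_mfun lb.
  move=> /L2D/(_ lb)/L2_eq; apply => w; by rewrite subrK.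
split=> // e /key[b [ib hb]]; exists (comb Z b); split=> //; first by exists b.
exact: L2_comb.
Qed.

End sample_closure.

(** * Gaussian codes *)

Section linear_combinations.
Context {R : realType} {d : measure_display} {Omega : measurableType d}.
Variable P : probability Omega R.

Lemma linear_set_sum (C : set (Omega -> R)) (I : Type) (s : seq I) (c : I -> R)
    (F : I -> Omega -> R) :
  linear_set C -> C (fun=> 0) -> (forall i, C (F i)) ->
  C (fun w => \sum_(i <- s) c i * F i w).
Proof.
move=> lin C0 CF; elim: s => [|i s ih].
  by rewrite (_ : (fun w => _) = fun=> 0)//; apply/funext => w; rewrite big_nil.
rewrite (_ : (fun w => _) = (fun w => \sum_(j <- s) c j * F j w + c i * F i w)).
  exact: lin.
by apply/funext => w; rewrite big_cons addrC.
Qed.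

Lemma Rint_linear_combination n (W : Omega -> R) (u : 'I_n -> R) (Y : 'I_n -> Omega -> R) :
  L2 P W -> (forall i, L2 P (Y i)) ->
  \int[P]_w (W w * \sum_i u i * Y i w) = \sum_i u i * \int[P]_w (W w * Y i w).
Proof.
move=> lW lY; transitivity (\int[P]_w (\sum_i u i * (W w * Y i w))).
  by apply: Rint_eq => w; rewrite mulr_sumr; apply: eq_bigr => i _; rewrite mulrCA.
rewrite Rint_sum; last by move=> i _; exact/intgZ/L2M.
by apply: eq_bigr => i _; rewrite RintZ//; exact: L2M.
Qed.

End linear_combinations.

Section gaussian_space.
Context {R : realType} {d : measure_display} {Omega : measurableType d}.
Variable P : probability Omega R.
Variable G : set (Omega -> R).
Hypotheses (G_lin : linear_set G) (G0 : G (fun=> 0))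
  (G_L2 : forall f, G f -> L2 P f) (G_cos : G `<=` gaussian_cosine P).

Lemma gaussian_orth_cos rho V v : G rho -> G V -> \int[P]_w (rho w * V w) = 0 ->
  \int[P]_w (rho w * cos (v + V w)) = 0.
Proof.
move=> Gr GV rV.
have lr := G_L2 Gr; have lV := G_L2 GV.
have mr := L2_mfun lr; have mV := L2_mfun lV.
have m2 (s : R) : \int[P]_w ((V w + s * rho w) ^+ 2) =
    \int[P]_w (V w ^+ 2) + s ^+ 2 * \int[P]_w (rho w ^+ 2).
  have i1 := L2_sqr lr; have i2 := L2_sqr lV; have i3 := L2M lr lV.
  have i4 : intg P (fun w => 2 * s * (rho w * V w)) by exact: intgZ.
  have i5 : intg P (fun w => s ^+ 2 * rho w ^+ 2) by exact: intgZ.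
  have -> : \int[P]_w ((V w + s * rho w) ^+ 2) =
      \int[P]_w (V w ^+ 2 + (2 * s * (rho w * V w) + s ^+ 2 * rho w ^+ 2)).
    by apply: Rint_eq => w; ring.
  rewrite RintD//; last exact: intgD.
  by rewrite RintD// !RintZ// rV mulr0 add0r.
have mc (s : R) : measurable_fun setT (fun w => cos (v + pi / 2 + (V w + s * rho w))).
  apply: measurableT_comp measurable_cos _; apply: measurable_funD => //.
  by apply: measurable_funD => //; exact: measurable_funM.
have ic (s : R) : intg P (fun w => cos (v + pi / 2 + (V w + s * rho w))).
  by apply: (@intg_bd _ _ _ P _ 1) => // w; exact: cos_max.
have zero (s : R) : \int[P]_w (cos (v + V w) * sin (s * rho w)) = 0.
  have : \int[P]_w (cos (v + pi / 2 + (V w + s * rho w)) -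
                 cos (v + pi / 2 + (V w + (- s) * rho w))) = 0.
    by rewrite RintB// !(G_cos (G_lin _ GV Gr)) !m2 sqrrN subrr.
  have -> : \int[P]_w (cos (v + pi / 2 + (V w + s * rho w)) -
                 cos (v + pi / 2 + (V w + (- s) * rho w))) =
     \int[P]_w ((-2) * (cos (v + V w) * sin (s * rho w))).
    apply: Rint_eq => w; rewrite !addrA (mulNr s) cosB (cosD (v + pi / 2 + V w)).
    by rewrite (addrAC v) sinDpihalf cosDpihalf; ring.
  rewrite RintZ; last first.
    apply: (intgMb (C := 1)); last by move=> w; exact: sin_max.
      apply: (@intg_bd _ _ _ P _ 1); last by move=> w; exact: cos_max.
      by apply: measurableT_comp measurable_cos _; exact: measurable_funD.
    by apply: measurableT_comp measurable_sin _; exact: measurable_funM.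
  by move/eqP; rewrite mulf_eq0 oppr_eq0 pnatr_eq0/= => /eqP.
pose f n w := cos (v + V w) * (sin (n.+1%:R^-1 * rho w) * n.+1%:R).
have f0 n : \int[P]_w f n w = 0.
  have -> : \int[P]_w f n w =
      \int[P]_w ((cos (v + V w) * sin (n.+1%:R^-1 * rho w)) * n.+1%:R).
    by apply: Rint_eq => w; rewrite /f mulrA.
  rewrite RintZr ?zero ?mul0r//.
  apply: (intgMb (C := 1)); last by move=> w; exact: sin_max.
    apply: (@intg_bd _ _ _ P _ 1); last by move=> w; exact: cos_max.
    by apply: measurableT_comp measurable_cos _; exact: measurable_funD.
  by apply: measurableT_comp measurable_sin _; exact: measurable_funM.
have mF n : measurable_fun setT (f n).
  apply: measurable_funM.
    by apply: measurableT_comp measurable_cos _; exact: measurable_funD.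
  apply: measurable_funM => //.
  by apply: measurableT_comp measurable_sin _; exact: measurable_funM.
have cF w : (f n w) @[n --> \oo] --> cos (v + V w) * rho w.
  by apply: cvgM; [exact: cvg_cst|exact: cvg_sin_quotient].
have bF n w : `|f n w| <= `|rho w|.
  rewrite /f normrM; apply: (@le_trans _ _ (1 * `|rho w|)); last by rewrite mul1r.
  rewrite ler_pM// ?cos_max// normrM.
  apply: le_trans (ler_wpM2r _ (sin_abs_le _)) _ => //.
  by rewrite normrM mulrAC -normrM mulVf ?normr1 ?mul1r// pnatr_eq0.
have ig : intg P (fun w => `|rho w|) by apply: intg_norm; exact: L2_intg.
have [_ L] := Rint_dct mF cF bF ig.
have -> : \int[P]_w (rho w * cos (v + V w)) = \int[P]_w (cos (v + V w) * rho w).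
  by apply: Rint_eq => w; rewrite mulrC.
apply: (cvg_unique _ L) => //.
have -> : (fun n => \int[P]_w f n w) = fun=> 0 by exact/funext.
exact: cvg_cst.
Qed.

Variables (N : nat) (Y : 'I_N -> Omega -> R).
Hypothesis GY : forall i, G (Y i).

Let lY i : L2 P (Y i). Proof. exact: G_L2. Qed.

Lemma cell_moment_project M (enc : N.-tuple R -> 'I_M) W W' m :
  (forall m, measurable (enc @^-1` [set m])) -> G W -> G W' ->
  (forall i, \int[P]_w ((W w - W' w) * Y i w) = 0) ->
  cell_moment P (enc \o tuple_of_fun Y) W m = cell_moment P (enc \o tuple_of_fun Y) W' m.
Proof.
move=> menc GW GW' orth.
have Gd : G (fun w => W w - W' w).
  by have := G_lin (-1) GW GW'; congr G; apply/funext => w; rewrite mulN1r.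
have ld := G_L2 Gd.
have mY i : measurable_fun setT (Y i) by exact: L2_mfun (lY i).
have mcell k : measurable ((enc \o tuple_of_fun Y) @^-1` [set k]).
  rewrite comp_preimage -[X in measurable X]setTI.
  by apply: (measurable_tuple_of_fun mY) => //; exact: menc.
have := cos_orth_tuple (L2_intg ld) mY _ (menc m) => /(_ _)/wrap[v u|].
  apply: gaussian_orth_cos => //; first exact: linear_set_sum.
  by rewrite Rint_linear_combination// big1// => i _; rewrite orth mulr0.
have -> : \int[P]_w ((W w - W' w) * \1_(enc @^-1` [set m]) (tuple_of_fun Y w)) =
  \int[P]_w (W w * cell (enc \o tuple_of_fun Y) m w -
     W' w * cell (enc \o tuple_of_fun Y) m w).
  apply: Rint_eq => w; rewrite -mulrBl cellE indicE; congr (_ * _%:R).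
  by congr nat_of_bool; apply/idP/eqP => [/set_mem//|/= h]; exact: mem_set.
rewrite RintB; [|exact: (intg_cell mcell m (L2_intg (G_L2 GW)))|
  exact: (intg_cell mcell m (L2_intg (G_L2 GW')))].
by move/eqP; rewrite subr_eq0 => /eqP.
Qed.

Variables (n : nat) (X : 'I_n -> Omega -> R).
Hypothesis GX : forall k, G (X k).

Let lX k : L2 P (X k). Proof. exact: G_L2. Qed.

Lemma gaussian_diagonalisation :
  exists (U : 'M[R]_n) (D : 'I_n -> R) (A : 'M[R]_(n, N)),
  let Z j w := \sum_i A j i * Y i w in
  [/\ U *m U^T = 1%:M, (#|[pred j | D j != 0%R]| <= N)%N,
      (forall i j, \int[P]_w (Z i w * Z j w) = D j *+ (i == j)),
      (forall j, \int[P]_w ((\sum_k U j k * X k w) * Z j w) = D j) &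
      (forall k i, \int[P]_w ((X k w - \sum_j U j k * Z j w) * Y i w) = 0)].
Proof.
pose Gam : 'M[R]_N := \matrix_(i, j) \int[P]_w (Y i w * Y j w).
pose c : 'M[R]_(n, N) := \matrix_(k, j) \int[P]_w (X k w * Y j w).
pose lin m (B : 'M[R]_(m, N)) j w := \sum_i B j i * Y i w.
have llin m (B : 'M[R]_(m, N)) j : L2 P (lin m B j) by apply: L2_sum => i _; exact: L2Z.
have linY m (B : 'M[R]_(m, N)) i j : \int[P]_w (lin m B i w * Y j w) = (B *m Gam) i j.
  under Rint_eq do rewrite mulrC.
  rewrite Rint_linear_combination// mxE; apply: eq_bigr => k _; rewrite mxE.
  by congr (_ * _); apply: Rint_eq => w; rewrite mulrC.
have lin2 m1 m2 (B1 : 'M[R]_(m1, N)) (B2 : 'M[R]_(m2, N)) i j :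
    \int[P]_w (lin m1 B1 i w * lin m2 B2 j w) = (B1 *m Gam *m B2^T) i j.
  rewrite Rint_linear_combination// mxE; apply: eq_bigr => k _.
  by rewrite linY [X in _ = _ * X]mxE mulrC.
have Xlin m (B : 'M[R]_(m, N)) k j : \int[P]_w (X k w * lin m B j w) = (c *m B^T) k j.
  rewrite Rint_linear_combination// mxE; apply: eq_bigr => i _.
  by rewrite !mxE mulrC.
have sG : Gam^T = Gam.
  by apply/matrixP => i j; rewrite !mxE; apply: Rint_eq => w; rewrite mulrC.
have cG (v : 'cV[R]_N) : Gam *m v = 0 -> c *m v = 0.
  move=> gv; apply/matrixP => k j; rewrite (ord1 j) [RHS]mxE.
  rewrite -[v]trmxK -Xlin.
  under Rint_eq do rewrite mulrC.
  apply: (Rint_eq0_sqr (llin _ v^T 0)) => //.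
  under Rint_eq do rewrite expr2.
  by rewrite lin2 trmxK -mulmxA gv mulmx0 mxE.
have [L [U [D [LG UU UD cD]]]] := gram_diagonalisation sG cG.
exists U, (fun j => D ord0 j), (U *m L) => Z.
have AD : (U *m L) *m Gam *m (U *m L)^T = diag_mx D.
  by rewrite trmx_mul -UD !mulmxA.
split=> //.
- by move=> i j; rewrite lin2 AD mxE; case: eqVneq => [->|].
- move=> j; have lZ : L2 P (Z j) by exact: llin.
  under Rint_eq do rewrite mulrC.
  rewrite Rint_linear_combination//.
  transitivity ((U *m (c *m (U *m L)^T)) j j).
    rewrite mxE; apply: eq_bigr => k _; rewrite -Xlin.
    by congr (_ * _); apply: Rint_eq => w; rewrite mulrC.
  by rewrite -LG !mulmxA AD mxE eqxx mulr1n.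
- move=> k i.
  have -> : \int[P]_w ((X k w - \sum_j U j k * Z j w) * Y i w) =
      \int[P]_w (X k w * Y i w - lin _ L k w * Y i w).
    apply: Rint_eq => w; rewrite -mulrBl; congr ((_ - _) * _).
    have -> : L = U^T *m (U *m L) by rewrite mulmxA (mulmx1C UU) mul1mx.
    rewrite /Z /lin.
    under [RHS]eq_bigr do rewrite mxE mulr_suml.
    rewrite exchange_big/=; apply: eq_bigr => j _; rewrite mulr_sumr.
    apply: eq_bigr => l _; by rewrite [U^T k j]mxE mulrA.
  rewrite RintB; [|exact: L2M|exact: L2M].
  by rewrite linY LG mxE subrr.
Qed.

Lemma gaussian_code_energy M (enc : N.-tuple R -> 'I_M) :
  (0 < M)%N -> (forall m, measurable (enc @^-1` [set m])) ->
  exists (U : 'M[R]_n) (D : 'I_n -> R) (A : 'M[R]_(n, N)),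
  let Z j w := \sum_i A j i * Y i w in
  [/\ U *m U^T = 1%:M, (#|[pred j | D j != 0%R]| <= N)%N,
      (forall j, \int[P]_w (Z j w ^+ 2) = D j),
      (forall j, \int[P]_w ((\sum_k U j k * X k w) * Z j w) = D j) &
      forall theta dl : R, 0 < theta -> 0 < dl ->
        dl * \sum_k decoded_energy P (enc \o tuple_of_fun Y) (X k) <=
        \sum_(j | D j != 0) waterfill theta (dl * D j) + 2 * theta * ln M%:R].
Proof.
move=> M0 menc; have [U [D [A [UU cD ZZ XZ res]]]] := gaussian_diagonalisation.
exists U, D, A => Z; rewrite -/Z in ZZ XZ res.
have Z2 j : \int[P]_w (Z j w ^+ 2) = D j.
  by under Rint_eq do rewrite expr2; rewrite ZZ eqxx.
split=> // theta dl t0 d0.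
set E := enc \o _.
have mY i : measurable_fun setT (Y i) by exact: L2_mfun (lY i).
have mE m : measurable (E @^-1` [set m]).
  rewrite comp_preimage -[X in measurable X]setTI.
  by apply: (measurable_tuple_of_fun mY) => //; exact: menc.
have GZ j : G (Z j) by exact: linear_set_sum.
have lZ j : L2 P (Z j) by exact: G_L2.
have GXt k : G (fun w => \sum_j U j k * Z j w) by exact: linear_set_sum.
have momX k m : cell_moment P E (X k) m = \sum_j U j k * cell_moment P E (Z j) m.
  rewrite (cell_moment_project m menc (GX k) (GXt k) (res k)).
  rewrite /cell_moment; under Rint_eq do rewrite mulrC.
  rewrite Rint_linear_combination//; last exact: L2_cell.
  by apply: eq_bigr => j _; congr (_ * _); apply: Rint_eq => w; rewrite mulrC.
have -> : \sum_k decoded_energy P E (X k) = \sum_j decoded_energy P E (Z j).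
  rewrite exchange_big [RHS]exchange_big/=; apply: eq_bigr => m _.
  rewrite -!mulr_suml; congr (_ / _).
  under eq_bigr do rewrite momX.
  have UtU : U^T *m U = 1%:M by exact: mulmx1C.
  pose z : 'rV[R]_n := \row_j cell_moment P E (Z j) m.
  transitivity ((z *m U *m (z *m U)^T) 0 0).
    rewrite mxE; apply: eq_bigr => k _; rewrite [X in _ = _ * X]mxE -expr2 mxE.
    by congr (_ ^+ 2); apply: eq_bigr => j _; rewrite mxE mulrC.
  rewrite trmx_mul mulmxA -(mulmxA z) UU mulmx1 mxE.
  by apply: eq_bigr => j _; rewrite !mxE -expr2.
rewrite (bigID (fun j => D j != 0))/= [X in _ * (_ + X)]big1 ?addr0; last first.
  move=> j; rewrite negbK => /eqP Dj; apply/eqP; rewrite eq_le decoded_energy_ge0 andbT.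
  by rewrite -Dj -Z2; exact: decoded_energy_le.
pose J := [pred j | D j != 0].
have D0 j : 0 <= D j by rewrite -Z2; apply: Rint_ge0 => w; exact: sqr_ge0.
pose j_ (i : 'I_#|J|) := enum_val i.
have Dj i : 0 < D (j_ i).
  by rewrite lt_def D0 andbT; have := enum_valP i; rewrite inE.
pose s i := Num.sqrt (D (j_ i)).
have s0 i : 0 < s i by rewrite sqrtr_gt0.
have s2 i : s i ^+ 2 = D (j_ i) by rewrite sqr_sqrtr.
pose g i w := (s i)^-1 * Z (j_ i) w.
have lg i : L2 P (g i) by exact: L2Z.
have Gg i : G (g i).
  by have := G_lin (s i)^-1 G0 (GZ (j_ i)); congr G; apply/funext => w; rewrite add0r.
have gg i k : \int[P]_w (g i w * g k w) = (i == k)%:R.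
  have -> : \int[P]_w (g i w * g k w) =
     \int[P]_w (((s i)^-1 * (s k)^-1) * (Z (j_ i) w * Z (j_ k) w)).
    by apply: Rint_eq => w; rewrite /g; ring.
  rewrite RintZ ?ZZ; last exact: L2M.
  rewrite (inj_eq enum_val_inj); case: eqVneq => [->|_]; last by rewrite mulr0.
  by rewrite mulr1n -s2 expr2 mulrACA mulVf ?mulr1// gt_eqF.
have g1 i : \int[P]_w (g i w ^+ 2) = 1.
  by under Rint_eq do rewrite expr2; rewrite gg eqxx.
have std : standard_normal_cos P g.
  move=> v u.
  have Gu : G (fun w => \sum_i u i * g i w) by exact: linear_set_sum.
  have := G_cos Gu v => ->; suff -> : \int[P]_w ((\sum_i u i * g i w) ^+ 2) = \sum_i u i ^+ 2 by [].
  under Rint_eq do rewrite expr2.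
  rewrite Rint_linear_combination//; last exact: G_L2.
  apply: eq_bigr => i _; rewrite expr2; congr (_ * _).
  under Rint_eq do rewrite mulrC.
  rewrite Rint_linear_combination// (bigD1 i)//= gg eqxx mulr1 big1 ?addr0// => k ki.
  by rewrite gg eq_sym (negbTE ki) mulr0.
have reind (F : 'I_n -> R) : \sum_(j | D j != 0) F j = \sum_i F (j_ i).
  by rewrite -(big_enum_val (A := J) F).
rewrite !reind.
have eZ i : decoded_energy P E (Z (j_ i)) = D (j_ i) * decoded_energy P E (g i).
  rewrite /decoded_energy mulr_sumr; apply: eq_bigr => m _.
  have -> : cell_moment P E (g i) m = (s i)^-1 * cell_moment P E (Z (j_ i)) m.
    rewrite /cell_moment -RintZ; last exact: (intg_cell mE m (L2_intg (lZ _))).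
    by apply: Rint_eq => w; rewrite /g mulrA.
  by rewrite -s2 mulrA; congr (_ / _); field; rewrite gt_eqF.
rewrite mulr_sumr; under eq_bigr do rewrite eZ mulrA.
apply: (@energy_waterfill_le _ _ _ P M E mE M0 _ g lg g1 std (fun i => dl * D (j_ i))) => // i.
by rewrite mulr_ge0 ?ltW.
Qed.

End gaussian_space.

(** * Sampling in time *)

Section discretisation.
Context {R : realType}.
Local Notation leb := (@lebesgue_measure R).

Lemma Rint_indicM (A : set R) (f : R -> R) :
  \int[leb]_(x in A) f x = \int[leb]_x (f x * \1_A x).
Proof.
rewrite Rintegral_mkcond; apply: Rint_eq => x; rewrite patchE indicE.
by case: (x \in A); rewrite ?mulr1 ?mulr0.
Qed.

Variables (S : R -> R) (theta dl t0 : R) (n : nat).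
Hypotheses (iS : intg leb S) (S0 : forall f, 0 <= S f) (theta_gt0 : 0 < theta)
  (dl_gt0 : 0 < dl).

Definition grid (k : 'I_n) : R := t0 + k%:R * dl.

Variable (U : 'M[R]_n).
Hypothesis UU : U *m U^T = 1%:M.

Lemma trig_energy_period j : let A := `[- (2 * dl)^-1, (2 * dl)^-1]%classic in
  intg leb (fun f => dl * trig_energy (U j) grid f * \1_A f) /\
  \int[leb]_f (dl * trig_energy (U j) grid f * \1_A f) = 1.
Proof.
move=> A.
have iA : intg leb (\1_A : R -> R) by exact: integrable_indic_itv.
have E f : dl * trig_energy (U j) grid f * \1_A f =
    \sum_k \sum_l (dl * (U j k * U j l)) *
      (\1_A f * cos (2 * pi * f * (k%:R * dl - l%:R * dl))).
  rewrite trig_energyE mulr_sumr mulr_suml; apply: eq_bigr => k _.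
  rewrite mulr_sumr mulr_suml; apply: eq_bigr => l _.
  rewrite /grid (_ : t0 + _ - _ = k%:R * dl - l%:R * dl); last by ring.
  by rewrite -/A; ring.
have ic (k l : 'I_n) :
    intg leb (fun f => \1_A f * cos (2 * pi * f * (k%:R * dl - l%:R * dl))).
  apply: (intgMb (C := 1)) => //; last by move=> f; exact: cos_max.
  by apply: measurableT_comp measurable_cos _; apply: measurable_funM.
have ic2 (k l : 'I_n) : intg leb (fun f => (dl * (U j k * U j l)) *
    (\1_A f * cos (2 * pi * f * (k%:R * dl - l%:R * dl)))) by exact: intgZ.
have ic3 (k : 'I_n) : intg leb (fun f => \sum_l (dl * (U j k * U j l)) *
    (\1_A f * cos (2 * pi * f * (k%:R * dl - l%:R * dl)))).
  by apply: intg_sum => l _; exact: ic2.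
rewrite (funext E); split; first by apply: intg_sum => k _; exact: ic3.
rewrite Rint_sum => [|k _]; last exact: ic3.
transitivity ((U *m U^T) j j); last by rewrite UU mxE eqxx.
rewrite mxE; apply: eq_bigr => k _.
rewrite Rint_sum => [|l _]; last exact: ic2.
have Ekl (l : 'I_n) : \int[leb]_f ((dl * (U j k * U j l)) *
    (\1_A f * cos (2 * pi * f * (k%:R * dl - l%:R * dl)))) =
    (k == l)%:R * (U j k * U j l).
  rewrite RintZ//.
  have -> : \int[leb]_f (\1_A f * cos (2 * pi * f * (k%:R * dl - l%:R * dl))) =
      (k == l)%:R / dl.
    rewrite -Rint_cos_period// [RHS]Rint_indicM.
    by apply: Rint_eq => f; rewrite mulrC.
  by field; rewrite gt_eqF.
under eq_bigr do rewrite Ekl.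
rewrite (bigD1 k)//= eqxx mul1r big1 ?addr0 ?mxE// => l lk.
by rewrite eq_sym (negbTE lk) mul0r.
Qed.

Variables (D : 'I_n -> R) (N : nat) (c : R).
Hypotheses (D_ge0 : forall j, 0 <= D j)
  (D_le : forall j, D j <= \int[leb]_f (S f * trig_energy (U j) grid f))
  (cD : (#|[pred j | D j != 0%R]| <= N)%N) (c_ge0 : 0 <= c).

Lemma sum_waterfill_le :
  \sum_(j | D j != 0) waterfill theta (dl * D j) <=
  n%:R * dl * \int[leb]_f Num.max (waterfill theta (S f) - c) 0 + c * N%:R +
  n%:R * dl * \int[leb]_f (S f * \1_(~` `[- (2 * dl)^-1, (2 * dl)^-1]) f).
Proof.
set A := `[- (2 * dl)^-1, (2 * dl)^-1]%classic.
have mA : measurable A by exact: measurable_itv.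
have mcA : measurable (~` A) by exact: measurableC.
pose w j f := dl * trig_energy (U j) grid f.
have mw j : measurable_fun setT (w j).
  by apply: measurable_funM => //; exact: measurable_trig_energy.
have w0 j f : 0 <= w j f <= n%:R * dl.
  rewrite /w mulr_ge0 ?(ltW dl_gt0) ?trig_energy_ge0//= mulrC ler_wpM2r ?(ltW dl_gt0)//.
  exact: trig_energy_row_le.
have wb j f : `|w j f| <= n%:R * dl.
  by rewrite ger0_norm; have /andP[] := w0 j f.
pose m f := Num.max (waterfill theta (S f) - c) 0.
have im : intg leb m.
  apply: (@intg_le _ _ _ leb _ _ _ iS).
    apply: measurable_maxr => //; apply: measurable_funB => //.
    exact: measurableT_comp (measurable_waterfill _) (intg_mfun iS).
  move=> f; rewrite ger0_norm; last by rewrite le_max lexx orbT.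
  rewrite ge_max S0 andbT lerBlDr (le_trans (waterfill_le_id theta_gt0 (S0 f)))//.
  by rewrite lerDl.
have iSA : intg leb (fun f => S f * \1_(~` A) f).
  by apply: (intgMb (C := 1)) => // f; exact: indic_abs_le1.
have imw j : intg leb (fun f => m f * w j f) by exact: intgMb im (mw j) (wb j).
have iSw j : intg leb (fun f => (S f * \1_(~` A) f) * w j f).
  exact: intgMb iSA (mw j) (wb j).
have nn1 j : 0 <= \int[leb]_f (m f * w j f).
  apply: Rint_ge0 => f; rewrite mulr_ge0//; last by have /andP[] := w0 j f.
  by rewrite le_max lexx orbT.
have nn2 j : 0 <= \int[leb]_f ((S f * \1_(~` A) f) * w j f).
  apply: Rint_ge0 => f; rewrite mulr_ge0//; last by have /andP[] := w0 j f.
  by rewrite mulr_ge0// indicE ler0n.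
have sw (h : R -> R) : intg leb h -> \sum_j \int[leb]_f (h f * w j f) =
    n%:R * dl * \int[leb]_f h f.
  move=> ih; rewrite -Rint_sum => [|j _]; last exact: intgMb ih (mw j) (wb j).
  rewrite -RintZ//; apply: Rint_eq => f; rewrite -mulr_sumr -mulr_sumr.
  by rewrite trig_energy_sum//; ring.
have step j : waterfill theta (dl * D j) <=
    \int[leb]_f (m f * w j f) + c + \int[leb]_f ((S f * \1_(~` A) f) * w j f).
  have [le_t|gt_t] := leP (dl * D j) theta.
    rewrite waterfill_le ?mulr_ge0 ?(ltW dl_gt0)//.
    by rewrite addr_ge0// addr_ge0.
  have [iw w1] := trig_energy_period j.
  have h := @waterfill_jensen R theta theta_gt0 S (w j) A (dl * D j) c (n%:R * dl)
    mA iS (mw j) S0 (w0 j) c_ge0 iw w1 gt_t.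
  apply: le_trans (h _) _.
    apply: le_trans (ler_wpM2l (ltW dl_gt0) (D_le j)) _.
    have iSt : intg leb (fun f => S f * trig_energy (U j) grid f).
      apply: (intgMb (C := n%:R)) => //; first exact: measurable_trig_energy.
      move=> f; rewrite ger0_norm ?trig_energy_ge0//; exact: trig_energy_row_le.
    rewrite -RintZ// le_eqVlt; apply/orP; left; apply/eqP.
    by apply: Rint_eq => f; rewrite /w mulrCA.
  rewrite lerD2l le_eqVlt; apply/orP; left; apply/eqP.
  by apply: Rint_eq => f; rewrite -mulrA [w j f * _]mulrC.
apply: (@le_trans _ _ (\sum_(j | D j != 0) (\int[leb]_f (m f * w j f) + c +
    \int[leb]_f ((S f * \1_(~` A) f) * w j f)))).
  by apply: ler_sum => j _; exact: step.
rewrite !big_split/= -(sw _ im) -(sw _ iSA).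
have part (F : 'I_n -> R) : (forall j, 0 <= F j) -> \sum_(j | D j != 0) F j <= \sum_j F j.
  by move=> F0; rewrite [leRHS](bigID (fun j => D j != 0))/= lerDl sumr_ge0.
rewrite lerD ?part// lerD ?part//.
rewrite sumr_const -[c *+ _]mulr_natr ler_wpM2l// ler_nat.
exact: cD.
Qed.

End discretisation.

Section mean_square_continuity.
Context {R : realType} {d : measure_display} {Omega : measurableType d}.
Variable P : probability Omega R.
Variables (X : R -> {RV P >-> R}) (S_X : R -> R).
Hypothesis X_psd : has_psd X S_X.
Local Notation leb := (@lebesgue_measure R).

Let lX t : L2 P (X t). Proof. by have [] := psd_moment X_psd t t. Qed.
Let iX : intg leb S_X. Proof. by case: X_psd. Qed.

Lemma Rint_sqr_le (f : Omega -> R) : L2 P f ->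
  (\int[P]_w f w) ^+ 2 <= \int[P]_w (f w ^+ 2).
Proof.
move=> lf; set m := \int[P]_w f w.
have if1 : intg P (fun w => 2 * m * f w) by apply: intgZ; exact: L2_intg.
have if2 := L2_sqr lf.
have : 0 <= \int[P]_w ((f w ^+ 2 - 2 * m * f w) + m ^+ 2).
  by apply: Rint_ge0 => w; rewrite (_ : _ + _ = (f w - m) ^+ 2) ?sqr_ge0//; ring.
rewrite RintD; [|exact: intgB|exact: intg_cst].
rewrite RintB// RintZ ?Rint_cst; last exact: L2_intg.
rewrite -/m; lra.
Qed.

Lemma signal_power t : \int[P]_w (X t w ^+ 2) = \int[leb]_f S_X f.
Proof.
have [_] := psd_moment X_psd t t; under Rint_eq do rewrite -expr2.
by move=> ->; apply: Rint_eq => f; rewrite subrr mulr0 mul0r cos0 mulr1.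
Qed.

Lemma mean_square_continuous (u : nat -> R) (t : R) : u n @[n --> \oo] --> t ->
  \int[P]_w ((X (u n) w - X t w) ^+ 2) @[n --> \oo] --> (0 : R).
Proof.
move=> ut.
have E n : \int[P]_w ((X (u n) w - X t w) ^+ 2) =
    2 * \int[leb]_f S_X f - 2 * \int[leb]_f (S_X f * cos (2 * pi * (u n - t) * f)).
  have i1 := L2_sqr (lX (u n)); have i2 := L2_sqr (lX t); have i3 := L2M (lX (u n)) (lX t).
  have -> : \int[P]_w ((X (u n) w - X t w) ^+ 2) =
      \int[P]_w (X (u n) w ^+ 2 + X t w ^+ 2 - 2 * (X (u n) w * X t w)).
    by apply: Rint_eq => w; ring.
  rewrite RintB; [|exact: intgD|exact: intgZ].
  rewrite RintD// RintZ// !signal_power; have [_ ->] := psd_moment X_psd (u n) t.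
  lra.
have -> : (fun n => \int[P]_w ((X (u n) w - X t w) ^+ 2)) = (fun n =>
    2 * \int[leb]_f S_X f - 2 * \int[leb]_f (S_X f * cos (2 * pi * (u n - t) * f))).
  exact/funext.
rewrite -(subrr (2 * \int[leb]_f S_X f)).
apply: cvgB; first exact: cvg_cst.
apply: cvgM; first exact: cvg_cst.
have m1 n : measurable_fun setT (fun f => S_X f * cos (2 * pi * (u n - t) * f)).
  exact: intg_mfun (intg_cos _ iX).
have c1 (f : R) : (S_X f * cos (2 * pi * (u n - t) * f)) @[n --> \oo] --> S_X f.
  rewrite -[X in _ --> X]mulr1; apply: cvgM; first exact: cvg_cst.
  rewrite -[X in _ --> X]cos0; apply: continuous_cvg; first exact: continuous_cos.
  have h : (2 * pi * (u n - t) * f) @[n --> \oo] --> 2 * pi * (t - t) * f.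
    by apply: cvgMl; apply: cvgMr; apply: cvgB => //; exact: cvg_cst.
  by move: h; rewrite subrr mulr0 mul0r.
have b1 n (f : R) : `|S_X f * cos (2 * pi * (u n - t) * f)| <= `|S_X f|.
  by rewrite normrM ler_piMr// cos_max.
by have [_ L] := @Rint_dct _ _ _ leb _ _ _ m1 c1 b1 (intg_norm iX).
Qed.

Variables (M : nat) (enc : Omega -> 'I_M).
Hypothesis measurable_cell : forall m, measurable (enc @^-1` [set m]).

Lemma decoded_energy_continuous (u : nat -> R) (t : R) : u n @[n --> \oo] --> t ->
  decoded_energy P enc (X (u n)) @[n --> \oo] --> decoded_energy P enc (X t).
Proof.
move=> ut.
have cm m : cell_moment P enc (X (u n)) m @[n --> \oo] --> cell_moment P enc (X t) m.
  apply/cvgrPdist_le => e e0.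
  have /cvgrPdist_le/(_ (e ^+ 2) (exprn_gt0 2 e0)) := mean_square_continuous ut.
  apply: filterS => n; rewrite sub0r normrN => h.
  have l1 : L2 P (fun w => (X (u n) w - X t w) * cell enc m w).
    apply: (L2Mb (C := 1)); [exact: L2B|exact: measurable_cell_fun|].
    by move=> w; exact: cell_abs_le1.
  rewrite distrC -(@ler_pXn2r _ 2)// ?nnegrE ?(ltW e0)// real_normK ?num_real//.
  apply: le_trans h; rewrite ger0_norm; last by apply: Rint_ge0 => w; exact: sqr_ge0.
  rewrite /cell_moment -RintB; [|exact: (intg_cell measurable_cell m (L2_intg (lX _)))..].
  apply: (@le_trans _ _ (\int[P]_w (((X (u n) w - X t w) * cell enc m w) ^+ 2))).
    apply: le_trans (Rint_sqr_le l1); rewrite le_eqVlt; apply/orP; left; apply/eqP.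
    by congr (_ ^+ 2); apply: Rint_eq => w; rewrite mulrBl.
  apply: Rint_le; [exact: L2_sqr|by apply: L2_sqr; exact: L2B|] => w.
  rewrite exprMn ler_piMr ?sqr_ge0// cell_sqr.
  exact: le_trans (ler_norm _) (cell_abs_le1 _ _ _).
apply: cvg_big => [|m _]; first exact: add_continuous.
apply: cvgM; last exact: cvg_cst.
by apply: cvgM; exact: cm.
Qed.

End mean_square_continuity.

Section riemann.
Context {R : realType}.
Local Notation leb := (@lebesgue_measure R).

Lemma Rint_indic_ico (a b : R) : a <= b ->
  intg leb (\1_(`[a, b[%classic) : R -> R) /\
  \int[leb]_x (\1_(`[a, b[%classic) : R -> R) x = b - a.
Proof.
move=> ab; split; first exact: integrable_indic_itv.
rewrite /Rintegral integral_indic// setIT.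
have := @lebesgue_measure_itv R `[a, b[; rewrite /= lte_fin => e.
rewrite [X in fine X]e; case: ltgtP ab => //= -> _.
by rewrite subrr.
Qed.

Lemma truncn_approx (x : R) (dl : nat -> R) : 0 <= x -> (forall n, 0 < dl n) ->
  dl n @[n --> \oo] --> (0 : R) ->
  (Num.truncn (x / dl n))%:R * dl n @[n --> \oo] --> x.
Proof.
move=> x0 d0 dl0.
have h : x - dl n @[n --> \oo] --> x.
  by rewrite -[X in _ --> X]subr0; apply: cvgB => //; exact: cvg_cst.
apply: squeeze_cvgr h (@cvg_cst _ x _ _ _); apply: nearW => n.
have xd : 0 <= x / dl n by rewrite divr_ge0// ltW.
have /andP[h1 h2] := truncn_itv xd.
apply/andP; split; last by rewrite -ler_pdivlMr.
rewrite lerBlDr -[X in _ + X]mul1r -mulrDl -ler_pdivrMr//.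
by rewrite -natr1 in h2; exact: ltW.
Qed.

Lemma riemann_sum_le (h : R -> R) (a T K B : R) (b : nat -> R) : 0 < T ->
  (forall t, `|h t| <= K) ->
  (forall (u : nat -> R) t, u n @[n --> \oo] --> t -> h (u n) @[n --> \oo] --> h t) ->
  (forall n, T / n.+1%:R * \sum_(k < n.+1) h (a + k%:R * (T / n.+1%:R)) <= B + b n) ->
  b n @[n --> \oo] --> (0 : R) ->
  intg leb (fun t => h t * \1_(`[a, a + T[%classic) t) /\
  \int[leb]_t (h t * \1_(`[a, a + T[%classic) t) <= B.
Proof.
move=> T0 hK hc hB b0.
pose dl n : R := T / n.+1%:R.
have d0 n : 0 < dl n by rewrite divr_gt0.
pose J := `[a, a + T[%classic : set R.
pose Jk n (k : nat) := `[a + k%:R * dl n, a + k%:R * dl n + dl n[%classic : set R.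
pose F n t := \sum_(k < n.+1) h (a + k%:R * dl n) * \1_(Jk n k) t.
have nd n : n.+1%:R * dl n = T by rewrite /dl mulrCA divff ?mulr1// pnatr_eq0.
have iJk n k : intg leb (\1_(Jk n k) : R -> R) /\ \int[leb]_x (\1_(Jk n k) : R -> R) x = dl n.
  have [|i1 ->] := @Rint_indic_ico (a + k%:R * dl n) (a + k%:R * dl n + dl n).
    by rewrite lerDl ltW.
  by split=> //; ring.
have [iJ IJ] : intg leb (\1_J : R -> R) /\ \int[leb]_x (\1_J : R -> R) x = a + T - a.
  by apply: Rint_indic_ico; rewrite lerDl ltW.
have FE n t : F n t = h (a + (Num.truncn ((t - a) / dl n))%:R * dl n) * \1_J t.
  have inJk k : (t \in Jk n k) = (k%:R <= (t - a) / dl n < k.+1%:R).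
    rewrite mem_setE in_itv/= ler_pdivlMr// ltr_pdivrMr// -natr1 mulrDl mul1r.
    by rewrite lerBrDl ltrBlDl addrA.
  have [tJ|tJ] := boolP (t \in J); last first.
    rewrite indicE (negbTE tJ) mulr0 /F big1// => k _; rewrite indicE inJk.
    case: (boolP (_ <= _ < _)) => [/andP[h1 h2]|_]; last by rewrite mulr0.
    move: tJ; rewrite mem_setE in_itv/= -subr_ge0 => /negP[]; apply/andP; split.
      by move: h1; rewrite ler_pdivlMr//; apply: le_trans; rewrite mulr_ge0// ltW.
    rewrite -ltrBlDl -(nd n) -ltr_pdivrMr//; apply: lt_le_trans h2 _.
    by rewrite ler_nat; exact: ltn_ord.
  have /andP[aJ bJ] : a <= t < a + T by move: tJ; rewrite mem_setE in_itv.
  have x0 : 0 <= (t - a) / dl n by rewrite divr_ge0 ?subr_ge0// ltW.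
  have kn : (Num.truncn ((t - a) / dl n) < n.+1)%N.
    rewrite -(ltr_nat R); apply: le_lt_trans (_ : (t - a) / dl n < _).
      by have /andP[] := truncn_itv x0.
    by rewrite ltr_pdivrMr// nd ltrBlDl.
  rewrite indicE tJ mulr1 /F (bigD1 (Ordinal kn))//= indicE inJk truncn_itv//= mulr1.
  rewrite big1 ?addr0// => k nk; rewrite indicE inJk -truncn_eq//.
  rewrite (_ : (_ == _) = false) ?mulr0//; apply/negbTE; move: nk; apply: contra.
  by move=> /eqP e; apply/eqP/val_inj.
have iF n : intg leb (F n) by apply: intg_sum => k _; apply: intgZ; have [] := iJk n k.
have IF n : \int[leb]_t F n t <= B + b n.
  apply: le_trans (hB n); rewrite Rint_sum => [|k _]; last first.
    by apply: intgZ; have [] := iJk n k.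
  rewrite mulr_sumr ler_sum// => k _; have [i1 e1] := iJk n k.
  by rewrite RintZ// e1 mulrC.
have dl0 : dl n @[n --> \oo] --> (0 : R).
  rewrite -(mulr0 T); apply: cvgM; [exact: cvg_cst|exact: cvg_harmonic].
have cF t : F n t @[n --> \oo] --> h t * \1_J t.
  under eq_fun do rewrite FE.
  have [tJ|tJ] := boolP (t \in J); last first.
    rewrite indicE (negbTE tJ); under eq_fun do rewrite mulr0.
    by rewrite mulr0; exact: cvg_cst.
  apply: cvgM; last exact: cvg_cst.
  apply: hc; rewrite [X in _ --> X](_ : t = a + (t - a)); last by ring.
  apply: cvgD; first exact: cvg_cst.
  have /andP[aJ bJ] : a <= t < a + T by move: tJ; rewrite mem_setE in_itv.
  by apply: truncn_approx => //; rewrite subr_ge0.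
have bF n t : `|F n t| <= K * \1_J t.
  rewrite FE normrM [X in _ * X <= _]ger0_norm ?ler_wpM2r//; by rewrite indicE.
have [iL L] := @Rint_dct _ _ _ leb _ _ _ (fun n => intg_mfun (iF n)) cF bF (intgZ K iJ).
split=> //.
have Bb : B + b n @[n --> \oo] --> B.
  by rewrite -[X in _ --> X]addr0; apply: cvgD => //; exact: cvg_cst.
apply: ler_cvg_to L Bb _; exact: nearW.
Qed.

End riemann.

Section tail.
Context {R : realType}.
Local Notation leb := (@lebesgue_measure R).

Lemma Rint_tail_cvg0 (S : R -> R) (T : R) : 0 < T -> intg leb S ->
  \int[leb]_f (S f * \1_(~` `[- (2 * (T / n.+1%:R))^-1, (2 * (T / n.+1%:R))^-1]) f)
    @[n --> \oo] --> (0 : R).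
Proof.
move=> T0 iS.
pose B n : R := (2 * (T / n.+1%:R))^-1.
pose A n : set R := ~` `[- B n, B n]%classic.
have iA n : intg leb (fun f => S f * \1_(A n) f).
  apply: (intgMb (C := 1)) => //; last by move=> f; exact: indic_abs_le1.
  by apply: measurable_indic; apply: measurableC; exact: measurable_itv.
have b1 n (f : R) : `|S f * \1_(A n) f| <= `|S f|.
  by rewrite normrM ler_piMr// indic_abs_le1.
have c1 (f : R) : S f * \1_(A n) f @[n --> \oo] --> (fun=> 0 : R) f.
  apply: cvg_near_cst; exists (Num.truncn (2 * T * `|f|)) => // n /= hn.
  have h : `|f| <= B n.
    have -> : B n = n.+1%:R / (2 * T).
      by rewrite /B; field; rewrite gt_eqF//= pnatr_eq0.
    rewrite ler_pdivlMr ?mulr_gt0// mulrC.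
    have x0 : 0 <= 2 * T * `|f| by rewrite mulr_ge0// mulr_ge0// ltW.
    have /andP[_ /ltW/le_trans] := truncn_itv x0; apply.
    by rewrite ler_nat ltnS.
  rewrite indicE memNset ?mulr0// /A/= in_itv/= => nh; apply: nh.
  by move: h; rewrite ler_norml.
have [_ L] := @Rint_dct _ _ _ leb _ _ _ (fun n => intg_mfun (iA n)) c1 b1 (intg_norm iS).
by move: L; rewrite Rint0.
Qed.

End tail.

Section assembly.
Context {R : realType} {d : measure_display} {Omega : measurableType d}.
Variables (P : probability Omega R) (X eps : R -> {RV P >-> R}) (S_X S_eps : R -> R).
Hypotheses (X_gaussian : gaussian_process X) (X_zero_mean : zero_mean X)
  (X_psd : has_psd X S_X) (eps_gaussian : gaussian_process eps)
  (eps_zero_mean : zero_mean eps) (eps_psd : has_psd eps S_eps)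
  (X_eps_indep : independent_processes X eps).
Local Notation leb := (@lebesgue_measure R).
Local Notation S := (S_cond S_X S_eps).

Variables (theta c : R).
Hypotheses (theta_gt0 : 0 < theta) (c_ge0 : 0 <= c).

Variables (N : nat) (Y : 'I_N -> Omega -> R).
Hypothesis Y_obs : forall i, L2closure P (observations X eps) (Y i).
Variables (M : nat) (enc : N.-tuple R -> 'I_M).
Hypotheses (M_gt0 : (0 < M)%N) (menc : forall m, measurable (enc @^-1` [set m])).

Let SX0 f : 0 <= S_X f. Proof. by case: X_psd => h _ _; exact: h. Qed.
Let Se0 f : 0 <= S_eps f. Proof. by case: eps_psd => h _ _; exact: h. Qed.
Let iX : intg leb S_X. Proof. by case: X_psd. Qed.
Let ie : intg leb S_eps. Proof. by case: eps_psd. Qed.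
Let iS : intg leb S. Proof. exact: intg_S_cond. Qed.
Let S0 f : 0 <= S f. Proof. exact: S_cond_ge0. Qed.
Let lX t : L2 P (X t). Proof. by have [] := psd_moment X_psd t t. Qed.

Let energy t := decoded_energy P (enc \o tuple_of_fun Y) (X t).

Let excess := \int[leb]_f Num.max (waterfill theta (S f) - c) 0.

Let G := L2closure P (linear_observables X eps).

Let G_lin : linear_set G.
Proof.
by move=> f g a; apply: L2closure_lin; exact: linear_observables_linear.
Qed.

Let G0 : G (fun=> 0).
Proof.
by apply: subset_L2closure; [exact: L2_cst|exact: linear_observables0].
Qed.

Let G_L2 f : G f -> L2 P f. Proof. exact: L2closure_L2. Qed.

Let G_cos : G `<=` gaussian_cosine P.
Proof.
move=> f; apply: L2closure_gaussian; exact: (@linear_observables_gaussian _ _ _ _ _ _ S_X S_eps).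
Qed.

Let GX t : G (X t).
Proof. by apply: subset_L2closure => //; exact: signal_observable. Qed.

Let GY i : G (Y i).
Proof. apply: L2closure_mono (Y_obs i); exact: observations_linear_observables. Qed.

Lemma sampled_energy_le (n : nat) (t0 dl : R) : 0 < dl ->
  dl * \sum_(k < n) energy (t0 + k%:R * dl) <=
  n%:R * dl * excess + c * N%:R + 2 * theta * ln M%:R +
  n%:R * dl * \int[leb]_f (S f * \1_(~` `[- (2 * dl)^-1, (2 * dl)^-1]) f).
Proof.
move=> d0.
have [U [D [A [UU cD ZZ XZ]]]] := @gaussian_code_energy _ _ _ P G G_lin G0 G_L2 G_cos
   N Y GY n (fun k => X (t0 + k%:R * dl)) (fun k => GX _) M enc M_gt0 menc.
move=> /(_ theta dl theta_gt0 d0) le1.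
apply: le_trans le1 _.
rewrite addrAC lerD2r.
apply: (@sum_waterfill_le _ _ _ _ t0 _ iS S0 theta_gt0 d0 U UU D N c _ _ cD c_ge0).
  by move=> j; rewrite -ZZ; apply: Rint_ge0 => w; exact: sqr_ge0.
move=> j; set Z := fun w => \sum_i A j i * Y i w.
have ZO : L2closure P (observations X eps) Z.
  by apply: L2closure_sum => //; [exact: observations_linear|exact: observations0].
have := spectral_inequality X_gaussian X_zero_mean X_psd eps_gaussian eps_zero_mean
   eps_psd X_eps_indep (U j) (@grid _ dl t0 n) ZO.
by rewrite ZZ (XZ j); apply: le_trans; lra.
Qed.

Lemma energy_integral_le (a T : R) : 0 < T ->
  intg leb (fun t => energy t * \1_(`[a, a + T[%classic) t) /\
  \int[leb]_t (energy t * \1_(`[a, a + T[%classic) t) <=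
    T * excess + c * N%:R + 2 * theta * ln M%:R.
Proof.
move=> T0.
have mY i : measurable_fun setT (Y i) by exact: L2_mfun (G_L2 (GY i)).
have mE m : measurable ((enc \o tuple_of_fun Y) @^-1` [set m]).
  rewrite comp_preimage -[X in measurable X]setTI.
  by apply: (measurable_tuple_of_fun mY) => //; exact: menc.
apply: (@riemann_sum_le _ _ _ _ (\int[leb]_f S_X f) _ (fun n => T *
    \int[leb]_f (S f * \1_(~` `[- (2 * (T / n.+1%:R))^-1, (2 * (T / n.+1%:R))^-1]) f))) => //.
- move=> t; rewrite ger0_norm ?decoded_energy_ge0// -(signal_power X_psd t).
  exact: decoded_energy_le.
- by move=> u t; exact: (decoded_energy_continuous X_psd mE).
- move=> n; have d0 : 0 < T / n.+1%:R by rewrite divr_gt0.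
  have := sampled_energy_le n.+1 a d0.
  by rewrite [n.+1%:R * _]mulrCA divff ?mulr1// pnatr_eq0.
- by rewrite -(mulr0 T); apply: cvgM; [exact: cvg_cst|exact: Rint_tail_cvg0].
Qed.

Lemma mean_square_error_ge (dec : 'I_M -> R -> R) (T : R) : 0 < T ->
  ((\int[leb]_f S_X f - (excess + (c * N%:R + 2 * theta * ln M%:R) / T))%:E <=
   mean_square_error P (fun t => X t) (fun t w => dec (enc (tuple_of_fun Y w)) t) T)%E.
Proof.
move=> T0.
have mY i : measurable_fun setT (Y i) by exact: L2_mfun (G_L2 (GY i)).
have mE m : measurable ((enc \o tuple_of_fun Y) @^-1` [set m]).
  rewrite comp_preimage -[X in measurable X]setTI.
  by apply: (measurable_tuple_of_fun mY) => //; exact: menc.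
have [iE hE] := energy_integral_le (- (T / 2)) T0.
set a := - (T / 2) in iE hE *; set J := `[a, a + T[%classic in iE hE.
have [iJ IJ] : intg leb (\1_J : R -> R) /\ \int[leb]_x (\1_J : R -> R) x = a + T - a.
  by apply: Rint_indic_ico; rewrite lerDl ltW.
have le1 : ((\int[leb]_t ((\int[leb]_f S_X f) * \1_J t - energy t * \1_J t))%:E <=
   \int[leb]_(t in `[a, (T / 2)%R])
    'E_P[fun w => ((X t w - dec (enc (tuple_of_fun Y w)) t) ^+ 2)%R])%E.
  rewrite -RintE; last by apply: intgB => //; exact: intgZ.
  rewrite [leRHS]integral_mkcond; apply: ge0_le_integral_setT => t _.
    rewrite lee_fin -mulrBl mulr_ge0 ?indicE// subr_ge0 -(signal_power X_psd t).
    exact: decoded_energy_le.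
  rewrite patchE; case: ifPn => [tI|tI]; last first.
    rewrite lee_fin -mulrBl indicE memNset ?mulr0// => tJ; move: tI.
    rewrite notin_setE; apply; move: tJ; rewrite /J/= !in_itv/= => /andP[-> h]/=.
    by rewrite ltW// (lt_le_trans h)// /a; lra.
  rewrite unlock.
  have lD : L2 P (fun w => X t w - dec (enc (tuple_of_fun Y w)) t).
    apply: L2B => //; exact: (L2_decoder P mE (fun m => dec m t)).
  rewrite (RintE (L2_sqr lD)) lee_fin.
  apply: le_trans (decoder_error_ge mE (fun m => dec m t) (lX t)).
  rewrite -mulrBl (signal_power X_psd) ler_piMr//.
  by rewrite subr_ge0 -(signal_power X_psd t); exact: decoded_energy_le.
rewrite /mean_square_error -/a.
apply: le_trans (lee_wpmul2l _ le1); last by rewrite lee_fin invr_ge0 ltW.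
rewrite -EFinM lee_fin RintB ?RintZ//; last exact: intgZ.
rewrite IJ ler_pdivlMl// (_ : a + T - a = T); last by ring.
rewrite mulrBr mulrDr [T * (_ / T)]mulrCA divff ?mulr1 ?gt_eqF//.
rewrite [_ * T]mulrC lerD2l lerN2; lra.
Qed.

End assembly.

Lemma ln_codebook_size_le {R : realType} (T rate : R) : 0 <= T * rate ->
  ln (codebook_size T rate)%:R <= T * rate * ln 2.
Proof.
move=> h; rewrite /codebook_size natrX lnXn// -[_ *+ _]mulr_natl.
rewrite ler_wpM2r//; first by rewrite ln_ge0// ler1n.
by have /andP[] := truncn_itv h.
Qed.

Lemma sampling_times_sub {R : realType} (Lambda : set R) (T : R) i :
  Lambda (tnth (in_tuple (sampling_times Lambda T)) i).
Proof.
set t := tnth _ i.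
have : t \in fset_set (Lambda `&` `[- (T / 2), T / 2]%classic).
  exact: (mem_tnth i (in_tuple (sampling_times Lambda T))).
have [fin|inf] := pselect (finite_set (Lambda `&` `[- (T / 2), T / 2]%classic)).
  by rewrite in_fset_set// => /set_mem[].
by rewrite /fset_set; case: pselect.
Qed.

Lemma limf_esup_lt_near {R : realType} (T : choiceType) (X : filteredType T)
  (f : X -> \bar R) (F : set (set X)) (a : \bar R) :
  (limf_esup f F < a)%E -> exists2 V, F V & forall x, V x -> (f x < a)%E.
Proof.
rewrite limf_esupE => /ereal_inf_lt[_ [V FV <-] h]; exists V => // x Vx.
by apply: le_lt_trans h; apply: ereal_sup_ubound; exists x.
Qed.

Lemma limf_einf_ge_near {R : realType} (T : choiceType) (X : filteredType T)
  (f : X -> \bar R) (F : set (set X)) (a : \bar R) V :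
  F V -> (forall x, V x -> (a <= f x)%E) -> (a <= limf_einf f F)%E.
Proof.
move=> FV h; rewrite limf_einfE; apply: (@le_trans _ _ (ereal_inf (f @` V))).
  by apply: le_ereal_inf_tmp => _ [x Vx <-]; exact: h.
by apply: ereal_sup_ubound; exists V.
Qed.

Section reverse_waterfilling.
Context {R : realType}.
Variables (S : R -> R) (F : set R) (theta rate : R).
Local Notation leb := (@lebesgue_measure R).
Hypotheses (iS : intg leb S) (S0 : forall f, 0 <= S f) (theta_gt0 : 0 < theta)
  (mF : measurable F)
  (rateE : (rate%:E = (2^-1)%:E * \int[leb]_(f in F) (logp (S f / theta))%:E)%E).

Lemma reverse_waterfilling :
  (\int[leb]_(f in F) (Num.max (S f - theta) 0)%:E =
   (\int[leb]_f (waterfill theta (S f) * \1_F f) + 2 * theta * (rate * ln 2))%:E)%E.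
Proof.
have ln2 : 0 < ln 2 :> R by rewrite ln_gt0// ltr1n.
have mS := intg_mfun iS.
have mkc (g : R -> R) : (\int[leb]_(f in F) (g f)%:E = \int[leb]_f (g f * \1_F f)%:E)%E.
  rewrite integral_mkcond; apply: eq_integral => f _; rewrite patchE indicE.
  by case: (f \in F); rewrite ?mulr1 ?mulr0.
pose p f := Num.max (S f - theta) 0.
pose l f := Num.max (ln (S f / theta)) 0.
have mp : measurable_fun setT p.
  by apply: measurable_maxr => //; exact: measurable_funB.
have ml : measurable_fun setT l.
  apply: measurable_maxr => //; apply: (measurableT_comp (@measurable_ln R)).
  exact: measurable_funM.
have p0 f : 0 <= p f by rewrite le_max lexx orbT.
have l0 f : 0 <= l f by rewrite le_max lexx orbT.
have pS f : p f <= S f by rewrite ge_max S0 andbT lerBlDr lerDl ltW.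
have lp f : theta * l f <= p f.
  by have := waterfill_ge0 theta_gt0 (S0 f); rewrite /waterfill subr_ge0.
have ip : intg leb p.
  by apply: (@intg_le _ _ _ leb _ _ mp iS) => f; rewrite ger0_norm.
have itl : intg leb (fun f => theta * l f).
  apply: (@intg_le _ _ _ leb _ _ _ ip); first exact: measurable_funM.
  by move=> f; rewrite ger0_norm// mulr_ge0// ltW.
have mI : measurable_fun setT (\1_F : R -> R) by exact: measurable_indic.
have ipF : intg leb (fun f => p f * \1_F f).
  by apply: (intgMb (C := 1)) => // f; exact: indic_abs_le1.
have itlF : intg leb (fun f => theta * l f * \1_F f).
  by apply: (intgMb (C := 1)) => // f; exact: indic_abs_le1.
have logpE f : logp (S f / theta) * \1_F f = (theta * ln 2)^-1 * (theta * l f * \1_F f).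
  have -> : logp (S f / theta) = (ln 2)^-1 * l f.
    rewrite /logp /log2 /l [X in Num.max X]mulrC maxr_pMr ?invr_ge0 ?(ltW ln2)//.
    by rewrite mulr0.
  by field; rewrite !gt_eqF.
have key : \int[leb]_f (theta * l f * \1_F f) = 2 * theta * (rate * ln 2).
  move: rateE; rewrite mkc.
  have -> : (fun f => (logp (S f / theta) * \1_F f)%:E) =
     (fun f => ((theta * ln 2)^-1 * (theta * l f * \1_F f))%:E).
    by apply/funext => f; rewrite logpE.
  rewrite RintE; last exact: intgZ.
  by rewrite RintZ// -EFinM => -[->]; field; rewrite !gt_eqF.
rewrite mkc RintE// -key -RintD//; last first.
  rewrite (_ : (fun f => _) = (fun f => p f * \1_F f - theta * l f * \1_F f)).
    exact: intgB.
  by apply/funext => f; rewrite /waterfill -mulrBl.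
congr (_%:E); apply: Rint_eq => f; rewrite /waterfill -/(p f) -/(l f); ring.
Qed.

End reverse_waterfilling.

Theorem theorem2 (R : realType) (d : measure_display)
  (Omega : measurableType d) (P : probability Omega R)
  (X eps : R -> {RV P >-> R}) (S_X S_eps : R -> R)
  (X_gaussian : gaussian_process X) (X_zero_mean : zero_mean X)
  (X_stationary : stationary X) (X_psd : has_psd X S_X)
  (eps_gaussian : gaussian_process eps) (eps_zero_mean : zero_mean eps)
  (eps_stationary : stationary eps) (eps_psd : has_psd eps S_eps)
  (X_eps_indep : independent_processes X eps)
  (fs : R) (fs_gt0 : 0 < fs)
  (S : @sampler R)
  (S_bounded : bounded_linear_sampler (fun f => S_X f + S_eps f) S)
  (S_density : (upper_symmetric_density (sampling_set S) <= fs%:E)%E)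
  (Y : R -> {RV P >-> R})
  (Y_samples : samples (fun t w => X t w + eps t w)
                 (fun f => S_X f + S_eps f) S Y)
  (rate : R) (rate_gt0 : 0 < rate)
  (Dstar : \bar R) (Dstar_def : is_Dstar S_X S_eps fs rate Dstar) :
  (Dstar <= distortion X (sampling_set S) Y rate)%E.
Proof.
have [F [theta [F_opt theta_gt0 rateE ->]]] := Dstar_def.
have [SX0 iX _] := X_psd; have [Se0 ie _] := eps_psd.
have iS : intg lebesgue_measure (S_cond S_X S_eps) by exact: intg_S_cond.
have S0 f : 0 <= S_cond S_X S_eps f by exact: S_cond_ge0.
have [mF _ _] := F_opt.
have -> : (\int[lebesgue_measure]_f (S_X f)%:E = (\int[lebesgue_measure]_f S_X f)%:E)%E.
  exact: RintE iX.
rewrite (reverse_waterfilling iS S0 theta_gt0 mF rateE) -EFinB.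
have [c c0 hc] := waterfill_bathtub iS S0 F_opt theta_gt0 fs_gt0.
have lX t : L2 P (X t) by have [] := psd_moment X_psd t t.
have le t : L2 P (eps t) by have [] := psd_moment eps_psd t t.
set W := \int[_]_f (_ * _) in hc *.
apply/lee_addgt0Pr => e e0.
pose e' := e / (c + 1).
have c1 : 0 < c + 1 by rewrite ltr_wpDl.
have e'0 : 0 < e' by rewrite divr_gt0.
have ce : c * e' <= e by rewrite /e' mulrA ler_pdivrMr// mulrC ler_wpM2l ?(ltW e0)//; lra.
have [V FV hV] : exists2 V, pinfty_nbhs R V & forall T, V T ->
    (((nb_samples (sampling_set S) T)%:R / T)%:E < (fs + e')%:E)%E.
  apply: limf_esup_lt_near; apply: le_lt_trans S_density _.
  by rewrite lte_fin ltrDl.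
rewrite -leeBlDr// -EFinB.
have FV' : pinfty_nbhs R (V `&` [set T | 0 < T]).
  by apply: filterI => //; exists 0; split.
apply: (limf_einf_ge_near FV') => T [VT /= T0].
apply: le_ereal_inf_tmp => _ [enc [dec [menc ->]]].
set N := nb_samples (sampling_set S) T in enc menc *.
pose Yv (i : 'I_N) : Omega -> R := Y (tnth (in_tuple (sampling_times (sampling_set S) T)) i).
have YO i : L2closure P (observations X eps) (Yv i).
  apply: (@linear_functional_closure _ _ _ P _ (fun f => S_X f + S_eps f)).
    by move=> t; exact: L2D.
  by apply: Y_samples; exact: sampling_times_sub.
have M0 : (0 < codebook_size T rate)%N by rewrite expn_gt0.
apply: le_trans (mean_square_error_ge X_gaussian X_zero_mean X_psd eps_gaussian
  eps_zero_mean eps_psd X_eps_indep theta_gt0 c0 YO M0 menc dec T0).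
rewrite lee_fin.
have hM : ln (codebook_size T rate)%:R / T <= rate * ln 2.
  rewrite ler_pdivrMr// -mulrC mulrA; apply: ln_codebook_size_le.
  by rewrite mulr_ge0// ltW.
have := hV T VT; rewrite lte_fin -/N => hN.
rewrite [(_ + _) / T]mulrDl -!mulrA.
have h1 : c * (N%:R / T) <= c * (fs + e') by rewrite ler_wpM2l// ltW.
have h2 : 2 * (theta * (ln (codebook_size T rate)%:R / T)) <= 2 * (theta * (rate * ln 2)).
  by rewrite ler_pM2l// ler_pM2l.
rewrite mulrDr in h1; lra.
Qed.
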